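(* Let $A$ be a C*-algebra and $I$ a closed two-sided ideal of $A$. Let $M$ and $N$ be countably generated right Hilbert C*-modules over $A$ and let $\phi\in B(M/MI,N/NI)$ be an adjointable operator. Then there exists an adjointable operator $\Phi\in B(M,N)$ inducing $\phi$ on the quotients, i.e. $\Phi(m)+NI=\phi(m+MI)$ for all $m\in M$.
   Context: For Hilbert modules $M,N$, $B(M,N)$ denotes the adjointable operators from $M$ to $N$. For a Hilbert $A$-module $M$, $MI$ is the closed submodule spanned by $\{mi:m\in M,i\in I\}$, and $M/MI$ is a Hilbert $A/I$-module with inner product $\langle x+MI,y+MI\rangle=\langle x,y\rangle+I$. Every $T\in B(M,N)$ satisfies $T(MI)\subseteq NI$ and induces an operator in $B(M/MI,N/NI)$. A Hilbert module is countably generated if it has a countable subset with dense span. *)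

(* Defs.v *)
From mathcomp Require Import all_boot all_algebra.
From mathcomp Require Import complex reals.
Set Implicit Arguments. Unset Strict Implicit. Unset Printing Implicit Defensive.
Import GRing.Theory Num.Theory.
Local Open Scope ring_scope.
Local Open Scope complex_scope.

Definition cauchy_seq (R : realType) (V : zmodType) (nrm : V -> R)
    (u : nat -> V) : Prop :=
  forall e : R, 0 < e -> exists N : nat, forall m n : nat,
    (N <= m)%N -> (N <= n)%N -> nrm (u m - u n) < e.

Definition converges_to (R : realType) (V : zmodType) (nrm : V -> R)
    (u : nat -> V) (l : V) : Prop :=
  forall e : R, 0 < e -> exists N : nat, forall n : nat,
    (N <= n)%N -> nrm (u n - l) < e.

Definition complete_for (R : realType) (V : zmodType) (nrm : V -> R) : Prop :=
  forall u : nat -> V, cauchy_seq nrm u -> exists l : V, converges_to nrm u l.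

Definition in_closure (R : realType) (V : zmodType) (nrm : V -> R)
    (S : V -> Prop) (x : V) : Prop :=
  forall e : R, 0 < e -> exists y : V, S y /\ nrm (x - y) < e.

Record cstar_algebra (R : realType) (A : lmodType R[i]) := CstarAlgebra {
  cmul : A -> A -> A;
  cstar : A -> A;
  cnorm : A -> R;
  cmulA : forall a b c, cmul a (cmul b c) = cmul (cmul a b) c;
  cmulDl : forall a b c, cmul (a + b) c = cmul a c + cmul b c;
  cmulDr : forall a b c, cmul a (b + c) = cmul a b + cmul a c;
  cmulZl : forall (z : R[i]) a b, cmul (z *: a) b = z *: cmul a b;
  cmulZr : forall (z : R[i]) a b, cmul a (z *: b) = z *: cmul a b;
  cstarD : forall a b, cstar (a + b) = cstar a + cstar b;
  cstarZ : forall (z : R[i]) a, cstar (z *: a) = z^* *: cstar a;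
  cstarK : forall a, cstar (cstar a) = a;
  cstarM : forall a b, cstar (cmul a b) = cmul (cstar b) (cstar a);
  cnorm_ge0 : forall a, 0 <= cnorm a;
  cnorm_eq0 : forall a, cnorm a = 0 -> a = 0;
  cnormD : forall a b, cnorm (a + b) <= cnorm a + cnorm b;
  cnormZ : forall (z : R[i]) a, (cnorm (z *: a))%:C = `|z| * (cnorm a)%:C;
  cnormM : forall a b, cnorm (cmul a b) <= cnorm a * cnorm b;
  cnorm_cstar_id : forall a, cnorm (cmul (cstar a) a) = cnorm a ^+ 2;
  ccomplete : complete_for cnorm
}.

Definition cpositive (R : realType) (A : lmodType R[i]) (cA : cstar_algebra A)
    (a : A) : Prop :=
  exists b : A, a = cmul cA (cstar cA b) b.

Definition closed_ideal (R : realType) (A : lmodType R[i]) (cA : cstar_algebra A)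
    (I : A -> Prop) : Prop :=
  [/\ I 0,
      forall a b, I a -> I b -> I (a + b),
      forall (z : R[i]) a, I a -> I (z *: a),
      forall a b, I b -> I (cmul cA a b) /\ I (cmul cA b a)
    & forall a, in_closure (cnorm cA) I a -> I a].

Record hilbert_module (R : realType) (A : lmodType R[i]) (cA : cstar_algebra A)
    (M : lmodType R[i]) := HilbertModule {
  ract : M -> A -> M;
  ip : M -> M -> A;
  ractDl : forall x y a, ract (x + y) a = ract x a + ract y a;
  ractDr : forall x a b, ract x (a + b) = ract x a + ract x b;
  ractA : forall x a b, ract x (cmul cA a b) = ract (ract x a) b;
  ractZl : forall (z : R[i]) x a, ract (z *: x) a = z *: ract x a;
  ractZr : forall (z : R[i]) x a, ract x (z *: a) = z *: ract x a;
  ipD : forall x y y', ip x (y + y') = ip x y + ip x y';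
  ipZ : forall (z : R[i]) x y, ip x (z *: y) = z *: ip x y;
  ip_ract : forall x y a, ip x (ract y a) = cmul cA (ip x y) a;
  ip_sym : forall x y, ip y x = cstar cA (ip x y);
  ip_pos : forall x, cpositive cA (ip x x);
  ip_def : forall x, ip x x = 0 -> x = 0;
  hcomplete : complete_for (fun x => Num.sqrt (cnorm cA (ip x x)))
}.

Definition hnorm (R : realType) (A : lmodType R[i]) (cA : cstar_algebra A)
    (M : lmodType R[i]) (hM : hilbert_module cA M) (x : M) : R :=
  Num.sqrt (cnorm cA (ip hM x x)).

Definition span_MI (R : realType) (A : lmodType R[i]) (cA : cstar_algebra A)
    (M : lmodType R[i]) (hM : hilbert_module cA M) (I : A -> Prop) (x : M) : Prop :=
  exists (n : nat) (c : 'I_n -> R[i]) (m : 'I_n -> M) (i : 'I_n -> A),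
    (forall k, I (i k)) /\ x = \sum_(k < n) c k *: ract hM (m k) (i k).

Definition modMI (R : realType) (A : lmodType R[i]) (cA : cstar_algebra A)
    (M : lmodType R[i]) (hM : hilbert_module cA M) (I : A -> Prop) (x : M) : Prop :=
  in_closure (hnorm hM) (span_MI hM I) x.

Definition span_gen (R : realType) (A : lmodType R[i]) (cA : cstar_algebra A)
    (M : lmodType R[i]) (hM : hilbert_module cA M) (g : nat -> M) (x : M) : Prop :=
  exists (n : nat) (c d : 'I_n -> R[i]) (j : 'I_n -> nat) (a : 'I_n -> A),
    x = \sum_(k < n) (c k *: g (j k) + d k *: ract hM (g (j k)) (a k)).

Definition countably_generated (R : realType) (A : lmodType R[i])
    (cA : cstar_algebra A) (M : lmodType R[i]) (hM : hilbert_module cA M) : Prop :=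
  exists g : nat -> M, forall x : M, in_closure (hnorm hM) (span_gen hM g) x.

Definition adjointable (R : realType) (A : lmodType R[i]) (cA : cstar_algebra A)
    (M N : lmodType R[i]) (hM : hilbert_module cA M) (hN : hilbert_module cA N)
    (T : M -> N) : Prop :=
  exists Tstar : N -> M, forall (x : M) (y : N), ip hN (T x) y = ip hM x (Tstar y).

(* An operator phi in B(M/MI, N/NI), represented through a lift
   f : M -> N (phi (x + MI) = f x + NI).  f must be well defined on cosets,
   and phi must be adjointable for the A/I-valued inner product
   <x + MI, y + MI> = <x, y> + I, i.e. there is psi (lifted to g : N -> M,
   also well defined on cosets) with <f x, y> - <x, g y> in I. *)
Definition quotient_adjointable_lift (R : realType) (A : lmodType R[i])
    (cA : cstar_algebra A) (I : A -> Prop)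
    (M N : lmodType R[i]) (hM : hilbert_module cA M) (hN : hilbert_module cA N)
    (f : M -> N) : Prop :=
  (forall x x' : M, modMI hM I (x - x') -> modMI hN I (f x - f x')) /\
  exists g : N -> M,
    (forall y y' : N, modMI hN I (y - y') -> modMI hM I (g y - g y')) /\
    (forall (x : M) (y : N), I (ip hN (f x) y - ip hM x (g y))).

(* Main.v *)
(** Put [E = M + N] and let [phi] also denote the operator [(m, n) |-> (phi* n, phi m)],
    which is self-adjoint modulo [I]; it suffices to lift it to [E].  By the uniform
    boundedness principle [phi] is bounded modulo [E I].

    Countable generation yields a positive contraction [k = sum c_n |g_n><g_n|] such that
    [s = 1 - k] satisfies [s^n x -> 0] for every [x], and the compact operator
    [t = sum c_n |phi g_n><g_n|] lifts [phi k].  With [a_n = s^(2n)] the operator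
    [phi (1 - a_n)] lifts to [t (1 + s + ... + s^(2n-1))], which is corrected to a lift
    [u_n] of norm bounded independently of [n].  Along a sparse sequence [nu] consider the
    windows [d_j = a_(nu j) - a_(nu (j+1))] and [w_j = a_(nu (j-1)) - a_(nu (j+2))].
    Because [t] is compact, [phi d_j] and [w_j phi d_j] have lifts that differ by an
    operator [r_j] with [|r_j| = O(2^-j)], and [sum_j (w_j u_j d_j + r_j)] converges strictly,
    by a Cauchy-Schwarz estimate, to a lift of [sum_j phi d_j = phi].

    Norm control comes from [T (1 - l T*T)^n] with [2 n l C^2 = 1]: it has norm at most [C]
    and, when [T] has norm at most [C] modulo [I], it differs from [T] by an operator of norm
    at most [C / 2] modulo [I].  The order structure of [A] is obtained from the
    Kelley-Vaught argument in the unital C*-algebra of bounded adjointable operators on [A]. *)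
Require Import Defs.
From HB Require Import structures.
From mathcomp Require Import all_boot all_order all_algebra.
From mathcomp Require Import complex reals boolp classical_sets.
From mathcomp Require Import ring lra.
Set Implicit Arguments. Unset Strict Implicit. Unset Printing Implicit Defensive.
Import Order.TTheory GRing.Theory Num.Theory.
Local Open Scope ring_scope.

(** The quotient modules are never formed. Statements about [phi] are congruences: [x] counts as an
    element of [E I] when every [<y, x>] lies in [I], and the quotient norm is the distance to that
    set. Only the very last step returns to the closed span of products [m i].

    Two obstacles shape the proof. The lifts of [phi (1 - a_n)] built from [t] come with norms of
    order [n], and taming them presupposes a bound on [phi] modulo [E I]. Even a bounded sequence of
    lifts need not converge, since two lifts of one operator may differ by any operator with range
    in [E I]. Cutting by windows on both sides makes the pieces almost orthogonal, so that the
    series and the series of adjoints converge at every vector.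

    Functional calculus is replaced by two devices: square roots obtained by iteration, and cut-offs
    by powers [(1 - l X)^n], controlled by [(2n + 1) t (1 - t)^(2n) <= 1] on [[0, 1]]. The same
    inequality serves vectors, operators and the convergence of [s^n]. *)

(** * Reflective decision of identities in abelian groups *)

Inductive gexp := GX of nat | GZ | GD of gexp & gexp | GN of gexp.

Fixpoint gden (V : zmodType) (env : seq V) (e : gexp) : V :=
  match e with
  | GX n => nth 0 env n
  | GZ => 0
  | GD a b => gden env a + gden env b
  | GN a => - gden env a
  end.

Fixpoint gcoef (e : gexp) (i : nat) : int :=
  match e with
  | GX n => if n == i then 1 else 0
  | GZ => 0
  | GD a b => gcoef a i + gcoef b i
  | GN a => - gcoef a i
  end.

Lemma gdenE (V : zmodType) (env : seq V) e :
  gden env e = \sum_(i < size env) env`_i *~ gcoef e i.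
Proof.
elim: e => [n||a IHa b IHb|a IHa] /=.
- case: (ltnP n (size env)) => hn.
    rewrite (bigD1 (Ordinal hn)) //= eqxx big1 ?addr0 // => i.
    by rewrite -val_eqE /= eq_sym => /negbTE ->; rewrite mulr0z.
  rewrite nth_default // big1 // => i _; case: eqP => // ni.
  by move: (ltn_ord i); rewrite -ni ltnNge hn.
- by rewrite big1.
- by rewrite IHa IHb -big_split; apply: eq_bigr => i _; rewrite /= mulrzDr.
- by rewrite IHa -sumrN; apply: eq_bigr => i _; rewrite /= mulrNz.
Qed.

Lemma gdenP (V : zmodType) (env : seq V) e1 e2 :
  all (fun i => gcoef e1 i == gcoef e2 i) (iota 0 (size env)) ->
  gden env e1 = gden env e2.
Proof.
move=> h; rewrite !gdenE; apply: eq_bigr => i _; congr (_ *~ _).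
by apply/eqP; apply: (allP h); rewrite mem_iota /=.
Qed.

(** Membership is tested by typing [erefl x : x = y], so atoms are identified up to conversion and
    not only syntactically. *)
Ltac gmem x env :=
  match env with
  | nil => constr:(false)
  | ?y :: ?l => let _ := constr:(erefl x : x = y) in constr:(true)
  | _ :: ?l => gmem x l
  end.
Ltac gindex x env :=
  match env with
  | ?y :: ?l => let _ := constr:(erefl x : x = y) in constr:(0%N)
  | _ :: ?l => let n := gindex x l in constr:(S n)
  end.
Ltac gadd x env :=
  let b := gmem x env in
  match b with true => env | false => constr:(x :: env) end.
Ltac gatoms V e env :=
  lazymatch e with
  | GRing.add ?a ?b => let env := gatoms V a env in gatoms V b env
  | GRing.opp ?a => gatoms V a env
  | GRing.zero => env
  | _ => gadd e env
  end.
Ltac greify e env :=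
  lazymatch e with
  | GRing.add ?a ?b =>
      let a := greify a env in let b := greify b env in constr:(GD a b)
  | GRing.opp ?a => let a := greify a env in constr:(GN a)
  | GRing.zero => constr:(GZ)
  | _ => let n := gindex e env in constr:(GX n)
  end.

(* Decides equalities that hold in every abelian group. *)
Ltac abel :=
  rewrite ?mulr2n;
  lazymatch goal with
  | |- @eq ?T ?x ?y =>
    let env := gatoms T x (@nil T) in
    let env := gatoms T y env in
    let e1 := greify x env in let e2 := greify y env in
    exact: (@gdenP _ env e1 e2 isT)
  end.

Ltac ncring :=
  rewrite ?(mulrDl, mulrDr, mulrN, mulNr, mul1r, mulr1, mulrA, opprD, opprK);
  abel.

(** * Positivity in unital C*-algebras *)

Lemma nondecreasing_bounded_cauchy (R : realType) (u : nat -> R) (M : R) :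
  (forall n, u n <= u n.+1) -> (forall n, u n <= M) ->
  forall e, 0 < e -> exists N, forall n m, (N <= n)%N -> (n <= m)%N -> u m - u n < e.
Proof.
move=> hu hM e e0.
have um n m : (n <= m)%N -> u n <= u m.
  elim: m => [|m IH]; first by rewrite leqn0 => /eqP ->.
  rewrite leq_eqVlt => /orP[/eqP -> //|]; rewrite ltnS => /IH h.
  exact: le_trans h (hu _).
pose S : set R := [set x | exists n, x = u n]%classic.
have hS : has_sup S.
  by split; [exists (u 0%N), 0%N | exists M => _ [n ->]].
have [_ [N ->] hN] := sup_adherent e0 hS.
exists N => n m Nn nm.
have h1 : u m <= sup S by apply: ub_le_sup; [exact: hS.2 | exists m].
have h2 := um _ _ Nn.
lra.
Qed.

Lemma le_eps0 (R : realType) (x K : R) :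
  0 <= x -> (forall e, 0 < e -> x <= K * e) -> x = 0.
Proof.
move=> x0 h; apply/eqP; rewrite eq_le x0 andbT leNgt; apply/negP => xp.
pose e := x / (2 * (`|K| + 1)).
have K1 : 0 < 2 * (`|K| + 1) by rewrite mulr_gt0 // ltr_wpDl.
have e0 : 0 < e by rewrite divr_gt0.
have := h e e0; have : x = (2 * (`|K| + 1)) * e by rewrite /e mulrC divfK // gt_eqF.
have : K <= `|K| by exact: ler_norm.
have := normr_ge0 K; nra.
Qed.

Lemma le_eps (R : realType) (x y K : R) :
  (forall e, 0 < e -> x <= y + K * e) -> x <= y.
Proof.
move=> h; rewrite leNgt; apply/negP => xp.
have xy : 0 <= x - y by lra.
have : x - y = 0 by apply: (@le_eps0 _ _ K) => // e /h; lra.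
lra.
Qed.

(* [csc] embeds the real scalars centrally and [cI] plays the role of the
   imaginary unit. *)
Record unital_cstar (R : realType) (B : pzRingType) := UnitalCstar {
  ust : B -> B;
  unm : B -> R;
  csc : R -> B;
  cI : B;
  ustD : forall a b, ust (a + b) = ust a + ust b;
  ustM : forall a b, ust (a * b) = ust b * ust a;
  ustK : forall a, ust (ust a) = a;
  cscD : forall r s, csc (r + s) = csc r + csc s;
  cscM : forall r s, csc (r * s) = csc r * csc s;
  csc1 : csc 1 = 1;
  cscC : forall r a, csc r * a = a * csc r;
  ust_csc : forall r, ust (csc r) = csc r;
  cIC : forall a, cI * a = a * cI;
  cII : cI * cI = - 1;
  ust_cI : ust cI = - cI;
  unm_ge0 : forall a, 0 <= unm a;
  unm_eq0 : forall a, unm a = 0 -> a = 0;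
  unmD : forall a b, unm (a + b) <= unm a + unm b;
  unmM : forall a b, unm (a * b) <= unm a * unm b;
  unm_csc : forall r, unm (csc r) <= `|r|;
  unm_ust : forall a, unm a ^+ 2 <= unm (ust a * a);
  ucomplete : complete_for unm
}.

Section UnitalCstar.
Variables (R : realType) (B : pzRingType) (S : unital_cstar R B).
Local Notation st := (ust S).
Local Notation nm := (unm S).
Local Notation sc := (csc S).
Local Notation J := (cI S).
Implicit Types (a b c x y : B) (r t m : R).

Lemma csc0 : sc 0 = 0.
Proof. by apply: (addrI (sc 0)); rewrite -cscD !addr0. Qed.

Lemma cscN r : sc (- r) = - sc r.
Proof. by apply: (addrI (sc r)); rewrite -cscD !subrr csc0. Qed.

Lemma csc_cancel r t a : r * t = 1 -> sc r * (sc t * a) = a.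
Proof. by move=> h; rewrite mulrA -cscM h csc1 mul1r. Qed.

Lemma ust0 : st 0 = 0.
Proof. by rewrite -csc0 ust_csc. Qed.

Lemma ust1 : st 1 = 1.
Proof. by rewrite -(csc1 S) ust_csc. Qed.

Lemma ustN a : st (- a) = - st a.
Proof. by apply: (addrI (st a)); rewrite -ustD !subrr ust0. Qed.

Lemma ustB a b : st (a - b) = st a - st b.
Proof. by rewrite ustD ustN. Qed.

Lemma unm0 : nm 0 = 0.
Proof.
have := unm_csc S 0; rewrite csc0 normr0 => h.
by apply/eqP; rewrite eq_le h unm_ge0.
Qed.

Lemma unm_scale r a : nm (sc r * a) <= `|r| * nm a.
Proof.
by apply: le_trans (unmM _ _ _) _; apply: ler_wpM2r (unm_csc _ _); apply: unm_ge0.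
Qed.

Lemma unm_scale_ge0 r a : 0 <= r -> nm (sc r * a) <= r * nm a.
Proof. by move=> h; have := unm_scale r a; rewrite ger0_norm. Qed.

Lemma unm_csc_ge0 r : 0 <= r -> nm (sc r) <= r.
Proof. by move=> h; have := unm_csc S r; rewrite ger0_norm. Qed.

Lemma unm1 : nm 1 <= 1.
Proof. by have := unm_csc S 1; rewrite csc1 normr1. Qed.

Lemma unmN a : nm (- a) = nm a.
Proof.
have h b : nm (- b) <= nm b.
  by have := unm_scale (- 1) b; rewrite cscN csc1 mulN1r normrN1 mul1r.
by apply/eqP; rewrite eq_le h -{1}[a]opprK h.
Qed.

Lemma unmBC a b : nm (a - b) = nm (b - a).
Proof. by rewrite -unmN opprB. Qed.

Lemma unm_small K a : (forall e, 0 < e -> nm a <= K * e) -> a = 0.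
Proof. by move=> h; apply: (unm_eq0 (u := S)); apply: le_eps0 h; apply: unm_ge0. Qed.

Lemma unm_st a : nm (st a) = nm a.
Proof.
have h b : nm b <= nm (st b).
  have := le_trans (unm_ust S b) (unmM S (st b) b); have := unm_ge0 S b.
  have := unm_ge0 S (st b); nra.
by have := h (st a); rewrite ustK => h2; apply/eqP; rewrite eq_le h h2.
Qed.

Lemma unm_sqr a : st a = a -> nm a ^+ 2 <= nm (a * a).
Proof. by move=> h; have := unm_ust S a; rewrite h. Qed.

Lemma sqr_eq0 a : st a = a -> a * a = 0 -> a = 0.
Proof.
move=> ha h; apply: (unm_eq0 (u := S)); have := unm_sqr ha; rewrite h unm0.
have := unm_ge0 S a; nra.
Qed.

(** * Square roots by iteration *)

Section SqrtSeq.
Variable x : B.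
Hypothesis x1 : nm x <= 1.

(** A fixed point of [y = (x + y * y) / 2] satisfies [(1 - y)^2 = 1 - x]. Started at [0], every
    iterate is a polynomial in [x] with nonnegative coefficients, which makes a scalar majorant
    available. *)
Fixpoint sqrt_seq (n : nat) : B :=
  if n is n'.+1 then sc 2^-1 * (x + sqrt_seq n' * sqrt_seq n') else 0.

(** The iteration at the scalar [1]. It increases and stays below [1], so its increments are
    summable; this covers the case [nm x = 1], where the iteration is not a strict contraction. *)
Fixpoint sqrt_maj (n : nat) : R :=
  if n is n'.+1 then 2^-1 * (1 + sqrt_maj n' * sqrt_maj n') else 0.

Lemma sqrt_majP n : 0 <= sqrt_maj n <= 1.
Proof.
elim: n => [|n /andP[h0 h1]] /=; first by rewrite lexx ler01.
have : 0 <= sqrt_maj n * sqrt_maj n <= 1 by rewrite mulr_ge0 // mulr_ile1.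
lra.
Qed.

Lemma sqrt_maj_nd n : sqrt_maj n <= sqrt_maj n.+1.
Proof. by rewrite /=; have := sqr_ge0 (sqrt_maj n - 1); nra. Qed.

Lemma sqrt_seq_comm b : b * x = x * b -> forall n, b * sqrt_seq n = sqrt_seq n * b.
Proof.
move=> h; elim=> [|n IH] /=; first by rewrite mulr0 mul0r.
rewrite mulrA -cscC -!mulrA; congr (_ * _).
by rewrite mulrDr mulrDl h mulrA IH -!mulrA IH.
Qed.

Lemma sqrt_seq_st : st x = x -> forall n, st (sqrt_seq n) = sqrt_seq n.
Proof.
move=> h; elim=> [|n IH] /=; first exact: ust0.
by rewrite ustM ust_csc ustD ustM IH h -cscC.
Qed.

Lemma sqrt_seq_nm n : nm (sqrt_seq n) <= sqrt_maj n.
Proof.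
elim: n => [|n IH] /=; first by rewrite unm0.
apply: le_trans (unm_scale_ge0 _ _) _; first by rewrite invr_ge0 ler0n.
have := unmD S x (sqrt_seq n * sqrt_seq n).
have := unmM S (sqrt_seq n) (sqrt_seq n).
have u0 := unm_ge0 S (sqrt_seq n).
by move: (ler_pM u0 u0 IH IH) x1; clear IH; move: (sqrt_maj n) => z; lra.
Qed.

(** The iterates commute, so [u^2 - v^2 = (u - v) (u + v)]; the majorant satisfies the same
    identity, and the two factors are compared separately. *)
Lemma sqrt_seq_step n :
  nm (sqrt_seq n.+1 - sqrt_seq n) <= sqrt_maj n.+1 - sqrt_maj n.
Proof.
elim: n => [|n IH].
  rewrite /= !mulr0 !addr0 !subr0.
  apply: le_trans (unm_scale_ge0 _ _) _; first by rewrite invr_ge0 ler0n.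
  by have := x1; lra.
set u := sqrt_seq n.+1; set v := sqrt_seq n.
have uv : u * v = v * u.
  by apply: sqrt_seq_comm; rewrite sqrt_seq_comm.
have -> : sqrt_seq n.+2 - u = sc 2^-1 * ((u - v) * (u + v)).
  rewrite -[sqrt_seq n.+2]/(sc 2^-1 * (x + u * u)).
  rewrite -[X in _ - X]/(sc 2^-1 * (x + v * v)) -mulrBr.
  congr (_ * _); rewrite mulrDr !mulrBl uv; abel.
apply: le_trans (unm_scale_ge0 _ _) _; first by rewrite invr_ge0 ler0n.
have := unmM S (u - v) (u + v); have := unmD S u v.
have := sqrt_seq_nm n; have := sqrt_seq_nm n.+1; rewrite -/u -/v.
have := unm_ge0 S (u - v); have := unm_ge0 S (u + v).
have -> : sqrt_maj n.+2 = 2^-1 * (1 + sqrt_maj n.+1 ^+ 2) by [].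
have : sqrt_maj n.+1 = 2^-1 * (1 + sqrt_maj n ^+ 2) by [].
move: IH; rewrite -/u -/v.
move: (sqrt_maj n.+1) (sqrt_maj n) (nm (u - v)) (nm (u + v)) (nm u) (nm v) => p q d s a b.
move=> h1 pq h2 h3 h4 h5 h6 h7.
have : d * s <= (p - q) * (p + q) by apply: ler_pM => //; lra.
have : (p - q) * (p + q) = p ^+ 2 - q ^+ 2 by ring.
lra.
Qed.

Lemma sqrt_seq_diff (n m : nat) : (n <= m)%N ->
  nm (sqrt_seq m - sqrt_seq n) <= sqrt_maj m - sqrt_maj n.
Proof.
elim: m => [|m IH]; first by rewrite leqn0 => /eqP ->; rewrite !subrr unm0.
rewrite leq_eqVlt => /orP[/eqP ->|]; first by rewrite !subrr unm0.
rewrite ltnS => /IH h; have := sqrt_seq_step m.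
have := unmD S (sqrt_seq m.+1 - sqrt_seq m) (sqrt_seq m - sqrt_seq n).
rewrite (_ : _ + _ = sqrt_seq m.+1 - sqrt_seq n); last by abel.
lra.
Qed.

Lemma sqrt_exists : exists y,
  [/\ (1 - y) * (1 - y) = 1 - x, nm y <= 1, st x = x -> st y = y
    & forall b, b * x = x * b -> b * y = y * b].
Proof.
have [y hy] : exists y, converges_to nm sqrt_seq y.
  apply: ucomplete => e e0.
  have [N hN] := nondecreasing_bounded_cauchy sqrt_maj_nd
    (fun n => (andP (sqrt_majP n)).2) e0.
  exists N => m n Nm Nn; case/orP: (leq_total n m) => h.
    exact: le_lt_trans (sqrt_seq_diff h) (hN _ _ Nn h).
  by rewrite unmBC; exact: le_lt_trans (sqrt_seq_diff h) (hN _ _ Nm h).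
have y1 : nm y <= 1.
  apply: (@le_eps _ _ _ 1) => e e0; have [N /(_ N (leqnn N)) hN] := hy e e0.
  have := unmD S (sqrt_seq N) (y - sqrt_seq N); rewrite addrC subrK.
  rewrite unmBC in hN.
  by have := sqrt_seq_nm N; have := sqrt_majP N; lra.
have yE : y = sc 2^-1 * (x + y * y).
  apply/eqP; rewrite -subr_eq0; apply/eqP; apply: (@unm_small 3) => e e0.
  have [N hN] := hy e e0.
  have h1 := hN N.+1 (leqnSn N); have h0 := hN N (leqnn N).
  rewrite unmBC in h1.
  set u := sqrt_seq N in h0.
  have -> : y - sc 2^-1 * (x + y * y) =
    (y - sqrt_seq N.+1) + sc 2^-1 * ((u - y) * u + y * (u - y)).
    by rewrite [sqrt_seq N.+1]/= -/u; ncring.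
  apply: le_trans (unmD _ _ _) _.
  have h2 : 0 <= 2^-1 :> R by rewrite invr_ge0 ler0n.
  have := unm_scale_ge0 ((u - y) * u + y * (u - y)) h2.
  have := unmD S ((u - y) * u) (y * (u - y)).
  have := unmM S (u - y) u; have := unmM S y (u - y).
  have := sqrt_seq_nm N; rewrite -/u; have := sqrt_majP N.
  have := unm_ge0 S (u - y); have := unm_ge0 S u; have := unm_ge0 S y.
  nra.
exists y; split => //.
- have e2 : y + y = x + y * y.
    rewrite {1 2}yE -mulrDl -cscD (_ : 2^-1 + 2^-1 = 1 :> R); last by lra.
    by rewrite csc1 mul1r.
  have -> : (1 - y) * (1 - y) = 1 - (y + y) + y * y by ncring.
  by rewrite e2; abel.
- move=> hx; apply/eqP; rewrite -subr_eq0; apply/eqP; apply: (@unm_small 2) => e e0.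
  have [N /(_ N (leqnn N)) hN] := hy e e0.
  have -> : st y - y = st (y - sqrt_seq N) + (sqrt_seq N - y).
    by rewrite ustB (sqrt_seq_st hx); abel.
  by apply: le_trans (unmD _ _ _) _; rewrite unm_st unmBC; lra.
- move=> b hb; apply/eqP; rewrite -subr_eq0; apply/eqP.
  apply: (@unm_small (2 * nm b)) => e e0.
  have [N /(_ N (leqnn N)) hN] := hy e e0.
  have -> : b * y - y * b = - (b * (sqrt_seq N - y)) + (sqrt_seq N - y) * b.
    by have := sqrt_seq_comm hb N; rewrite mulrBr mulrBl => ->; abel.
  apply: le_trans (unmD _ _ _) _; rewrite unmN.
  have := unmM S b (sqrt_seq N - y); have := unmM S (sqrt_seq N - y) b.
  have := unm_ge0 S b; nra.
Qed.

End SqrtSeq.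

(** * The cone of positive elements *)

(** For self-adjoint [a] the norm condition says that the spectrum lies in [[0, 2 t]]. In this form
    sums are positive by the triangle inequality. *)
Definition cpos a := st a = a /\ exists2 t, 0 <= t & nm (sc t - a) <= t.

Lemma cpos_st a : cpos a -> st a = a.
Proof. by case. Qed.

Lemma cpos0 : cpos 0.
Proof. by split; [exact: ust0 | exists 0; rewrite // csc0 subrr unm0]. Qed.

Lemma cposD a b : cpos a -> cpos b -> cpos (a + b).
Proof.
move=> [sa [t t0 ht]] [sb [r r0 hr]]; split; first by rewrite ustD sa sb.
exists (t + r); first by lra.
have := unmD S (sc t - a) (sc r - b).
rewrite (_ : _ + _ = sc (t + r) - (a + b)); last by rewrite cscD; abel.
lra.
Qed.

Lemma cpos_scale r a : 0 <= r -> cpos a -> cpos (sc r * a).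
Proof.
move=> r0 [sa [t t0 ht]]; split; first by rewrite ustM ust_csc sa cscC.
exists (r * t); first exact: mulr_ge0.
rewrite cscM -mulrBr; apply: le_trans (unm_scale_ge0 _ _) _ => //.
exact: ler_wpM2l.
Qed.

Lemma cpos_csc r : 0 <= r -> cpos (sc r).
Proof. by move=> r0; split; [exact: ust_csc | exists r; rewrite ?subrr ?unm0]. Qed.

Lemma cpos_cscB m a : st a = a -> nm a <= m -> cpos (sc m - a).
Proof.
move=> sa am; split; first by rewrite ustB ust_csc sa.
exists m; first exact: le_trans (unm_ge0 S a) am.
by rewrite (_ : sc m - _ = a) //; abel.
Qed.

Lemma cpos_sqrt a : cpos a -> exists h,
  [/\ cpos h, h * h = a & forall b, b * a = a * b -> b * h = h * b].
Proof.
move=> [sa [t t0 ht]]; have [t00|tn0] := eqVneq t 0.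
  exists 0; split; [exact: cpos0| |by move=> b; rewrite mulr0 mul0r].
  rewrite mulr0; apply/esym; apply: (unm_eq0 (u := S)); apply/eqP.
  by rewrite eq_le unm_ge0 andbT; move: ht; rewrite t00 csc0 sub0r unmN.
have tp : 0 < t by rewrite lt_def tn0.
(* The iteration runs on [1 - a / t], a contraction by the choice of [t]; it yields
   [(1 - y)^2 = a / t]. *)
have x1 : nm (1 - sc t^-1 * a) <= 1.
  have -> : 1 - sc t^-1 * a = sc t^-1 * (sc t - a).
    by rewrite mulrBr -cscM mulVf // csc1.
  apply: le_trans (unm_scale_ge0 _ _) _; first by rewrite invr_ge0.
  by rewrite mulrC ler_pdivrMr // mul1r.
have [y [yy y1 ys yc]] := sqrt_exists x1.
have sy : st y = y by apply: ys; rewrite ustB ust1 ustM ust_csc sa cscC.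
have r0 := sqrtr_ge0 t.
exists (sc (Num.sqrt t) * (1 - y)); split.
- split; first by rewrite ustM ust_csc ustB ust1 sy cscC.
  exists (Num.sqrt t) => //.
  rewrite (_ : _ - _ = sc (Num.sqrt t) * y); last by ncring.
  apply: le_trans (unm_scale_ge0 _ _) _ => //.
  by rewrite -[leRHS]mulr1; apply: ler_wpM2l.
- rewrite mulrA -[_ * _ * sc _]mulrA -cscC !mulrA -cscM -expr2 sqr_sqrtr //.
  rewrite -mulrA yy opprB addrC subrK.
  by rewrite csc_cancel // mulfV.
- move=> b ba; have by_ : b * y = y * b.
    apply: yc; rewrite mulrBr mulrBl mulr1 mul1r; congr (_ - _).
    by rewrite mulrA -cscC -!mulrA ba.
  by rewrite mulrA -cscC -!mulrA mulrBr mulrBl by_ mulr1 mul1r.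
Qed.

(** The element [u = a + J g] satisfies [st u * u = m^2], hence has norm at most [m], and [a] is its
    real part. *)
Lemma unm_unitary_part a g m : 0 <= m -> st a = a -> st g = g -> a * g = g * a ->
  a * a + g * g = sc (m * m) -> nm a <= m.
Proof.
move=> m0 sa sg ag h.
pose u := a + J * g.
have su : st u = a - J * g by rewrite ustD ustM sa sg ust_cI cIC mulrN.
have uu : st u * u = sc (m * m).
  rewrite su mulrDr !mulrBl -h.
  have -> : a * (J * g) = J * g * a by rewrite -mulrA -ag !mulrA -cIC.
  have -> : J * g * (J * g) = - (g * g).
    by rewrite -mulrA [g * (_ * _)]mulrA -[g * J]cIC !mulrA cII mulN1r mulNr.
  abel.
have u1 : nm u <= m.
  have mm : 0 <= m * m by apply: mulr_ge0.
  have := unm_ust S u; rewrite uu; have := unm_csc_ge0 mm.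
  have := unm_ge0 S u; nra.
have -> : a = sc 2^-1 * (u + st u).
  rewrite su (_ : _ + _ = a + a); last by rewrite /u; abel.
  rewrite mulrDr -mulrDl -cscD (_ : 2^-1 + 2^-1 = 1 :> R); last by lra.
  by rewrite csc1 mul1r.
apply: le_trans (unm_scale_ge0 _ _) _; first by rewrite invr_ge0 ler0n.
by have := unmD S u (st u); rewrite unm_st; lra.
Qed.

(** [(m/2 - a)^2 + a (m - a) = (m/2)^2], and the middle term is the square of [h g] for square roots
    [h], [g] of its factors, so [unm_unitary_part] applies. Thus the witness in [cpos] can be read
    off from any norm bound. *)
Lemma cpos_mid a m : 0 <= m -> cpos a -> cpos (sc m - a) -> nm (sc (m / 2) - a) <= m / 2.
Proof.
move=> m0 ca cb; have [h [ch hh hC]] := cpos_sqrt ca.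
have [g [cg gg gC]] := cpos_sqrt cb.
have ac b : b * a = a * b -> b * (sc m - a) = (sc m - a) * b.
  by move=> ba; rewrite mulrBr mulrBl -cscC ba.
have ha : h * a = a * h by rewrite -hh mulrA.
have ag : a * g = g * a by apply: gC; apply: ac.
have hg : h * g = g * h by apply: gC; apply: ac.
have sh := cpos_st ch; have sg := cpos_st cg; have sa := cpos_st ca.
apply: (@unm_unitary_part _ (h * g)).
- by lra.
- by rewrite ustB ust_csc sa.
- by rewrite ustM sh sg.
- rewrite mulrBl mulrBr cscC; congr (_ - _).
  by rewrite mulrA -ha -!mulrA ag.
- have -> : h * g * (h * g) = a * (sc m - a).
    by rewrite -gg -hh -!mulrA; congr (_ * _); rewrite mulrA -hg !mulrA.
  rewrite mulrBl !mulrBr -[a * sc (m / 2)]cscC -[a * sc m]cscC -cscM.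
  have -> : sc m * a = sc (m / 2) * a + sc (m / 2) * a.
    by rewrite -mulrDl -cscD; congr (sc _ * _); lra.
  abel.
Qed.

Lemma unm_le_cpos a m : 0 <= m -> cpos a -> cpos (sc m - a) -> nm a <= m.
Proof.
move=> m0 ca cb; have := cpos_mid m0 ca cb; have m2 : 0 <= m / 2 by lra.
have := unmD S (sc (m / 2)) (- (sc (m / 2) - a)); rewrite unmN.
rewrite (_ : _ - _ = a); last by abel.
have := unm_csc_ge0 m2; lra.
Qed.

(** With [m = nm h], [m^2 - h^2 = (m - h) (m + h)] is the square of [g1 g2], and [unm_unitary_part]
    bounds [g1 g2] by [m]. So [m^2] is a witness for [h^2]. *)
Lemma cpos_sqr h : st h = h -> cpos (h * h).
Proof.
move=> sh; pose m := nm h; have m0 : 0 <= m := unm_ge0 S h.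
have c1 : cpos (sc m - h) by apply: cpos_cscB.
have c2 : cpos (sc m + h).
  by rewrite -[h]opprK; apply: cpos_cscB; rewrite ?unmN // ustN sh.
have [g1 [p1 q1 r1]] := cpos_sqrt c1; have [g2 [p2 q2 r2]] := cpos_sqrt c2.
have hr b : b * h = h * b -> b * (sc m - h) = (sc m - h) * b /\
    b * (sc m + h) = (sc m + h) * b.
  by move=> bh; rewrite !mulrDr !mulrDl mulrN mulNr -cscC bh.
have hg1 : h * g1 = g1 * h by apply: r1; have [] := hr h erefl.
have hg2 : h * g2 = g2 * h by apply: r2; have [] := hr h erefl.
have g12 : g1 * g2 = g2 * g1 by apply: r2; have [] := hr g1 (esym hg1).
have sg : st (g1 * g2) = g1 * g2 by rewrite ustM !cpos_st.
have gE : g1 * g2 * (g1 * g2) = sc (m * m) - h * h.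
  have -> : g1 * g2 * (g1 * g2) = (sc m - h) * (sc m + h).
    by rewrite -q1 -q2 -!mulrA; congr (_ * _); rewrite mulrA -g12 !mulrA.
  by rewrite mulrDr !mulrBl -cscM -cscC; abel.
have gm : nm (g1 * g2) <= m.
  apply: (@unm_unitary_part _ h) => //; first by rewrite -mulrA -hg2 mulrA -hg1 mulrA.
  by rewrite gE subrK.
split; first by rewrite ustM sh.
exists (m * m); first exact: mulr_ge0.
by rewrite -gE; apply: le_trans (unmM _ _ _) _; apply: ler_pM => //; apply: unm_ge0.
Qed.

Lemma cpos_mul a b : cpos a -> cpos b -> a * b = b * a -> cpos (a * b).
Proof.
move=> ca cb ab; have [h [ch hh hC]] := cpos_sqrt ca.
have [g [cg gg gC]] := cpos_sqrt cb.
have bh : b * h = h * b by apply: hC.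
have hg : h * g = g * h by apply: gC.
have -> : a * b = h * g * (h * g).
  by rewrite -hh -gg -!mulrA; congr (_ * _); rewrite [RHS]mulrA -hg !mulrA.
by apply: cpos_sqr; rewrite ustM !cpos_st.
Qed.

Lemma unm_mono a b : cpos a -> cpos (b - a) -> nm a <= nm b.
Proof.
move=> ca cba; apply: unm_le_cpos => //; first exact: unm_ge0.
have sb : st b = b.
  by rewrite -[b](subrK a) ustD (cpos_st cba) (cpos_st ca).
have := cposD (cpos_cscB sb (lexx _)) cba.
by rewrite (_ : _ + _ = sc (nm b) - a) //; abel.
Qed.

Lemma cpos_limit (u : nat -> B) a :
  (forall n, cpos (u n)) -> converges_to nm u a -> cpos a.
Proof.
move=> cu ua; have sa : st a = a.
  apply/eqP; rewrite -subr_eq0; apply/eqP; apply: (@unm_small 2) => e e0.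
  have [N /(_ N (leqnn N)) hN] := ua e e0.
  have -> : st a - a = st (a - u N) + (u N - a).
    by rewrite ustB (cpos_st (cu N)); abel.
  by apply: le_trans (unmD _ _ _) _; rewrite unm_st unmBC; lra.
(* The witnesses of the terms [u n] may be unbounded; [cpos_mid] replaces them by half of the common
   norm bound [m]. *)
split=> //; pose m := nm a + 1; have m0 : 0 <= m by rewrite addr_ge0 ?unm_ge0.
exists (m / 2); first by lra.
apply: (@le_eps _ _ _ 1) => e e0.
have e10 : 0 < Num.min e 1 by rewrite lt_min e0 ltr01.
have [N /(_ N (leqnn N))] := ua _ e10; rewrite lt_min => /andP[h1 h2].
have uNm : nm (u N) <= m.
  by have := unmD S (u N - a) a; rewrite subrK /m; lra.
have := cpos_mid m0 (cu N) (cpos_cscB (cpos_st (cu N)) uNm).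
have := unmD S (sc (m / 2) - u N) (u N - a).
rewrite (_ : _ + _ = sc (m / 2) - a); last by abel.
lra.
Qed.

(** Stands in for the equality of the nonzero spectra of [st c c] and [c st c]. The powers
    [b n = (1 + l p)^n] satisfy [c b n = (1 - l r)^n c] with [r = c st c], so
    [b n p b n = - st (c b n) (c b n)] stays bounded, although it dominates [n l p^2]. *)
Lemma opposite_products c p : cpos p -> st c * c = - p -> cpos (c * st c) -> p = 0.
Proof.
move=> cp cE; have sp := cpos_st cp; move rE : (c * st c) => r cr.
(* This [l] gives [0 <= l r <= 1], so that [1 - l r] is a contraction. *)
pose l := (nm r + 1)^-1; have r0 := unm_ge0 S r.
have lp : 0 < l by rewrite invr_gt0; lra.
have l0 := ltW lp.
have lr1 : nm (sc l * r) <= 1.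
  apply: le_trans (unm_scale_ge0 _ l0) _.
  by rewrite /l mulrC ler_pdivrMr; lra.
have n1 : nm (1 - sc l * r) <= 1.
  have clr : cpos (sc l * r) by apply: cpos_scale.
  apply: unm_le_cpos; rewrite ?csc1 ?ler01 //; last by rewrite opprB addrC subrK.
  by rewrite -(csc1 S); apply: cpos_cscB lr1; apply: cpos_st.
pose b n := (1 + sc l * p) ^+ n.
have bp n : b n * p = p * b n.
  by apply: commr_sym; apply: commrX; rewrite /GRing.comm mulrDr mulrDl mulr1 mul1r mulrA -cscC -mulrA.
have sb n : st (b n) = b n.
  elim: n => [|n IH]; first exact: ust1.
  rewrite /b exprSr ustM IH ustD ust1 ustM ust_csc sp -[p * _]cscC.
  by rewrite -exprS exprSr.
have cpb n : cpos (b n - 1).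
  elim: n => [|n IH]; first by rewrite subrr; exact: cpos0.
  have -> : b n.+1 - 1 = b n - 1 + sc l * (p * b n).
    by rewrite /b exprS -/(b n); ncring.
  apply: cposD => //; apply: cpos_scale => //; apply: cpos_mul => //.
  by rewrite -[b n](subrK 1); apply: cposD => //; rewrite -(csc1 S); apply: cpos_csc.
have cb n : c * b n = (1 - sc l * r) ^+ n * c.
  elim: n => [|n IH]; first by rewrite mulr1 mul1r.
  rewrite /b exprS mulrA.
  have -> : c * (1 + sc l * p) = (1 - sc l * r) * c.
    have : c * (st c * c) = r * c by rewrite mulrA rE.
    rewrite cE mulrN => h; rewrite mulrDr mulrBl mulr1 mul1r mulrA -cscC -!mulrA -h.
    by rewrite mulrN opprK.
  by rewrite -mulrA -/(b n) IH mulrA -exprS.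
have nb n : nm ((1 - sc l * r) ^+ n) <= 1.
  elim: n => [|n IH]; first exact: unm1.
  rewrite exprS; apply: le_trans (unmM _ _ _) _.
  by rewrite -[leRHS]mulr1; apply: ler_pM => //; exact: unm_ge0.
have ncb n : nm (c * b n) <= nm c.
  rewrite cb; apply: le_trans (unmM _ _ _) _.
  by rewrite -[leRHS]mul1r; apply: ler_wpM2r => //; exact: unm_ge0.
have npb n : nm (b n * p * b n) <= nm c ^+ 2.
  rewrite -unmN -mulNr -mulrN -cE -mulrA -mulrA.
  rewrite -{1}(sb n) [st _ * _]mulrA -ustM.
  apply: le_trans (unmM _ _ _) _; rewrite unm_st expr2.
  by apply: ler_pM; rewrite ?unm_ge0.
have cpbp n : cpos (b n * p - sc (n%:R * l) * (p * p)).
  elim: n => [|n IH]; first by rewrite mul0r csc0 mul0r subr0 mul1r.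
  have -> : b n.+1 * p - sc (n.+1%:R * l) * (p * p) =
     b n * p - sc (n%:R * l) * (p * p) + sc l * (p * (b n - 1) * p).
    rewrite -natr1 mulrDl mul1r cscD /b exprS -/(b n); ncring.
  apply: cposD => //; apply: cpos_scale => //.
  have pb : p * (b n - 1) = (b n - 1) * p by rewrite mulrBr mulrBl mulr1 mul1r bp.
  by apply: cpos_mul (cpos_mul cp (cpb n) pb) cp _; rewrite -mulrA -pb.
have key n : n%:R * l * nm (p * p) <= nm c ^+ 2.
  have h0 : 0 <= n%:R * l by rewrite mulr_ge0 ?ler0n.
  have h1 : nm (sc (n%:R * l) * (p * p)) <= nm (b (2 * n)%N * p).
    apply: unm_mono; first by apply: cpos_scale => //; apply: cpos_sqr.
    have -> : b (2 * n)%N * p - sc (n%:R * l) * (p * p) =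
        b (2 * n)%N * p - sc ((2 * n)%N%:R * l) * (p * p) + sc (n%:R * l) * (p * p).
      have -> : (2 * n)%N%:R * l = n%:R * l + n%:R * l by rewrite natrM; ring.
      by rewrite cscD; ncring.
    by apply: cposD => //; apply: cpos_scale => //; apply: cpos_sqr.
  have h2 : b (2 * n)%N * p = b n * p * b n.
    by rewrite -mulrA -bp mulrA /b -exprD mul2n addnn.
  have h3 : n%:R * l * nm (p * p) <= nm (sc (n%:R * l) * (p * p)).
    have [->|hn] := eqVneq (n%:R * l) 0; first by rewrite mul0r unm_ge0.
    have hp : 0 < n%:R * l by rewrite lt_def hn.
    rewrite -ler_pdivlMl // -[in leLHS](csc_cancel (p * p) (mulVf hn)).
    by apply: unm_scale_ge0; rewrite invr_ge0.
  by apply: le_trans h3 (le_trans h1 _); rewrite h2.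
apply: sqr_eq0 => //; apply: (unm_eq0 (u := S)); apply/eqP; rewrite eq_le unm_ge0 andbT leNgt.
apply/negP => pp.
pose q := nm c ^+ 2 / (l * nm (p * p)).
have lpp : 0 < l * nm (p * p) by apply: mulr_gt0.
have := key (Num.truncn q).+1; rewrite -mulrA -ler_pdivlMr // -/q leNgt => /negP; apply.
by rewrite truncnS_gt.
Qed.

(* The Kelley-Vaught theorem: with [m = sqrt (a ^ 2)] and [f = m - a], twice the
   negative part of [a = st b * b], the element [c = b * f] has [st c * c <= 0]. *)
Lemma cpos_stM b : cpos (st b * b).
Proof.
pose a := st b * b; have sa : st a = a by rewrite ustM ustK.
have [m [cm mm mC]] := cpos_sqrt (cpos_sqr sa).
have [l [cl ll lC]] := cpos_sqrt cm.
have am : a * m = m * a by apply: mC; rewrite mulrA.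
have la : a * l = l * a by apply: lC.
have lm : l * m = m * l by rewrite -ll mulrA.
pose f := m - a.
have sf : st f = f by rewrite ustB sa (cpos_st cm).
have mf : m * f = - (a * f) by rewrite /f !mulrBr mm am; abel.
have lf : l * f = f * l by rewrite mulrBr mulrBl lm la.
pose c := b * f.
pose p := l * f * (l * f).
have slf : st (l * f) = l * f by rewrite ustM sf (cpos_st cl) lf.
have cp : cpos p by apply: cpos_sqr.
have cE : st c * c = - p.
  rewrite ustM sf mulrA -[f * _ * _]mulrA -/a -mulrA.
  have -> : a * f = - (m * f) by rewrite mf opprK.
  by rewrite /p mulrN -ll !mulrA -lf.
have cr : cpos (c * st c).
  (* [X^2 + Y^2 = 2 (c st c + st c c)] and [st c c = - p], so [c st c] is half of a sum of positive
     elements. *)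
  pose X := c + st c; pose Y := J * (c - st c).
  have sX : st X = X by rewrite ustD ustK addrC.
  have sY : st Y = Y by rewrite ustM ustB ustK ust_cI mulrN -mulNr opprB -cIC.
  have h : X * X + Y * Y + (p + p) = c * st c + c * st c.
    have -> : Y * Y = - ((c - st c) * (c - st c)).
      by rewrite /Y -mulrA [_ * (J * _)]mulrA -[_ * J]cIC !mulrA cII mulN1r mulNr.
    have -> : p = - (st c * c) by rewrite cE opprK.
    by rewrite /X; ncring.
  have h2 : 0 <= 2^-1 :> R by rewrite invr_ge0 ler0n.
  have := cpos_scale h2 (cposD (cposD (cpos_sqr sX) (cpos_sqr sY)) (cposD cp cp)).
  rewrite h mulrDr -mulrDl -cscD (_ : 2^-1 + 2^-1 = 1 :> R); last by lra.
  by rewrite csc1 mul1r.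
have p0 := opposite_products cp cE cr.
have lf0 : l * f = 0 by apply: sqr_eq0.
have mf0 : m * f = 0 by rewrite -ll -mulrA lf0 mulr0.
have f0 : f = 0.
  apply: sqr_eq0 => //; rewrite {1}/f mulrBl mf0.
  by rewrite -[a * f]opprK -mf mf0 oppr0 subr0.
by move/eqP: f0; rewrite subr_eq0 -/a => /eqP <-.
Qed.

Lemma cpos_conj a c : cpos a -> cpos (st c * a * c).
Proof.
move=> ca; have [h [ch hh _]] := cpos_sqrt ca.
have -> : st c * a * c = st (h * c) * (h * c) by rewrite ustM (cpos_st ch) -hh !mulrA.
exact: cpos_stM.
Qed.

End UnitalCstar.

(** * Limits, modules with an A-valued inner product, adjointable operators *)

Local Open Scope complex_scope.

(** Homogeneity is left out so that the lemmas on limits apply alike to the norms of [A], of a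
    module, and of operators, which carry a ring structure but no scalar multiplication. *)
Record vnorm (R : realType) (V : zmodType) (n : V -> R) : Prop := VNorm {
  vn_ge0 : forall x, 0 <= n x;
  vn_eq0 : forall x, n x = 0 -> x = 0;
  vn0 : n 0 = 0;
  vnN : forall x, n (- x) = n x;
  vnD : forall x y, n (x + y) <= n x + n y
}.

Definition tends0 (R : realType) (v : nat -> R) :=
  forall e, 0 < e -> exists N, forall n, (N <= n)%N -> v n < e.

Section Limits.
Variables (R : realType) (V : zmodType) (nrm : V -> R) (nP : vnorm nrm).
Implicit Types (u w : nat -> V) (x y l : V).

Lemma vnBC x y : nrm (x - y) = nrm (y - x).
Proof. by rewrite -(vnN nP) opprB. Qed.

Lemma vnB x y : nrm (x - y) <= nrm x + nrm y.
Proof. by have := vnD nP x (- y); rewrite (vnN nP). Qed.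

Lemma vn_tri x y z : nrm (x - z) <= nrm (x - y) + nrm (y - z).
Proof. by have := vnD nP (x - y) (y - z); rewrite addrA subrK. Qed.

Lemma vn_small x K : (forall e, 0 < e -> nrm x <= K * e) -> x = 0.
Proof. by move=> h; apply: (vn_eq0 nP); apply: le_eps0 h; apply: (vn_ge0 nP). Qed.

Lemma cvgt_unique u l l' : converges_to nrm u l -> converges_to nrm u l' -> l = l'.
Proof.
move=> h h'; apply/eqP; rewrite -subr_eq0; apply/eqP.
apply: (@vn_small _ 2) => e e0; have [N hN] := h e e0; have [N' hN'] := h' e e0.
have := hN _ (leq_maxl N N'); have := hN' _ (leq_maxr N N').
by have := vn_tri l (u (maxn N N')) l'; rewrite (vnBC l (u _)); lra.
Qed.

Lemma cvgt_cst x : converges_to nrm (fun=> x) x.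
Proof. by move=> e e0; exists 0%N => n _; rewrite subrr (vn0 nP). Qed.

Lemma cvgtD u w l l' : converges_to nrm u l -> converges_to nrm w l' ->
  converges_to nrm (fun n => u n + w n) (l + l').
Proof.
move=> h h' e e0; have e2 : 0 < e / 2 by lra.
have [N hN] := h _ e2; have [N' hN'] := h' _ e2.
exists (maxn N N') => n; rewrite geq_max => /andP[/hN h1 /hN' h2].
have := vnD nP (u n - l) (w n - l').
by rewrite (_ : _ + _ = u n + w n - (l + l')); [lra | abel].
Qed.

Lemma cvgtN u l : converges_to nrm u l -> converges_to nrm (fun n => - u n) (- l).
Proof.
move=> h e /h[N hN]; exists N => n /hN.
by rewrite -(vnN nP) (_ : - (_ - _) = - u n - - l) //; abel.
Qed.

Lemma cvgtB u w l l' : converges_to nrm u l -> converges_to nrm w l' ->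
  converges_to nrm (fun n => u n - w n) (l - l').
Proof. by move=> h h'; apply: cvgtD => //; apply: cvgtN. Qed.

Lemma cvgt_sub u (f : nat -> nat) l : (forall n, (n <= f n)%N) ->
  converges_to nrm u l -> converges_to nrm (fun n => u (f n)) l.
Proof.
move=> hf h e /h[N hN]; exists N => n Nn; apply: hN; exact: leq_trans Nn (hf n).
Qed.

Lemma cvgt_le u l K : converges_to nrm u l ->
  (exists N, forall n, (N <= n)%N -> nrm (u n) <= K) -> nrm l <= K.
Proof.
move=> h [M hM]; apply: (@le_eps _ _ _ 1) => e e0; have [N hN] := h e e0.
have := hN _ (leq_maxl N M); have := hM _ (leq_maxr N M).
have := vn_tri l (u (maxn N M)) 0; rewrite !subr0 (vnBC l (u _)); lra.
Qed.

Lemma cvgt_tends0 u l (v : nat -> R) : tends0 v ->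
  (forall n, nrm (u n - l) <= v n) -> converges_to nrm u l.
Proof.
by move=> hv h e /hv[N hN]; exists N => n /hN; apply: le_lt_trans.
Qed.

Lemma cvgt_closure (P : V -> Prop) u l :
  (forall n, P (u n)) -> converges_to nrm u l -> in_closure nrm P l.
Proof.
move=> hP h e /h[N /(_ N (leqnn N)) hN]; exists (u N); split=> //.
by rewrite vnBC.
Qed.

Lemma cauchyD u w : cauchy_seq nrm u -> cauchy_seq nrm w ->
  cauchy_seq nrm (fun n => u n + w n).
Proof.
move=> h h' e e0; have e2 : 0 < e / 2 by lra.
have [N hN] := h _ e2; have [N' hN'] := h' _ e2.
exists (maxn N N') => m n; rewrite !geq_max => /andP[m1 m2] /andP[n1 n2].
have := hN _ _ m1 n1; have := hN' _ _ m2 n2.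
have := vnD nP (u m - u n) (w m - w n).
by rewrite (_ : _ + _ = u m + w m - (u n + w n)); [lra | abel].
Qed.

Lemma cauchy_le (v : nat -> R) u : tends0 v ->
  (forall n m, (n <= m)%N -> nrm (u m - u n) <= v n) -> cauchy_seq nrm u.
Proof.
move=> hv h e /hv[N hN]; exists N => m n Nm Nn.
case/orP: (leq_total n m) => nm; first exact: le_lt_trans (h _ _ nm) (hN _ Nn).
by rewrite vnBC; exact: le_lt_trans (h _ _ nm) (hN _ Nm).
Qed.

End Limits.

Lemma cvgt_map (R : realType) (V W : zmodType) (n1 : V -> R) (n2 : W -> R)
    (nP : vnorm n1) (f : V -> W) (K : R) u l :
  (forall x y, n2 (f x - f y) <= K * n1 (x - y)) ->
  converges_to n1 u l -> converges_to n2 (fun n => f (u n)) (f l).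
Proof.
move=> hf h e e0; pose K' := `|K| + 1.
have K0 : 0 < K' by rewrite ltr_wpDl.
have eK : 0 < e / K' by rewrite divr_gt0.
have [N hN] := h _ eK; exists N => n /hN; rewrite ltr_pdivlMr // => h1.
apply: le_lt_trans (hf _ _) (le_lt_trans _ h1); rewrite mulrC.
apply: ler_wpM2l; first exact: (vn_ge0 nP).
by rewrite (le_trans (ler_norm K)) // /K' lerDl.
Qed.

Lemma tends0_inv (R : realType) (K : R) : tends0 (fun n => K / n.+1%:R).
Proof.
move=> e e0; exists (Num.truncn (`|K| / e)) => n hn.
have n0 : 0 < n.+1%:R :> R by rewrite ltr0n.
rewrite ltr_pdivrMr // mulrC -ltr_pdivrMr //.
apply: le_lt_trans (_ : `|K| / e < _).
  by rewrite ler_wpM2r ?invr_ge0 ?(ltW e0) // ler_norm.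
apply: lt_le_trans (truncnS_gt _) _.
by rewrite ler_nat ltnS.
Qed.

Lemma tends0_le (R : realType) (v w : nat -> R) :
  (forall n, v n <= w n) -> tends0 w -> tends0 v.
Proof. by move=> h hw e /hw[N hN]; exists N => n /hN; apply: le_lt_trans. Qed.

Lemma tends0M (R : realType) (v : nat -> R) (K : R) :
  tends0 v -> (forall n, 0 <= v n) -> tends0 (fun n => K * v n).
Proof.
move=> hv v0 e e0; have K0 : 0 < `|K| + 1 by rewrite ltr_wpDl.
have eK : 0 < e / (`|K| + 1) by rewrite divr_gt0.
have [N hN] := hv _ eK; exists N => n /hN; rewrite ltr_pdivlMr // mulrC.
apply: le_lt_trans; apply: ler_wpM2r => //.
by rewrite (le_trans (ler_norm K)) // lerDl.
Qed.

Lemma geo_gt0 (R : realType) n : 0 < (2^-1 : R) ^+ n.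
Proof. by rewrite exprn_gt0 // invr_gt0 ltr0n. Qed.

Lemma geo_le_inv (R : realType) n : (2^-1 : R) ^+ n <= n.+1%:R^-1.
Proof.
rewrite exprVn lef_pV2 ?posrE ?ltr0n ?exprn_gt0 ?ltr0n //.
by rewrite -natrX ler_nat ltn_expl.
Qed.

Lemma tends0_geo (R : realType) (K : R) : 0 <= K -> tends0 (fun n => K * 2^-1 ^+ n).
Proof.
move=> K0; apply: tends0_le (tends0_inv K) => n.
by rewrite ler_wpM2l // geo_le_inv.
Qed.

Section Series.
Variables (R : realType) (V : zmodType) (nrm : V -> R) (nP : vnorm nrm).

Lemma geo_tail (u : nat -> V) (K : R) : (forall n, nrm (u n) <= K * 2^-1 ^+ n) ->
  forall n m, (n <= m)%N ->
  nrm (\sum_(i < m) u i - \sum_(i < n) u i) <= 2 * K * (2^-1 ^+ n - 2^-1 ^+ m).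
Proof.
move=> h n m; elim: m => [|m IH].
  by rewrite leqn0 => /eqP ->; rewrite !subrr (vn0 nP) mulr0.
rewrite leq_eqVlt => /orP[/eqP ->|]; first by rewrite !subrr (vn0 nP) mulr0.
rewrite ltnS => /IH h1; rewrite big_ord_recr /= addrAC.
apply: le_trans (vnD nP _ _) _; have := h m; rewrite exprS; lra.
Qed.

Lemma geo_cauchy (u : nat -> V) (K : R) : (forall n, nrm (u n) <= K * 2^-1 ^+ n) ->
  cauchy_seq nrm (fun n => \sum_(i < n) u i).
Proof.
move=> h; have K0 : 0 <= K.
  by have := h 0%N; rewrite expr0 mulr1; apply: le_trans; apply: (vn_ge0 nP).
have K2 : 0 <= 2 * K by lra.
apply: (cauchy_le nP (tends0_geo K2)) => n m nm.
apply: le_trans (geo_tail h nm) _; rewrite ler_wpM2l //.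
by rewrite gerBl ltW // geo_gt0.
Qed.

Lemma geo_series (u : nat -> V) (K : R) : complete_for nrm ->
  (forall n, nrm (u n) <= K * 2^-1 ^+ n) ->
  exists2 l, converges_to nrm (fun n => \sum_(i < n) u i) l & nrm l <= 2 * K.
Proof.
move=> hc h; have [l hl] := hc _ (geo_cauchy h); exists l => //.
have K0 : 0 <= K.
  by have := h 0%N; rewrite expr0 mulr1; apply: le_trans; apply: (vn_ge0 nP).
apply: (cvgt_le nP hl); exists 0%N => n _.
have := geo_tail h (leq0n n); rewrite big_ord0 subr0 expr0.
by have := geo_gt0 R n; nra.
Qed.

End Series.

Section CstarNorm.
Variables (R : realType) (A : lmodType R[i]) (cA : cstar_algebra A).
Local Notation "a ** b" := (cmul cA a b) (at level 40, left associativity).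
Local Notation nA := (cnorm cA).
Local Notation st := (cstar cA).
Implicit Types (a b c : A) (r : R).

Lemma normrC r : `|r%:C| = `|r|%:C :> R[i].
Proof. by rewrite normc_def /= expr0n addr0 sqrtr_sqr. Qed.

Lemma conj_real r : Num.conj r%:C = r%:C :> R[i].
Proof. exact: conjc_real. Qed.

Lemma cnorm_real r a : nA (r%:C *: a) = `|r| * nA a.
Proof.
have := cnormZ cA r%:C a; rewrite normrC -rmorphM => /eqP.
by rewrite eq_complex /= eqxx andbT => /eqP.
Qed.

Lemma cnorm0 : nA 0 = 0.
Proof. by rewrite -(scale0r (0 : A)) (_ : 0 = 0%:C) // cnorm_real normr0 mul0r. Qed.

Lemma cnormN a : nA (- a) = nA a.
Proof.
by rewrite -scaleN1r (_ : -1 = (-1)%:C) ?cnorm_real ?normrN1 ?mul1r // rmorphN1.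
Qed.

Lemma cnorm_vnorm : vnorm nA.
Proof.
split; [exact: cnorm_ge0|exact: cnorm_eq0|exact: cnorm0|exact: cnormN|exact: cnormD].
Qed.

Lemma cmul0r a : 0 ** a = 0.
Proof. by rewrite -(scale0r (0 : A)) cmulZl !scale0r. Qed.

Lemma cmulNl a b : (- a) ** b = - (a ** b).
Proof. by rewrite -scaleN1r cmulZl scaleN1r. Qed.

Lemma cmulBl a b c : (a - b) ** c = a ** c - b ** c.
Proof. by rewrite cmulDl cmulNl. Qed.

Lemma cstarN a : st (- a) = - st a.
Proof. by rewrite -scaleN1r cstarZ rmorphN1 scaleN1r. Qed.

Lemma cstar0 : st 0 = 0.
Proof. by apply: (addrI (st 0)); rewrite -cstarD !addr0. Qed.

Lemma cstar_real r a : st (r%:C *: a) = r%:C *: st a.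
Proof. by rewrite cstarZ conj_real. Qed.

Lemma cnorm_star a : nA (st a) = nA a.
Proof.
have h b : nA b <= nA (st b).
  have := cnormM cA (st b) b; rewrite cnorm_cstar_id.
  have := cnorm_ge0 cA b; have := cnorm_ge0 cA (st b); nra.
by have := h (st a); rewrite cstarK => h2; apply/eqP; rewrite eq_le h h2.
Qed.

End CstarNorm.

(** Cauchy-Schwarz is a field while positivity of [<x, x>] is not: positivity in [A] is defined
    through operators on [A] as a module over itself, so this structure has to exist before
    positivity can be stated. It is assumed afterwards as [hpos]. *)
Record nmod (R : realType) (A : lmodType R[i]) (cA : cstar_algebra A)
    (E : lmodType R[i]) := NMod {
  nip : E -> E -> A;
  nact : E -> A -> E;
  nnm : E -> R;
  nipDr : forall x y y', nip x (y + y') = nip x y + nip x y';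
  nipZr : forall (z : R[i]) x y, nip x (z *: y) = z *: nip x y;
  nip_act : forall x y a, nip x (nact y a) = cmul cA (nip x y) a;
  nip_sym : forall x y, nip y x = cstar cA (nip x y);
  nnm_ge0 : forall x, 0 <= nnm x;
  nnm_sqr : forall x, nnm x ^+ 2 = cnorm cA (nip x x);
  nnm_eq0 : forall x, nnm x = 0 -> x = 0;
  nip_cs : forall x y, cnorm cA (nip x y) <= nnm x * nnm y;
  ncomplete : complete_for nnm
}.

Section NModule.
Variables (R : realType) (A : lmodType R[i]) (cA : cstar_algebra A).
Variables (E : lmodType R[i]) (H : nmod cA E).
Local Notation "a ** b" := (cmul cA a b) (at level 40, left associativity).
Local Notation nA := (cnorm cA).
Local Notation st := (cstar cA).
Local Notation ip := (nip H).
Local Notation nE := (nnm H).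
Implicit Types (x y : E) (a b : A) (r : R) (z : R[i]).

Lemma nipDl x x' y : ip (x + x') y = ip x y + ip x' y.
Proof. by rewrite nip_sym nipDr cstarD -!nip_sym. Qed.

Lemma nipZl z x y : ip (z *: x) y = Num.conj z *: ip x y.
Proof. by rewrite nip_sym nipZr cstarZ -nip_sym. Qed.

Lemma nip0r x : ip x 0 = 0.
Proof. by rewrite -(scale0r (0 : E)) nipZr scale0r. Qed.

Lemma nip0l x : ip 0 x = 0.
Proof. by rewrite nip_sym nip0r cstar0. Qed.

Lemma nipNr x y : ip x (- y) = - ip x y.
Proof. by rewrite -scaleN1r nipZr scaleN1r. Qed.

Lemma nipNl x y : ip (- x) y = - ip x y.
Proof. by rewrite nip_sym nipNr cstarN -nip_sym. Qed.

Lemma nipBr x y y' : ip x (y - y') = ip x y - ip x y'.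
Proof. by rewrite nipDr nipNr. Qed.

Lemma nipBl x x' y : ip (x - x') y = ip x y - ip x' y.
Proof. by rewrite nipDl nipNl. Qed.

Lemma nipRl r x y : ip (r%:C *: x) y = r%:C *: ip x y.
Proof. by rewrite nipZl conj_real. Qed.

Lemma nip_sumr (I : Type) (s : seq I) (F : I -> E) x :
  ip x (\sum_(i <- s) F i) = \sum_(i <- s) ip x (F i).
Proof. by apply: (big_morph (ip x) (nipDr H x) (nip0r x)). Qed.

Lemma nip_suml (I : Type) (s : seq I) (F : I -> E) x :
  ip (\sum_(i <- s) F i) x = \sum_(i <- s) ip (F i) x.
Proof.
by apply: (big_morph (fun y => ip y x)); [move=> ? ?; apply: nipDl|apply: nip0l].
Qed.

Lemma nip_ext x y : (forall w, ip w x = ip w y) -> x = y.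
Proof.
move=> h; apply/eqP; rewrite -subr_eq0; apply/eqP; apply: (nnm_eq0 (n := H)).
have := nnm_sqr H (x - y); rewrite nipBr h subrr cnorm0.
by move/eqP; rewrite sqrf_eq0 => /eqP.
Qed.

Lemma nnm_leP x (K : R) : 0 <= K -> nA (ip x x) <= K ^+ 2 -> nE x <= K.
Proof.
by move=> K0; rewrite -nnm_sqr ler_pXn2r ?nnegrE ?nnm_ge0.
Qed.

Lemma nnm_vnorm : vnorm nE.
Proof.
split; [exact: nnm_ge0|exact: nnm_eq0| | |].
- by have := nnm_sqr H 0; rewrite nip0r cnorm0 => /eqP; rewrite sqrf_eq0 => /eqP.
- have h x : nE (- x) <= nE x.
    by apply: nnm_leP; rewrite ?nnm_ge0 // nipNr nipNl opprK nnm_sqr.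
  by move=> x; apply/eqP; rewrite eq_le h -{1}[x]opprK h.
- move=> x y; apply: nnm_leP; first by rewrite addr_ge0 ?nnm_ge0.
  rewrite nipDr !nipDl.
  have -> : (nE x + nE y) ^+ 2 =
    nE x ^+ 2 + nE y * nE x + (nE x * nE y + nE y ^+ 2) by ring.
  by apply: le_trans (cnormD _ _ _) (lerD _ _);
    apply: le_trans (cnormD _ _ _) (lerD _ _); rewrite ?nnm_sqr ?nip_cs.
Qed.

Lemma nnm_real r x : nE (r%:C *: x) = `|r| * nE x.
Proof.
apply: (@pexpIrn _ 2) => //; rewrite ?nnegrE ?mulr_ge0 ?nnm_ge0 //.
rewrite nnm_sqr nipZr nipRl !cnorm_real exprMn nnm_sqr.
by rewrite mulrA.
Qed.

Lemma nip_lip1 y x x' : nA (ip x y - ip x' y) <= nE y * nE (x - x').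
Proof. by rewrite -nipBl mulrC nip_cs. Qed.

Lemma nip_lip2 x y y' : nA (ip x y - ip x y') <= nE x * nE (y - y').
Proof. by rewrite -nipBr nip_cs. Qed.

Lemma nip_cvgl u l y : converges_to nE u l ->
  converges_to nA (fun n => ip (u n) y) (ip l y).
Proof. exact: (cvgt_map nnm_vnorm (nip_lip1 y)). Qed.

Lemma nip_cvgr u l x : converges_to nE u l ->
  converges_to nA (fun n => ip x (u n)) (ip x l).
Proof. exact: (cvgt_map nnm_vnorm (nip_lip2 x)). Qed.

Lemma nactDl x y a : nact H (x + y) a = nact H x a + nact H y a.
Proof. by apply: nip_ext => w; rewrite nipDr !nip_act nipDr cmulDl. Qed.

Lemma nactDr x a b : nact H x (a + b) = nact H x a + nact H x b.
Proof. by apply: nip_ext => w; rewrite nipDr !nip_act cmulDr. Qed.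

Lemma nactZl z x a : nact H (z *: x) a = z *: nact H x a.
Proof. by apply: nip_ext => w; rewrite nipZr !nip_act nipZr cmulZl. Qed.

Lemma nactZr z x a : nact H x (z *: a) = z *: nact H x a.
Proof. by apply: nip_ext => w; rewrite nipZr !nip_act cmulZr. Qed.

Lemma nactNl x a : nact H (- x) a = - nact H x a.
Proof. by rewrite -scaleN1r nactZl scaleN1r. Qed.

Lemma nactNr x a : nact H x (- a) = - nact H x a.
Proof. by rewrite -scaleN1r nactZr scaleN1r. Qed.

Lemma nact0r x : nact H x 0 = 0.
Proof. by rewrite -(scale0r (0 : A)) nactZr !scale0r. Qed.

Lemma nactA x a b : nact H x (a ** b) = nact H (nact H x a) b.
Proof. by apply: nip_ext => w; rewrite !nip_act cmulA. Qed.

Lemma nip_actl x y a : ip (nact H x a) y = st a ** ip x y.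
Proof. by rewrite nip_sym nip_act cstarM -nip_sym. Qed.

Lemma nnm_act x a : nE (nact H x a) <= nE x * nA a.
Proof.
apply: nnm_leP; first by rewrite mulr_ge0 ?nnm_ge0 ?cnorm_ge0.
rewrite nip_act nip_actl exprMn nnm_sqr.
apply: le_trans (cnormM _ _ _) _; rewrite expr2 mulrA ler_wpM2r ?cnorm_ge0 //.
by apply: le_trans (cnormM _ _ _) _; rewrite cnorm_star mulrC.
Qed.

(** * The C*-algebra of bounded adjointable operators *)

Record op := Op {
  ofn :> E -> E;
  oad : E -> E;
  oadj : forall x y, ip (ofn x) y = ip x (oad y);
  obnd : exists C : R, forall x, nE (ofn x) <= C * nE x
}.
Implicit Types (S T : op).

Lemma oadj' T x y : ip x (T y) = ip (oad T x) y.
Proof. by rewrite nip_sym oadj -nip_sym. Qed.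

Lemma op_ext S T : S =1 T -> S = T.
Proof.
case: S T => [f f' hf bf] [g g' hg bg] /= /funext fg; subst g.
have fg' : f' = g' by apply: funext => x; apply: nip_ext => w; rewrite -hf -hg.
by subst g'; rewrite (Prop_irrelevance hf hg) (Prop_irrelevance bf bg).
Qed.

Lemma ofnD T x y : T (x + y) = T x + T y.
Proof. by apply: nip_ext => w; rewrite nipDr !oadj' nipDr. Qed.

Lemma ofnZ T z x : T (z *: x) = z *: T x.
Proof. by apply: nip_ext => w; rewrite nipZr !oadj' nipZr. Qed.

Lemma ofn_act T x a : T (nact H x a) = nact H (T x) a.
Proof. by apply: nip_ext => w; rewrite nip_act !oadj' nip_act. Qed.

Lemma ofn0 T : T 0 = 0.
Proof. by rewrite -(scale0r (0 : E)) ofnZ !scale0r. Qed.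

Lemma ofnN T x : T (- x) = - T x.
Proof. by rewrite -scaleN1r ofnZ scaleN1r. Qed.

Lemma ofnB T x y : T (x - y) = T x - T y.
Proof. by rewrite ofnD ofnN. Qed.

Lemma obnd_ge0 T : exists2 C, 0 <= C & forall x, nE (T x) <= C * nE x.
Proof.
have [C hC] := obnd T; exists `|C| => // x.
by apply: le_trans (hC x) _; rewrite ler_wpM2r ?nnm_ge0 ?ler_norm.
Qed.

Lemma oad_bound T (C : R) : (forall x, nE (T x) <= C * nE x) ->
  forall x, nE (oad T x) <= C * nE x.
Proof.
move=> h x; have := nnm_sqr H (oad T x); rewrite -oadj => e.
have := nip_cs H (T (oad T x)) x; rewrite -e => h2.
have h3 := h (oad T x); have p0 := nnm_ge0 H (oad T x).
have p1 := nnm_ge0 H x.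
have [->|pn] := eqVneq (nE (oad T x)) 0.
  by apply: le_trans (nnm_ge0 H _) (h x).
have pp : 0 < nE (oad T x) by rewrite lt_def pn.
rewrite -(ler_pM2l pp) -expr2; apply: le_trans h2 _.
rewrite mulrA [_ * C]mulrC.
by rewrite ler_wpM2r.
Qed.

Definition ost T : op.
Proof.
apply: (@Op (oad T) T); first by move=> x y; rewrite oadj'.
by have [C hC] := obnd T; exists C; apply: oad_bound.
Defined.

Definition oscale z : op.
Proof.
apply: (@Op (fun x => z *: x) (fun x => Num.conj z *: x)).
  by move=> x y; rewrite nipZl nipZr.
have [c c0 zc] : exists2 c : R, 0 <= c & `|z| = c%:C.
  by eexists; last exact: normc_def; exact: sqrtr_ge0.
exists c => x; apply: nnm_leP; first by rewrite mulr_ge0 ?nnm_ge0.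
rewrite nipZr nipZl scalerA -lecR cnormZ exprMn nnm_sqr normrM norm_conjC zc.
by rewrite -rmorphM -rmorphM.
Defined.

Definition oadd S T : op.
Proof.
apply: (@Op (fun x => S x + T x) (fun x => oad S x + oad T x)).
  by move=> x y; rewrite nipDl nipDr !oadj.
have [C hC] := obnd S; have [D hD] := obnd T; exists (C + D) => x.
by rewrite mulrDl; apply: le_trans (vnD nnm_vnorm _ _) (lerD _ _).
Defined.

Definition omul S T : op.
Proof.
apply: (@Op (fun x => S (T x)) (fun x => oad T (oad S x))).
  by move=> x y; rewrite !oadj.
have [C C0 hC] := obnd_ge0 S; have [D hD] := obnd T; exists (C * D) => x.
by rewrite -mulrA; apply: le_trans (hC _) _; rewrite ler_wpM2l.
Defined.

(* [othe x y] is the rank one operator [w |-> x <y, w>]. *)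
Definition othe x y : op.
Proof.
apply: (@Op (fun w => nact H x (ip y w)) (fun w => nact H y (ip x w))).
  move=> u v; rewrite nip_actl nip_act -nip_sym.
  by [].
exists (nE x * nE y) => w; apply: le_trans (nnm_act _ _) _.
by rewrite -mulrA ler_wpM2l ?nnm_ge0 // nip_cs.
Defined.

HB.instance Definition _ := gen_eqMixin op.
HB.instance Definition _ := gen_choiceMixin op.

Lemma oaddA : associative oadd.
Proof. by move=> S T U; apply: op_ext => x /=; rewrite addrA. Qed.
Lemma oaddC : commutative oadd.
Proof. by move=> S T; apply: op_ext => x /=; rewrite addrC. Qed.
Lemma oadd0 : left_id (oscale 0) oadd.
Proof. by move=> S; apply: op_ext => x /=; rewrite scale0r add0r. Qed.
Lemma oaddN : left_inverse (oscale 0) (omul (oscale (- 1))) oadd.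
Proof. by move=> S; apply: op_ext => x /=; rewrite scaleN1r addNr scale0r. Qed.

HB.instance Definition _ := GRing.isZmodule.Build op oaddA oaddC oadd0 oaddN.

Lemma omulA : associative omul.
Proof. by move=> S T U; apply: op_ext. Qed.
Lemma omul1l : left_id (oscale 1) omul.
Proof. by move=> S; apply: op_ext => x /=; rewrite scale1r. Qed.
Lemma omul1r : right_id (oscale 1) omul.
Proof. by move=> S; apply: op_ext => x /=; rewrite scale1r. Qed.
Lemma omulDl : left_distributive omul +%R.
Proof. by move=> S T U; apply: op_ext. Qed.
Lemma omulDr : right_distributive omul +%R.
Proof. by move=> S T U; apply: op_ext => x /=; rewrite ofnD. Qed.

HB.instance Definition _ :=
  GRing.Zmodule_isPzRing.Build op omulA omul1l omul1r omulDl omulDr.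

Lemma opD S T x : (S + T) x = S x + T x.
Proof. by []. Qed.
Lemma opM S T x : (S * T) x = S (T x).
Proof. by []. Qed.
Lemma op0 x : (0 : op) x = 0.
Proof. exact: scale0r. Qed.
Lemma op1 x : (1 : op) x = x.
Proof. exact: scale1r. Qed.
Lemma opN T x : (- T) x = - T x.
Proof. exact: scaleN1r. Qed.
Lemma opB S T x : (S - T) x = S x - T x.
Proof. by rewrite opD opN. Qed.
Lemma op_sum (I : Type) (s : seq I) (F : I -> op) x :
  (\sum_(i <- s) F i) x = \sum_(i <- s) F i x.
Proof. by apply: (big_morph (fun T : op => T x)); [|exact: op0]. Qed.

Lemma ost_adj T x y : ip (T x) y = ip x (ost T y).
Proof. exact: oadj. Qed.
Lemma ost_adj' T x y : ip x (T y) = ip (ost T x) y.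
Proof. exact: oadj'. Qed.

Lemma op_st_ext S T : (forall x y, ip x (S y) = ip (T x) y) -> ost S = T.
Proof. by move=> h; apply: op_ext => x; apply: nip_ext => w; rewrite nip_sym -ost_adj' h -nip_sym. Qed.

Lemma ostK T : ost (ost T) = T.
Proof. exact: op_ext. Qed.
Lemma ostD S T : ost (S + T) = ost S + ost T.
Proof. exact: op_ext. Qed.
Lemma ostM S T : ost (S * T) = ost T * ost S.
Proof. exact: op_ext. Qed.

Lemma ostN T : ost (- T) = - ost T.
Proof. by apply: op_st_ext => x y; rewrite !opN nipNr nipNl ost_adj'. Qed.

Definition onm T : R := inf [set C : R | 0 <= C /\ forall x, nE (T x) <= C * nE x]%classic.

Lemma onm_has_inf T :
  has_inf [set C : R | 0 <= C /\ forall x, nE (T x) <= C * nE x]%classic.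
Proof.
by split; [have [C C0 hC] := obnd_ge0 T; exists C | exists 0 => C []].
Qed.

Lemma onm_ge0 T : 0 <= onm T.
Proof. by apply: lb_le_inf; [exact: (onm_has_inf T).1 | move=> C []]. Qed.

Lemma onm_le T (C : R) : 0 <= C -> (forall x, nE (T x) <= C * nE x) -> onm T <= C.
Proof. by move=> C0 h; apply: ge_inf; [exact: (onm_has_inf T).2|]. Qed.

Lemma onmP T x : nE (T x) <= onm T * nE x.
Proof.
apply: (@le_eps _ _ _ (nE x)) => e e0.
have [C [C0 hC] hlt] := inf_adherent e0 (onm_has_inf T).
have := hC x; have := nnm_ge0 H x; rewrite -/(onm T) in hlt.
nra.
Qed.

Lemma onm_leP T x (C : R) : onm T <= C -> nE (T x) <= C * nE x.
Proof.
by move=> h; apply: le_trans (onmP _ _) _; rewrite ler_wpM2r ?nnm_ge0.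
Qed.

Lemma onm_eq0 T : onm T = 0 -> T = 0.
Proof.
move=> h; apply: op_ext => x; rewrite op0; apply: (nnm_eq0 (n := H)); apply/eqP.
by rewrite eq_le nnm_ge0 andbT; have := onmP T x; rewrite h mul0r.
Qed.

Lemma onmD S T : onm (S + T) <= onm S + onm T.
Proof.
apply: onm_le => [|x]; first by rewrite addr_ge0 ?onm_ge0.
by rewrite mulrDl; apply: le_trans (vnD nnm_vnorm _ _) (lerD _ _); apply: onmP.
Qed.

Lemma onmM S T : onm (S * T) <= onm S * onm T.
Proof.
apply: onm_le => [|x]; first by rewrite mulr_ge0 ?onm_ge0.
by rewrite -mulrA; apply: le_trans (onmP S (T x)) _; rewrite ler_wpM2l ?onm_ge0 ?onmP.
Qed.

Definition osc r : op := oscale r%:C.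

Lemma onm_osc r : onm (osc r) <= `|r|.
Proof. by apply: onm_le => // x; rewrite nnm_real. Qed.

Lemma onm_ost T : onm T ^+ 2 <= onm (ost T * T).
Proof.
have h0 := onm_ge0 (ost T * T).
rewrite -[leRHS]sqr_sqrtr // ler_pXn2r ?nnegrE ?onm_ge0 ?sqrtr_ge0 //.
apply: onm_le => [|x]; first exact: sqrtr_ge0.
apply: nnm_leP; first by rewrite mulr_ge0 ?sqrtr_ge0 ?nnm_ge0.
rewrite exprMn sqr_sqrtr // ost_adj; apply: le_trans (nip_cs _ _ _) _.
rewrite expr2 mulrA mulrC ler_wpM2r ?nnm_ge0 //.
exact: (onmP (ost T * T) x).
Qed.

Lemma onm_complete : complete_for onm.
Proof.
move=> u hu.
have pc (v : nat -> op) x : cauchy_seq onm v -> exists l, converges_to nE (fun n => v n x) l.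
  move=> hv; apply: ncomplete => e e0.
  have eK : 0 < e / (nE x + 1) by rewrite divr_gt0 // ltr_wpDl ?nnm_ge0.
  have [N hN] := hv _ eK; exists N => m n Nm Nn; rewrite -opB.
  apply: le_lt_trans (onmP _ _) _; have := hN _ _ Nm Nn.
  rewrite ltr_pdivlMr ?ltr_wpDl ?nnm_ge0 // => h; apply: le_lt_trans h.
  by rewrite ler_wpM2l ?onm_ge0 // lerDl.
(* The limit has to come with an adjoint, which is the pointwise limit of the adjoints. *)
have hu' : cauchy_seq onm (fun n => ost (u n)).
  move=> e /hu[N hN]; exists N => m n Nm Nn; apply: le_lt_trans (hN _ _ Nm Nn).
  apply: onm_le; first exact: onm_ge0.
  move=> x; have := @oad_bound (u m - u n) _ (fun y => onmP _ y) x.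
  by rewrite -ostN -ostD.
have [f hf] := choice (pc u ^~ hu).
have [g hg] := choice (pc _ ^~ hu').
have adj x y : ip (f x) y = ip x (g y).
  apply: (cvgt_unique (cnorm_vnorm cA) (nip_cvgl y (hf x))).
  move=> e /(nip_cvgr x (hg y))[N hN]; exists N => n /hN.
  by rewrite -ost_adj.
have key e : 0 < e -> exists N, forall n, (N <= n)%N ->
    forall x, nE (u n x - f x) <= e * nE x.
  move=> /hu[N hN]; exists N => n Nn x.
  have := cvgtB (nnm_vnorm) (cvgt_cst nnm_vnorm (u n x)) (hf x).
  move=> /(cvgt_le nnm_vnorm); apply; exists N => m Nm.
  rewrite -opB; apply: le_trans (onmP _ _) _; rewrite ler_wpM2r ?nnm_ge0 //.
  by rewrite ltW // hN.
have bf : exists C : R, forall x, nE (f x) <= C * nE x.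
  have [N /(_ N (leqnn N)) hN] := key _ ltr01.
  exists (1 + onm (u N)) => x; rewrite mulrDl.
  have := vnD nnm_vnorm (f x - u N x) (u N x); rewrite subrK.
  by have := hN x; have := onmP (u N) x; rewrite (vnBC nnm_vnorm); lra.
exists (Op adj bf) => e e0; have e2 : 0 < e / 2 by lra.
have [N hN] := key _ e2; exists N => n Nn.
apply: (@le_lt_trans _ _ (e / 2)); last by lra.
by apply: onm_le => [|x]; [exact: ltW | rewrite opB; apply: hN].
Qed.

Lemma oscD r s : osc (r + s) = osc r + osc s.
Proof. by apply: op_ext => x /=; rewrite rmorphD scalerDl. Qed.
Lemma oscM r s : osc (r * s) = osc r * osc s.
Proof. by apply: op_ext => x /=; rewrite rmorphM scalerA. Qed.
Lemma osc1 : osc 1 = 1.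
Proof. by []. Qed.
Lemma oscaleC z T : oscale z * T = T * oscale z.
Proof. by apply: op_ext => x /=; rewrite ofnZ. Qed.
Lemma ost_osc r : ost (osc r) = osc r.
Proof. by apply: op_ext => x /=; rewrite conj_real. Qed.
Lemma oII : oscale 'i * oscale 'i = - 1.
Proof. by apply: op_ext => x /=; rewrite scale1r scalerA -expr2 sqr_i. Qed.
Lemma ost_oI : ost (oscale 'i) = - oscale 'i.
Proof.
apply: op_ext => x /=; rewrite scalerA; congr (_ *: _).
by rewrite mulN1r; apply/eqP; rewrite eq_complex /= oppr0 !eqxx.
Qed.

Definition op_cstar : unital_cstar R op :=
  UnitalCstar ostD ostM ostK oscD oscM osc1 (fun r => oscaleC r%:C) ost_osc
    (oscaleC 'i) oII ost_oI onm_ge0 onm_eq0 onmD onmM onm_osc onm_ost onm_complete.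

Lemma onm_vnorm : vnorm onm.
Proof.
split; [exact: onm_ge0|exact: onm_eq0|exact: (unm0 op_cstar)|exact: (unmN op_cstar)|exact: onmD].
Qed.

Lemma op_cvg u (T : op) x : converges_to onm u T -> converges_to nE (fun n => u n x) (T x).
Proof.
apply: (cvgt_map onm_vnorm (f := fun T : op => T x) (K := nE x)) => S U.
by rewrite -opB mulrC onmP.
Qed.

End NModule.

Lemma ustE (R : realType) (A : lmodType R[i]) (cA : cstar_algebra A) (E : lmodType R[i])
  (H : nmod cA E) (T : op H) : ust (op_cstar H) T = ost T.
Proof. by []. Qed.

Lemma oscE (R : realType) (A : lmodType R[i]) (cA : cstar_algebra A) (E : lmodType R[i])
  (H : nmod cA E) r x : osc H r x = r%:C *: x.
Proof. by []. Qed.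

Lemma oscaleE (R : realType) (A : lmodType R[i]) (cA : cstar_algebra A) (E : lmodType R[i])
  (H : nmod cA E) z x : oscale H z x = z *: x.
Proof. by []. Qed.

Lemma otheE (R : realType) (A : lmodType R[i]) (cA : cstar_algebra A) (E : lmodType R[i])
  (H : nmod cA E) x y w : othe H x y w = nact H x (nip H y w).
Proof. by []. Qed.

Opaque oadd omul oscale ost othe.

(** * Positive operators *)

Section SelfModule.
Variables (R : realType) (A : lmodType R[i]) (cA : cstar_algebra A).
Local Notation "a ** b" := (cmul cA a b) (at level 40, left associativity).
Local Notation nA := (cnorm cA).
Local Notation st := (cstar cA).
Implicit Types (a b c : A) (r : R).

Definition selfmod : nmod cA A.
Proof.
refine (@NMod R A cA A (fun a b => st a ** b) (cmul cA) nA _ _ _ _ _ _ _ _ _).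
- by move=> x y y'; rewrite cmulDr.
- by move=> z x y; rewrite cmulZr.
- by move=> x y a; rewrite cmulA.
- by move=> x y; rewrite cstarM cstarK.
- exact: cnorm_ge0.
- by move=> x; rewrite cnorm_cstar_id.
- exact: cnorm_eq0.
- by move=> x y; rewrite -(cnorm_star cA x); exact: cnormM.
- exact: ccomplete.
Defined.

Definition Lop a : op selfmod.
Proof.
apply: (@Op _ _ _ _ selfmod (cmul cA a) (cmul cA (st a))).
  by move=> x y /=; rewrite cstarM cmulA.
by exists (nA a) => x; exact: cnormM.
Defined.

Local Notation OC := (op_cstar selfmod).

Lemma LopD a b : Lop (a + b) = Lop a + Lop b.
Proof. by apply: op_ext => x; rewrite opD /= cmulDl. Qed.
Lemma LopN a : Lop (- a) = - Lop a.
Proof. by apply: op_ext => x; rewrite opN /= cmulNl. Qed.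
Lemma LopB a b : Lop (a - b) = Lop a - Lop b.
Proof. by rewrite LopD LopN. Qed.
Lemma Lop0 : Lop 0 = 0.
Proof. by apply: op_ext => x; rewrite op0 /= cmul0r. Qed.
Lemma LopM a b : Lop (a ** b) = Lop a * Lop b.
Proof. by apply: op_ext => x; rewrite opM /= cmulA. Qed.
Lemma LopR r a : Lop (r%:C *: a) = osc selfmod r * Lop a.
Proof. by apply: op_ext => x; rewrite opM oscE /= cmulZl. Qed.
Lemma Lop_st a : ost (Lop a) = Lop (st a).
Proof. by apply: op_st_ext => x y /=; rewrite cstarM cstarK cmulA. Qed.

Lemma onm_Lop a : onm (Lop a) = nA a.
Proof.
apply/eqP; rewrite eq_le; apply/andP; split.
  by apply: onm_le; [exact: cnorm_ge0 | move=> x; exact: cnormM].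
have := onmP (Lop a) (st a) => /=.
have -> : nA (a ** st a) = nA a ^+ 2.
  by have := cnorm_cstar_id cA (st a); rewrite cstarK cnorm_star.
rewrite cnorm_star; have := cnorm_ge0 cA a; have := onm_ge0 (Lop a).
have [->//|n0] := eqVneq (nA a) 0.
by move=> _ h; rewrite expr2 ler_pM2r // lt_def n0.
Qed.

(** [A] may lack the unit that [cpos] refers to; left multiplication embeds [A] isometrically in the
    unital algebra of operators on [A], and positivity is read there. *)
Variant Pos a : Prop := IsPos of cpos OC (Lop a).

Lemma Pos0 : Pos 0.
Proof. by split; rewrite Lop0; exact: cpos0. Qed.

Lemma PosD a b : Pos a -> Pos b -> Pos (a + b).
Proof. by case=> ha [hb]; split; rewrite LopD; exact: cposD. Qed.

Lemma PosR r a : 0 <= r -> Pos a -> Pos (r%:C *: a).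
Proof. by move=> r0 [ha]; split; rewrite LopR; exact: (@cpos_scale _ _ OC). Qed.

Lemma Pos_stM b : Pos (st b ** b).
Proof. by split; rewrite LopM -Lop_st; exact: (cpos_stM OC). Qed.

Lemma Pos_conj a c : Pos a -> Pos (st c ** a ** c).
Proof. by case=> ha; split; rewrite !LopM -Lop_st; exact: (@cpos_conj _ _ OC). Qed.

Lemma Pos_mono a b : Pos a -> Pos (b - a) -> nA a <= nA b.
Proof. by case=> ha []; rewrite -!onm_Lop LopB; exact: (@unm_mono _ _ OC). Qed.

Lemma Pos_limit u a : (forall n, Pos (u n)) -> converges_to nA u a -> Pos a.
Proof.
move=> hu h; split; apply: (@cpos_limit _ _ OC (fun n => Lop (u n))).
  by move=> n; case: (hu n).
by move=> e /h[N hN]; exists N => n /hN; rewrite /= -LopB onm_Lop.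
Qed.

Lemma Pos_norm a c (m : R) : Pos a -> nA a <= m ->
  Pos (m%:C *: (st c ** c) - st c ** a ** c).
Proof.
case=> pa am; have h : cpos OC (osc selfmod m - Lop a).
  by apply: (cpos_cscB (S := OC)); [exact: (cpos_st (S := OC)) | rewrite [unm _ _]onm_Lop].
split; have := cpos_conj (Lop c) h; rewrite LopB !LopM LopR LopM -Lop_st.
rewrite ustE mulrBr mulrBl.
by rewrite -[ost _ * osc _ _](cscC OC) -!mulrA.
Qed.

Definition leA a b := Pos (b - a).

Lemma leA_refl a : leA a a.
Proof. by rewrite /leA subrr; exact: Pos0. Qed.

Lemma leA_trans b a c : leA a b -> leA b c -> leA a c.
Proof.
by move=> h h'; have := PosD h h'; rewrite (_ : _ + _ = c - a) //; abel.
Qed.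

Lemma leAD a b a' b' : leA a b -> leA a' b' -> leA (a + a') (b + b').
Proof.
by move=> h h'; have := PosD h h'; rewrite (_ : _ + _ = b + b' - (a + a')) //; abel.
Qed.

Lemma leAR r a b : 0 <= r -> leA a b -> leA (r%:C *: a) (r%:C *: b).
Proof. by move=> r0; rewrite /leA -scalerBr; exact: PosR. Qed.

Lemma leA_scale r r' a : Pos a -> r <= r' -> leA (r%:C *: a) (r'%:C *: a).
Proof.
by move=> pa rr; rewrite /leA -scalerBl -rmorphB; apply: PosR; rewrite // subr_ge0.
Qed.

Lemma leA_sum (I : Type) (s : seq I) (F G : I -> A) :
  (forall i, leA (F i) (G i)) -> leA (\sum_(i <- s) F i) (\sum_(i <- s) G i).
Proof.
move=> h; elim: s => [|i s IH]; first by rewrite !big_nil; exact: leA_refl.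
by rewrite !big_cons; apply: leAD (h i) IH.
Qed.

Lemma leA_Pos a b : Pos a -> leA a b -> Pos b.
Proof. by move=> pa ab; rewrite -[b](subrK a); exact: PosD. Qed.

Section Sesquilinear.
Variables (E : lmodType R[i]) (ip : E -> E -> A) (act : E -> A -> E).
Hypothesis ipD : forall x y y', ip x (y + y') = ip x y + ip x y'.
Hypothesis ipZ : forall (z : R[i]) x y, ip x (z *: y) = z *: ip x y.
Hypothesis ip_act : forall x y a, ip x (act y a) = ip x y ** a.
Hypothesis ip_sym : forall x y, ip y x = st (ip x y).
Hypothesis ip_pos : forall x, Pos (ip x x).

(** Expand the positive element [<x a - m y, x a - m y>] with [a = <x, y>] and use
    [st a <x, x> a <= m (st a a)]: what remains is [m (m <y, y> - st a a)], and [m > 0] is divided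
    out. *)
Lemma cs_order x y (m : R) : 0 < m -> nA (ip x x) <= m ->
  leA (st (ip x y) ** ip x y) (m%:C *: ip y y).
Proof.
move=> m0 hm; set a := ip x y.
have ipl u v w (z : R[i]) : ip (u + z *: v) w = ip u w + Num.conj z *: ip v w.
  by rewrite ip_sym ipD ipZ cstarD cstarZ -!ip_sym.
have h1 := ip_pos (act x a + (- m)%:C *: y).
rewrite ipl !ipD !ipZ conj_real !ip_act in h1.
have e1 : ip (act x a) x = st a ** ip x x by rewrite ip_sym ip_act cstarM -ip_sym.
have e2 : ip (act x a) y = st a ** a by rewrite ip_sym ip_act cstarM -!ip_sym.
have e3 : ip y x = st a by rewrite ip_sym.
rewrite e1 e2 e3 in h1.
have h2 := Pos_norm a (ip_pos x) hm.
set b := st a ** a in h1 h2 *.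
have key u : Pos u -> u = m%:C *: (m%:C *: ip y y - b) -> leA b (m%:C *: ip y y).
  have mi : 0 <= m^-1 by rewrite invr_ge0 ltW.
  move=> /(PosR mi) + uE.
  rewrite uE scalerA -rmorphM mulVf; last by rewrite gt_eqF.
  by rewrite scale1r => h3; exact: h3.
apply: key (PosD h1 h2) _.
rewrite rmorphN !scaleNr !scalerDr !scalerN opprD opprK.
abel.
Qed.

Lemma cs_norm x y : nA (ip x y) ^+ 2 <= nA (ip x x) * nA (ip y y).
Proof.
apply: (@le_eps _ _ _ (nA (ip y y))) => e e0.
have m0 : 0 < nA (ip x x) + e by rewrite ltr_wpDl ?cnorm_ge0.
have hm : nA (ip x x) <= nA (ip x x) + e by rewrite lerDl ltW.
have := Pos_mono (Pos_stM _) (cs_order y m0 hm).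
by rewrite cnorm_cstar_id cnorm_real gtr0_norm // mulrDl [_ * e]mulrC.
Qed.

End Sesquilinear.

End SelfModule.

(** For self-adjoint [t] and [z] the right-hand side is the conjugate of [s] by [z * t], the form
    that [opos_conj] accepts. *)
Lemma comm_sandwich (B : pzRingType) (s t z : B) :
  s * t = t * s -> z * s = s * z -> z * t = t * z ->
  s * (t * t) * (z * z) = t * z * s * (z * t).
Proof.
move=> st zs zt; rewrite -[t * z * s]mulrA zs [t * (s * z)]mulrA zt.
by rewrite [RHS]mulrA -[t * s * z * t]mulrA zt !mulrA st.
Qed.

Lemma comm_square (B : pzRingType) (t z : B) : z * t = t * z ->
  t * t * (z * z) = t * z * (z * t).
Proof.
by move=> zt; rewrite zt [RHS]mulrA -[t * z * t]mulrA zt !mulrA.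
Qed.

(** * Order estimates for operators on a Hilbert module *)

Section Positive.
Variables (R : realType) (A : lmodType R[i]) (cA : cstar_algebra A).
Variables (E : lmodType R[i]) (H : nmod cA E).
Hypothesis hpos : forall x, Pos cA (nip H x x).
Local Notation "a ** b" := (cmul cA a b) (at level 40, left associativity).
Local Notation nA := (cnorm cA).
Local Notation st := (cstar cA).
Local Notation ip := (nip H).
Local Notation nE := (nnm H).
Local Notation leA := (leA cA).
Implicit Types (x y : E) (a b : A) (r : R) (S T P : op H).

Lemma leA_nnm x y (C : R) : 0 <= C -> leA (ip x x) ((C ^+ 2)%:C *: ip y y) ->
  nE x <= C * nE y.
Proof.
move=> C0 h; apply: nnm_leP; first by rewrite mulr_ge0 ?nnm_ge0.
have := Pos_mono (hpos x) h.
by rewrite cnorm_real -!nnm_sqr exprMn ger0_norm ?sqr_ge0.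
Qed.

Definition opos T := forall x, Pos cA (ip x (T x)).

Lemma opos_stM S : opos (ost S * S).
Proof. by move=> x; rewrite opM -ost_adj. Qed.

Lemma opos_conj S T : opos T -> opos (ost S * T * S).
Proof. by move=> h x; rewrite !opM -ost_adj. Qed.

Lemma oposD S T : opos S -> opos T -> opos (S + T).
Proof. by move=> hS hT x; rewrite opD nipDr; apply: PosD. Qed.

Lemma opos0 : opos 0.
Proof. by move=> x; rewrite op0 nip0r; exact: Pos0. Qed.

Lemma opos_osc r T : 0 <= r -> opos T -> opos (osc H r * T).
Proof. by move=> r0 hT x; rewrite opM nipZr; apply: PosR. Qed.

Lemma opos_leA S T x : opos (T - S) -> leA (ip x (S x)) (ip x (T x)).
Proof. by move=> /(_ x); rewrite opB nipBr. Qed.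

Lemma osc0 : osc H 0 = 0.
Proof. exact: (csc0 (op_cstar H)). Qed.

Lemma ost1 : ost (1 : op H) = 1.
Proof. exact: (ust1 (op_cstar H)). Qed.

Lemma ostB S T : ost (S - T) = ost S - ost T.
Proof. exact: (ustB (op_cstar H)). Qed.

Lemma ostX T n : ost (T ^+ n) = ost T ^+ n.
Proof.
by elim: n => [|n IH]; [rewrite !expr0 ost1 | rewrite exprS ostM IH -exprSr].
Qed.

Lemma opos_1B T : ost T = T -> onm T <= 1 -> opos (1 - T).
Proof.
move=> sT T1; have [y [yy _ ys _]] := @sqrt_exists _ _ (op_cstar H) T T1.
have sy : ost (1 - y) = 1 - y by rewrite ostB ost1 [ost y]ys.
by rewrite -yy -{1}sy; exact: opos_stM.
Qed.

(** The sums over windows are compared in the order of [A], where near orthogonality is visible, so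
    a norm bound is needed in this form. For [c = onm T] nonzero, [ost T * T] divided by [c^2] is a
    self-adjoint contraction. *)
Lemma op_leA T (C : R) x : onm T <= C -> leA (ip (T x) (T x)) ((C ^+ 2)%:C *: ip x x).
Proof.
move=> TC; apply: (@leA_trans _ _ _ (((onm T) ^+ 2)%:C *: ip x x)); last first.
  by apply: leA_scale => //; rewrite ler_pXn2r ?nnegrE ?onm_ge0 // (le_trans (onm_ge0 T)).
rewrite ost_adj; have [T0|Tn] := eqVneq (onm T) 0.
  rewrite (onm_eq0 T0) op0 ofn0 nip0r (_ : onm 0 = 0) ?expr0n ?scale0r; last exact: (unm0 (op_cstar H)).
  exact: leA_refl.
set c := onm T; have c0 : 0 < c ^+ 2 by rewrite exprn_gt0 // lt_def Tn onm_ge0.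
pose X := osc H (c ^+ 2)^-1 * (ost T * T).
have sX : ost X = X by rewrite ostM ost_osc ostM ostK [RHS]oscaleC.
have X1 : onm X <= 1.
  apply: le_trans (unm_scale_ge0 (op_cstar H) _ _) _; first by rewrite invr_ge0 ltW.
  rewrite mulrC ler_pdivrMr // mul1r; apply: le_trans (onmM _ _) _.
  by rewrite [onm (ost T)](unm_st (op_cstar H)) -expr2.
have := leAR (ltW c0) (opos_leA x (opos_1B sX X1)).
have cn : c ^+ 2 != 0 by rewrite gt_eqF.
rewrite op1 /X opM nipZr scalerA -rmorphM (mulfV cn) scale1r => h; exact: h.
Qed.

Lemma onm_leA T (C : R) : 0 <= C ->
  (forall x, leA (ip (T x) (T x)) ((C ^+ 2)%:C *: ip x x)) -> onm T <= C.
Proof. by move=> C0 h; apply: onm_le => // x; apply: leA_nnm. Qed.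

Lemma opos_sub_sqr P : ost P = P -> opos P -> opos (1 - P) -> opos (P - P * P).
Proof.
move=> sP hP hQ.
have -> : P - P * P = ost P * (1 - P) * P + ost (1 - P) * P * (1 - P).
  by rewrite ostB ost1 sP; ncring.
by apply: oposD; apply: opos_conj.
Qed.

Lemma opos_onm1 P : ost P = P -> opos P -> opos (1 - P) -> onm P <= 1.
Proof.
move=> sP hP hQ; apply: onm_leA => // x; rewrite ost_adj sP expr1n scale1r.
have h : opos (1 - P * P).
  rewrite (_ : _ - _ = 1 - P + (P - P * P)); last by abel.
  by apply: oposD => //; apply: opos_sub_sqr.
by have := h x; rewrite opB op1 nipBr.
Qed.

Section Powers.
Variable k : op H.
Hypotheses (sk : ost k = k) (k0 : opos k) (k1 : opos (1 - k)).
Local Notation s := (1 - k).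

Lemma ost_s : ost s = s.
Proof. by rewrite ostB ost1 sk. Qed.

Lemma ost_sX n : ost (s ^+ n) = s ^+ n.
Proof. by rewrite ostX ost_s. Qed.

Lemma onm_s : onm s <= 1.
Proof.
apply: opos_onm1 => //; first exact: ost_s.
by rewrite opprB addrC subrK.
Qed.

Lemma onm_sX n : onm (s ^+ n) <= 1.
Proof.
elim: n => [|n IH]; first exact: (unm1 (op_cstar H)).
rewrite exprS; apply: le_trans (onmM _ _) _.
by rewrite -[leRHS]mulr1; apply: ler_pM; rewrite ?onm_ge0 ?onm_s.
Qed.

Lemma sk_comm n : s ^+ n * k = k * s ^+ n.
Proof.
apply: commr_sym; apply: commrX; rewrite /GRing.comm.
by rewrite mulrBr mulrBl mulr1 mul1r.
Qed.

Lemma opos_sXsqr i z : ost z = z -> z * s = s * z -> opos (s ^+ i * (z * z)).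
Proof.
move=> sz zs; have zsX j : z * s ^+ j = s ^+ j * z by apply: commrX.
rewrite -(odd_double_half i); case: (odd i) => /=.
  have -> : s ^+ (1 + i./2.*2) * (z * z) = ost (z * s ^+ i./2) * s * (z * s ^+ i./2).
    rewrite ostM ost_sX sz -addnn add1n exprS exprD.
    by apply: comm_sandwich => //; apply: commrX.
  exact: opos_conj.
have -> : s ^+ (0 + i./2.*2) * (z * z) = ost (z * s ^+ i./2) * (z * s ^+ i./2).
  rewrite ostM ost_sX sz -addnn add0n exprD.
  exact: comm_square.
exact: opos_stM.
Qed.

Lemma opos_sX i : opos (s ^+ i).
Proof.
have := @opos_sXsqr i 1; rewrite !mulr1; apply; first exact: ost1.
by rewrite mul1r.
Qed.

(** Operator form of [1 - (1 - t)^m >= m t (1 - t)^m]: passing from [m] to [m + 1] adds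
    [(m + 1) s^m k^2], positive by [opos_sXsqr]. *)
Lemma opos_sXk m : opos (1 - s ^+ m - osc H m%:R * (s ^+ m * k)).
Proof.
elim: m => [|m IH].
  by rewrite expr0 subrr osc0 mul0r subr0; exact: opos0.
have -> : 1 - s ^+ m.+1 - osc H m.+1%:R * (s ^+ m.+1 * k) =
  1 - s ^+ m - osc H m%:R * (s ^+ m * k) + osc H m.+1%:R * (s ^+ m * (k * k)).
  rewrite exprSr -natr1 oscD osc1; ncring.
apply: oposD => //; apply: opos_osc; first exact: ler0n.
apply: opos_sXsqr => //.
by have := sk_comm 1; rewrite expr1 => ->.
Qed.

(* The operator form of [(2n+1) t (1-t)^(2n) <= 1] on [[0, 1]]. *)
Lemma sXk_bound n x :
  leA ((n.*2.+1)%:R%:C *: ip ((s ^+ n) x) (k ((s ^+ n) x))) (ip x x).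
Proof.
have h : opos (1 - osc H (n.*2.+1)%:R * (s ^+ n * k * s ^+ n)).
  have -> : 1 - osc H (n.*2.+1)%:R * (s ^+ n * k * s ^+ n) =
     1 - s ^+ n.*2 - osc H n.*2%:R * (s ^+ n.*2 * k) + s ^+ n.*2 * (1 - k).
    have -> : s ^+ n * k * s ^+ n = s ^+ n.*2 * k.
      by rewrite -mulrA -sk_comm mulrA -exprD addnn.
    by rewrite -natr1 oscD osc1; ncring.
  by apply: oposD; [exact: opos_sXk | rewrite -exprSr; exact: opos_sX].
have := opos_leA x h; rewrite op1 opM nipZr !opM.
by rewrite -{1}(ost_sX n) -ost_adj.
Qed.

(** Even exponents make each step a conjugate: [s^(2m) - s^(2m+2) = s^m (1 - s^2) s^m], where
    [1 - s^2 = k + (s - s^2)]. *)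
Lemma opos_sX_decr n m : (n <= m)%N -> opos (s ^+ n.*2 - s ^+ m.*2).
Proof.
elim: m => [|m IH]; first by rewrite leqn0 => /eqP ->; rewrite subrr; exact: opos0.
rewrite leq_eqVlt => /orP[/eqP ->|]; first by rewrite subrr; exact: opos0.
rewrite ltnS => /IH h.
rewrite (_ : _ - _ = s ^+ n.*2 - s ^+ m.*2 + (s ^+ m.*2 - s ^+ m.+1.*2)); last by abel.
apply: oposD => //.
have -> : s ^+ m.*2 - s ^+ m.+1.*2 = ost (s ^+ m) * (1 - s * s) * s ^+ m.
  rewrite ost_sX mulrBr mulr1 mulrBl -exprD addnn; congr (_ - _).
  by rewrite doubleS -addnn -expr2 -!exprD addn2 !addSn.
apply: opos_conj; rewrite (_ : _ - _ = k + (s - s * s)); last by ncring.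
apply: oposD => //; apply: opos_sub_sqr => //; first exact: ost_s.
by rewrite opprB addrC subrK.
Qed.

End Powers.

End Positive.

(** * Approximation of a vector by its own multiples *)

Section VectorLift.
Variables (R : realType) (A : lmodType R[i]) (cA : cstar_algebra A).
Variables (E : lmodType R[i]) (H : nmod cA E).
Hypothesis hpos : forall x, Pos cA (nip H x x).
Local Notation "a ** b" := (cmul cA a b) (at level 40, left associativity).
Local Notation nA := (cnorm cA).
Local Notation st := (cstar cA).
Local Notation ip := (nip H).
Local Notation nE := (nnm H).

(** With a unit one would take [a = 1]. Here [a = b = <z, z>] does: the left side squared is the
    norm of [b^3], and the C*-identity gives [|b|^4 <= |b| |b^3|]. *)
Lemma nnm_le_act (z : E) (C : R) : 0 <= C ->
  (forall a, nE (nact H z a) <= C * nA a) -> nE z <= C.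
Proof.
move=> C0 h; pose b := ip z z; have sb : st b = b by rewrite -nip_sym.
have b0 := cnorm_ge0 cA b.
have h1 : nA (b ** b ** b) <= C ^+ 2 * nA b ^+ 2.
  have := h b; rewrite -(ler_pXn2r (n := 2)) ?nnegrE ?mulr_ge0 ?nnm_ge0 //.
  by rewrite nnm_sqr nip_act nip_actl sb exprMn.
have bb : nA (b ** b) = nA b ^+ 2 by rewrite -{1}sb cnorm_cstar_id.
have h2 : nA b ^+ 4 <= nA b * nA (b ** b ** b).
  have -> : nA b ^+ 4 = nA ((b ** b) ** (b ** b)).
    have sbb : st (b ** b) = b ** b by rewrite cstarM sb.
    by rewrite -{1}sbb cnorm_cstar_id bb -exprM.
  by rewrite -!cmulA; exact: cnormM.
apply: nnm_leP => //; rewrite -/b.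
have [->|bn] := eqVneq (nA b) 0; first exact: sqr_ge0.
have bp : 0 < nA b ^+ 3 by rewrite exprn_gt0 // lt_def bn.
rewrite -(ler_pM2r bp) -exprS; apply: le_trans h2 _.
rewrite (_ : _ * _ ^+ 3 = nA b * (C ^+ 2 * nA b ^+ 2)); last by ring.
by rewrite ler_wpM2l.
Qed.

Variables (z : E) (l : R).
Hypotheses (l0 : 0 <= l) (l1 : l * nA (ip z z) <= 1).

(** This is [z (1 - l <z, z>)^n], written recursively because [A] need not contain [1]. For [l > 0]
    it tends to [0], while [z - zseq n] is [z] times an element of any closed ideal containing
    [<z, z>]. So [z] is a limit of products [z b] with [b] in that ideal. *)
Fixpoint zseq (n : nat) : E :=
  if n is n'.+1 then zseq n' - l%:C *: nact H (zseq n') (ip z z) else z.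

Let X : op (selfmod cA) := osc _ l * Lop cA (ip z z).

Let sX : ost X = X.
Proof. by rewrite ostM ost_osc Lop_st -nip_sym [RHS]oscaleC. Qed.

Let X0 : opos X.
Proof.
move=> a /=; rewrite cmulZr; apply: PosR => //.
by rewrite cmulA; exact: Pos_conj.
Qed.

Let selfpos (a : A) : Pos cA (nip (selfmod cA) a a).
Proof. exact: Pos_stM. Qed.

Let X1 : opos (1 - X).
Proof.
apply: opos_1B => //; apply: le_trans (unm_scale_ge0 (op_cstar _) _ l0) _.
by rewrite [unm _ _]onm_Lop.
Qed.

Lemma zseq_act n a : nact H (zseq n) a = nact H z (((1 - X) ^+ n) a).
Proof.
elim: n a => [|n IH] a; first by rewrite op1.
rewrite exprSr opM -IH opB op1 /= nactDl nactNl nactZl -nactA -nactZr.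
by rewrite nactDr nactNr.
Qed.

Lemma zseq_le n : nE (zseq n) <= nE z.
Proof.
apply: nnm_le_act; first exact: nnm_ge0.
move=> a; rewrite zseq_act; apply: le_trans (nnm_act _ _ _) _.
rewrite ler_wpM2l ?nnm_ge0 //.
have := @onm_leP _ _ _ _ _ ((1 - X) ^+ n) a 1; rewrite mul1r; apply.
exact: onm_sX.
Qed.

(** For [b = (1 - X)^n a], [sXk_bound] with [k = X] reads [(2n + 1) l (st b <z, z> b) <= st a a],
    and [st b <z, z> b] is the inner square of [zseq n] acting on [a]. *)
Lemma zseq_bound n : (n.*2.+1)%:R * l * nE (zseq n) ^+ 2 <= 1.
Proof.
have [l00|ln] := eqVneq l 0; first by rewrite l00 mulr0 mul0r.
have c0 : 0 < (n.*2.+1)%:R * l by rewrite mulr_gt0 ?ltr0n // lt_def ln.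
set c := _ * l in c0 *.
rewrite mulrC -ler_pdivlMr // mul1r -[leRHS]sqr_sqrtr ?invr_ge0 ?(ltW c0) //.
rewrite ler_pXn2r ?nnegrE ?nnm_ge0 ?sqrtr_ge0 //.
apply: nnm_le_act; first exact: sqrtr_ge0.
move=> a; rewrite -(ler_pXn2r (n := 2)) ?nnegrE ?mulr_ge0 ?nnm_ge0 ?sqrtr_ge0 ?cnorm_ge0 //.
rewrite exprMn sqr_sqrtr ?invr_ge0 ?(ltW c0) // [leRHS]mulrC ler_pdivlMr // mulrC.
rewrite zseq_act nnm_sqr nip_act nip_actl.
set b := ((1 - X) ^+ n) a.
have := @sXk_bound _ _ _ _ _ selfpos X sX X1 n a; rewrite -/b /=.
rewrite cmulZr scalerA -rmorphM -/c cmulA => h.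
have p : Pos cA (c%:C *: (st b ** ip z z ** b)).
  by apply: PosR; [exact: ltW | exact: Pos_conj].
by have := Pos_mono p h; rewrite cnorm_real gtr0_norm // cnorm_cstar_id.
Qed.

Variable I : A -> Prop.
Hypothesis hI : closed_ideal cA I.

Lemma zseq_ideal n : I (ip z z) -> exists2 b, I b & zseq n = z - nact H z b.
Proof.
case: hI => I0 ID IZ IM _ hz; elim: n => [|n [b Ib IH]].
  by exists 0 => //; rewrite nact0r subr0.
exists (b + l%:C *: (ip z z - b ** ip z z)).
  have h1 : I (- (b ** ip z z)) by rewrite -scaleN1r; apply: IZ; have [] := IM b _ hz.
  exact: (ID _ _ Ib (IZ _ _ (ID _ _ hz h1))).
rewrite /= IH !nactDl !nactNl !nactDr !nactZr !nactDr !nactNr nactA !scalerDr !scalerN.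
abel.
Qed.

Lemma zseq_small e : 0 < e -> 0 < l -> exists n, nE (zseq n) < e.
Proof.
move=> e0 lp; have K0 : 0 < l * e ^+ 2 by rewrite mulr_gt0 ?exprn_gt0.
have [N /(_ N (leqnn N)) hN] := @tends0_inv R 1 _ K0.
exists N; rewrite ltNge; apply/negP => h.
have := zseq_bound N; apply/negP; rewrite -ltNge.
move: hN; rewrite ltr_pdivrMr ?ltr0n // => hN; apply: lt_le_trans hN _.
have p1 : N.+1%:R * l <= (N.*2.+1)%:R * l.
  by apply: ler_wpM2r => //; rewrite ler_nat ltnS -addnn leq_addr.
have p2 : e ^+ 2 <= nE (zseq N) ^+ 2.
  by rewrite ler_pXn2r ?nnegrE ?nnm_ge0 // ltW.
have -> : l * e ^+ 2 * N.+1%:R = N.+1%:R * l * e ^+ 2 by ring.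
apply: ler_pM p1 p2; last exact: sqr_ge0.
by apply: mulr_ge0 => //; exact: ler0n.
Qed.

End VectorLift.

(** * Distances to an ideal and uniform boundedness *)

Section Dist.
Variables (R : realType) (V : zmodType) (nrm : V -> R) (nP : vnorm nrm).
Variable S : V -> Prop.
Hypotheses (S0 : S 0) (SD : forall x y, S x -> S y -> S (x + y))
  (SN : forall x, S x -> S (- x)).

Definition dst x : R := inf [set r : R | exists2 s, S s & r = nrm (x - s)]%classic.

Lemma dst_has_inf x : has_inf [set r : R | exists2 s, S s & r = nrm (x - s)]%classic.
Proof.
split; first by exists (nrm (x - 0)), 0.
by exists 0 => _ [s _ ->]; exact: (vn_ge0 nP).
Qed.

Lemma dst_ge0 x : 0 <= dst x.
Proof.
apply: lb_le_inf; first exact: (dst_has_inf x).1.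
by move=> _ [s _ ->]; exact: (vn_ge0 nP).
Qed.

Lemma dst_le x s : S s -> dst x <= nrm (x - s).
Proof. by move=> Ss; apply: ge_inf; [exact: (dst_has_inf x).2 | exists s]. Qed.

Lemma dst_nrm x : dst x <= nrm x.
Proof. by have := dst_le x S0; rewrite subr0. Qed.

Lemma dst_adh x e : 0 < e -> exists2 s, S s & nrm (x - s) < dst x + e.
Proof.
by move=> e0; have [_ [s Ss ->] h] := inf_adherent e0 (dst_has_inf x); exists s.
Qed.

Lemma dst_mod x y : S (x - y) -> dst x = dst y.
Proof.
have h u v : S (u - v) -> dst u <= dst v.
  move=> huv; apply: (@le_eps _ _ _ 1) => e e0.
  have [s Ss hs] := dst_adh v e0.
  have := dst_le u (SD huv Ss).
  rewrite (_ : u - _ = v - s); last by abel.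
  by rewrite mul1r => h; apply: ltW; apply: le_lt_trans hs.
move=> hxy; apply/eqP; rewrite eq_le !h //.
by rewrite -opprB; apply: SN.
Qed.

Lemma dstD x y : dst (x + y) <= dst x + dst y.
Proof.
apply: (@le_eps _ _ _ 2) => e e0.
have [s Ss hs] := dst_adh x e0; have [t St ht] := dst_adh y e0.
have := dst_le (x + y) (SD Ss St); have := vnD nP (x - s) (y - t).
rewrite (_ : x - s + (y - t) = x + y - (s + t)); last by abel.
lra.
Qed.

Lemma dstN x : dst (- x) = dst x.
Proof.
have h u : dst (- u) <= dst u.
  apply: (@le_eps _ _ _ 1) => e e0; have [s Ss hs] := dst_adh u e0.
  have := dst_le (- u) (SN Ss); rewrite (_ : - u - _ = - (u - s)); last by abel.
  by rewrite (vnN nP) mul1r => h; apply: ltW; apply: le_lt_trans hs.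
by apply/eqP; rewrite eq_le h -{1}[x]opprK h.
Qed.

Lemma dst_eq0 x : (forall y, in_closure nrm S y -> S y) -> dst x = 0 -> S x.
Proof.
move=> hS x0; apply: hS => e e0; have [s Ss hs] := dst_adh x e0.
by exists s; split=> //; rewrite x0 add0r in hs.
Qed.

End Dist.

Section UniformBoundedness.
Variables (R : realType) (E : lmodType R[i]) (nrm : E -> R) (nP : vnorm nrm).
Hypothesis nR : forall (r : R) x, nrm (r%:C *: x) = `|r| * nrm x.
Hypothesis nC : complete_for nrm.
Variables (J : Type) (p : J -> E -> R).

Hypothesis pD : forall i x y, p i (x + y) <= p i x + p i y.
Hypothesis pN : forall i x, p i (- x) = p i x.
Hypothesis pR : forall i (r : R) x, 0 <= r -> p i (r%:C *: x) = r * p i x.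
Hypothesis pK : forall i, exists K, forall x, p i x <= K * nrm x.
Hypothesis pB : forall x, exists B, forall i, p i x <= B.

Let Q i : set R := [set K : R | 0 <= K /\ forall x, p i x <= K * nrm x]%classic.
Let pn i : R := inf (Q i).

Let Q_has_inf i : has_inf (Q i).
Proof.
split; last by exists 0 => K [].
have [K hK] := pK i; exists `|K|; split=> // x; apply: le_trans (hK x) _.
by rewrite ler_wpM2r ?ler_norm // (vn_ge0 nP).
Qed.

Let pn_ge0 i : 0 <= pn i.
Proof. by apply: lb_le_inf; [exact: (Q_has_inf i).1 | move=> K []]. Qed.

Let pnP i x : p i x <= pn i * nrm x.
Proof.
apply: (@le_eps _ _ _ (nrm x)) => e e0.
have [K [K0 hK] hlt] := inf_adherent e0 (Q_has_inf i).
have := hK x; have := vn_ge0 nP x; rewrite -/(pn i) in hlt; nra.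
Qed.

(** Later steps of the construction move the point by at most a third of the current step, so the
    factor [2/3] leaves a margin of [1/3]. *)
Let pn_adh i : 0 < pn i -> exists x, nrm x <= 1 /\ 2 / 3 * pn i <= p i x.
Proof.
move=> pi0; have [x hx] : exists x, 2 / 3 * pn i * nrm x < p i x.
  apply/not_existsP => h.
  suff : pn i <= 2 / 3 * pn i by lra.
  apply: ge_inf; first exact: (Q_has_inf i).2.
  by split=> [|x]; [lra | rewrite leNgt; apply/negP; exact: h].
have n0 : 0 < nrm x.
  rewrite lt_def (vn_ge0 nP) andbT; apply/eqP => n0.
  by have := pnP i x; rewrite n0 mulr0; rewrite n0 mulr0 in hx; lra.
exists ((nrm x)^-1%:C *: x).
rewrite nR pR ?invr_ge0 ?(ltW n0) // ger0_norm ?invr_ge0 ?(ltW n0) //.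
rewrite mulVf ?gt_eqF //; split=> //.
by rewrite [leRHS]mulrC ler_pdivlMr // ltW.
Qed.

(** A gliding hump in place of Baire category. If the norms [pn] are unbounded, choose seminorms of
    norm at least [8^n] and walk by steps of length [4^-(n+1)], making the [n]-th one large at the
    [n]-th step; at the limit point it is still at least [2^n / 12]. *)
Lemma uniform_boundedness : exists2 C : R, 0 <= C & forall i x, p i x <= C * nrm x.
Proof.
have [[C hC]|hn] := pselect (exists C, forall i, pn i <= C).
  exists `|C| => // i x; apply: le_trans (pnP i x) _.
  rewrite ler_wpM2r ?(vn_ge0 nP) //; exact: le_trans (hC i) (ler_norm C).
have big n : exists iv : J * E, [/\ 8 ^+ n <= pn iv.1, nrm iv.2 <= 1
    & 2 / 3 * pn iv.1 <= p iv.1 iv.2].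
  have [i hi] : exists i, 8 ^+ n < pn i.
    apply/not_existsP => h; apply: hn; exists (8 ^+ n) => i.
    by rewrite leNgt; apply/negP; exact: h.
  have [x [x1 x2]] := pn_adh (lt_trans (exprn_gt0 n (ltr0n R 8)) hi).
  by exists (i, x); split=> //; exact: ltW.
have [iv hiv] := choice big.
pose c n : R := 4^-1 ^+ n.
have c0 n : 0 < c n by rewrite exprn_gt0 // invr_gt0 ltr0n.
have cS n : c n.+1 = c n / 4 by rewrite /c exprSr.
(* One of [x + w] and [x - w] works, because [p (2 w) <= p (x + w) + p (x - w)]. *)
have step n x : exists y, nrm (y - x) <= c n.+1 /\
    c n.+1 * p (iv n).1 (iv n).2 <= p (iv n).1 y.
  have [_ v1 _] := hiv n; move: v1; set i := (iv n).1; set v := (iv n).2 => v1.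
  set w := (c n.+1)%:C *: v.
  have nw : nrm w <= c n.+1.
    by rewrite nR gtr0_norm // -[leRHS]mulr1 ler_wpM2l // ltW.
  have pw : p i w = c n.+1 * p i v by rewrite pR // ltW.
  have [h|h] := leP (c n.+1 * p i v) (p i (x + w)).
    by exists (x + w); split=> //; rewrite addrC addKr.
  exists (x - w); split; first by rewrite addrC addKr (vnN nP).
  have := pD i (x + w) (- (x - w)); rewrite pN.
  rewrite (_ : x + w - _ = 2%:C *: w); last first.
    by rewrite (_ : 2%:C = 1 + 1) ?rmorphD // scalerDl scale1r; abel.
  rewrite pR ?ler0n // pw; lra.
have [f hf] := choice (fun nx : nat * E => step nx.1 nx.2).
pose x := fix x n := if n is n'.+1 then f (n', x n') else 0.
have xS n : nrm (x n.+1 - x n) <= c n.+1 by have [] := hf (n, x n).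
have xp n : c n.+1 * p (iv n).1 (iv n).2 <= p (iv n).1 (x n.+1) by have [] := hf (n, x n).
have tail n m : (n <= m)%N -> nrm (x m - x n) <= (c n - c m) / 3.
  elim: m => [|m IH]; first by rewrite leqn0 => /eqP ->; rewrite !subrr mul0r (vn0 nP).
  rewrite leq_eqVlt => /orP[/eqP ->|]; first by rewrite !subrr mul0r (vn0 nP).
  rewrite ltnS => /IH h; have := vn_tri nP (x m.+1) (x m) (x n).
  by have := xS m; rewrite cS; lra.
have [l hl] : exists l, converges_to nrm x l.
  apply: nC; apply: (cauchy_le nP (tends0_geo (@ler01 R))) => n m nm.
  apply: le_trans (tail _ _ nm) _; rewrite mul1r.
  have : c n <= 2^-1 ^+ n.
    by apply: lerXn2r; rewrite ?nnegrE ?invr_ge0 ?ler0n // lef_pV2 ?posrE ?ltr0n // ler_nat.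
  by have := c0 m; have := c0 n; lra.
have tl n : nrm (l - x n) <= c n / 3.
  have := cvgtB nP hl (cvgt_cst nP (x n)) => /(cvgt_le nP); apply.
  by exists n => m /tail; have := c0 m; lra.
have [B hB] := pB l.
have low n : 2 ^+ n / 12 <= B.
  have [h1 h2 h3] := hiv n; apply: le_trans (hB (iv n).1).
  have h4 := xp n; have h5 := tl n.+1; have h6 := pnP (iv n).1 (l - x n.+1).
  have h7 := pD (iv n).1 l (- (l - x n.+1)).
  rewrite pN (_ : l - _ = x n.+1) in h7; last by abel.
  move: h1 h3 h4 h5 h6 h7; set P := pn _; set pv := p _ (iv n).2 => h1 h3 h4 h5 h6 h7.
  have h8 : P * nrm (l - x n.+1) <= P * (c n.+1 / 3) by rewrite ler_wpM2l ?pn_ge0.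
  have h9 : c n.+1 * (2 / 3 * P) <= c n.+1 * pv by rewrite ler_wpM2l // ltW.
  have h10 : c n.+1 * 8 ^+ n <= c n.+1 * P by rewrite ler_wpM2l // ltW.
  have e : c n.+1 * 8 ^+ n = 2 ^+ n / 4.
    by rewrite cS /c mulrAC -exprMn (_ : 4^-1 * 8 = 2) //; lra.
  lra.
have B0 : 0 <= 12 * B by have := low 0%N; rewrite expr0; lra.
have := low (Num.truncn (12 * B)).+1.
have : (Num.truncn (12 * B)).+1%:R < 2 ^+ (Num.truncn (12 * B)).+1 :> R.
  by rewrite -natrX ltr_nat ltn_expl.
have := truncnS_gt (12 * B); lra.
Qed.

End UniformBoundedness.

(** * Congruence modulo the ideal and boundedness of [phi] *)

Section Ideal.
Variables (R : realType) (A : lmodType R[i]) (cA : cstar_algebra A).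
Variables (I : A -> Prop) (hI : closed_ideal cA I).
Local Notation "a ** b" := (cmul cA a b) (at level 40, left associativity).
Local Notation nA := (cnorm cA).
Local Notation st := (cstar cA).
Implicit Types (a b : A).

Lemma id0 : I 0. Proof. by case: hI. Qed.
Lemma idD a b : I a -> I b -> I (a + b). Proof. by case: hI => _ h _ _ _; exact: h. Qed.
Lemma idZ (z : R[i]) a : I a -> I (z *: a). Proof. by case: hI => _ _ h _ _; exact: h. Qed.
Lemma idMl a b : I b -> I (a ** b).
Proof. by case: hI => _ _ _ h _ Ib; have [] := h a b Ib. Qed.
Lemma idMr a b : I b -> I (b ** a).
Proof. by case: hI => _ _ _ h _ Ib; have [] := h a b Ib. Qed.
Lemma id_closed a : in_closure nA I a -> I a.
Proof. by case: hI => _ _ _ _; exact. Qed.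
Lemma idN a : I a -> I (- a). Proof. by move=> h; rewrite -scaleN1r; apply: idZ. Qed.
Lemma idB a b : I a -> I b -> I (a - b). Proof. by move=> h /idN; exact: idD. Qed.
Lemma id_limit u a : (forall n, I (u n)) -> converges_to nA u a -> I a.
Proof. by move=> h /(cvgt_closure (cnorm_vnorm cA) h); exact: id_closed. Qed.
Lemma id_trans a b c : I (a - b) -> I (b - c) -> I (a - c).
Proof. by move=> h h'; have := idD h h'; rewrite addrA subrK. Qed.
Lemma id_sym a b : I (a - b) -> I (b - a).
Proof. by rewrite -[b - a]opprB; exact: idN. Qed.

(** Apply [zseq] to the vector [st a] of the module [A]: its inner square [a (st a)] lies in [I], so
    [st a] is a limit of products [(st a) b] with [b] in [I]. *)
Lemma id_star a : I a -> I (st a).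
Proof.
move=> Ia; pose H := selfmod cA; pose X := a ** st a.
have X0 := cnorm_ge0 cA X.
pose l := (nA X + 1)^-1; have lp : 0 < l by rewrite invr_gt0; lra.
have XE : nip H (st a) (st a) = X by rewrite /= cstarK.
have l1 : l * nA (nip H (st a) (st a)) <= 1.
  by rewrite XE /l mulrC ler_pdivrMr; lra.
have IX : I (nip H (st a) (st a)) by rewrite XE; apply: idMr.
apply: id_closed => e e0.
have hp (x : A) : Pos cA (nip H x x) by exact: Pos_stM.
have [n hn] := zseq_small hp (ltW lp) l1 e0 lp.
have [b Ib hb] := zseq_ideal l hI n IX.
exists (st a ** b); split; first exact: idMl.
by move: hn; rewrite hb.
Qed.

Definition dI a := dst nA I a.

Lemma dI_scale (r : R) a : 0 <= r -> dI (r%:C *: a) = r * dI a.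
Proof.
have h (t : R) b : 0 <= t -> dI (t%:C *: b) <= t * dI b.
  move=> t0; apply: (@le_eps _ _ _ t) => e e0.
  have [s Ss hs] := dst_adh (cnorm_vnorm cA) id0 b e0.
  have := dst_le (cnorm_vnorm cA) id0 (t%:C *: b) (idZ t%:C Ss).
  rewrite -scalerBr cnorm_real ger0_norm // => /le_trans; apply.
  by rewrite -mulrDr ler_wpM2l // ltW.
move=> r0; apply/eqP; rewrite eq_le h //=.
have [->|rn] := eqVneq r 0; first by rewrite mul0r; exact: (dst_ge0 (cnorm_vnorm cA) id0).
have rp : 0 < r by rewrite lt_def rn.
rewrite -ler_pdivlMl //; have {1}-> : a = r^-1%:C *: (r%:C *: a).
  by rewrite scalerA -rmorphM mulVf // scale1r.
by apply: h; rewrite invr_ge0.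
Qed.

Variables (E : lmodType R[i]) (H : nmod cA E).
Hypothesis hpos : forall x, Pos cA (nip H x x).
Local Notation ip := (nip H).
Local Notation nE := (nnm H).
Implicit Types (x y z : E).

(* Membership in the closed submodule [E I]. *)
Definition emem x := forall y, I (ip y x).

Lemma emem0 : emem 0. Proof. by move=> y; rewrite nip0r; exact: id0. Qed.
Lemma ememD x y : emem x -> emem y -> emem (x + y).
Proof. by move=> h h' w; rewrite nipDr; apply: idD. Qed.
Lemma ememZ (c : R[i]) x : emem x -> emem (c *: x).
Proof. by move=> h w; rewrite nipZr; apply: idZ. Qed.
Lemma ememN x : emem x -> emem (- x).
Proof. by move=> h; rewrite -scaleN1r; apply: ememZ. Qed.
Lemma emem_op (T : op H) x : emem x -> emem (T x).
Proof. by move=> h w; rewrite oadj'; apply: h. Qed.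
Lemma emem_act x a : I a -> emem (nact H x a).
Proof. by move=> h w; rewrite nip_act; apply: idMl. Qed.
Lemma emem_l x y : emem x -> I (ip x y).
Proof. by move=> h; rewrite nip_sym; apply: id_star; apply: h. Qed.
Lemma emem_closed x : in_closure nE emem x -> emem x.
Proof.
move=> h w; apply: id_closed => e e0.
have w0 : 0 < nE w + 1 by rewrite ltr_wpDl ?nnm_ge0.
have ew : 0 < e / (nE w + 1) by rewrite divr_gt0.
have [y [hy]] := h _ ew; rewrite ltr_pdivlMr // => xy.
exists (ip w y); split; first exact: hy.
rewrite -nipBr; apply: le_lt_trans (nip_cs _ _ _) (le_lt_trans _ xy).
by rewrite mulrC ler_wpM2l ?nnm_ge0 // lerDl.
Qed.
Lemma emem_trans x y z : emem (x - y) -> emem (y - z) -> emem (x - z).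
Proof. by move=> h h'; have := ememD h h'; rewrite addrA subrK. Qed.
Lemma emem_sym x y : emem (x - y) -> emem (y - x).
Proof. by rewrite -[y - x]opprB; exact: ememN. Qed.
(** The norm of the class of [x] in [E / E I]. *)
Definition qd x := dst nE emem x.
Local Notation q := qd.

Lemma qd_ge0 x : 0 <= q x.
Proof. exact: (dst_ge0 (nnm_vnorm H) emem0). Qed.
Lemma qd_nnm x : q x <= nE x.
Proof. exact: (dst_nrm (nnm_vnorm H) emem0). Qed.
Lemma qd_le x s : emem s -> q x <= nE (x - s).
Proof. exact: (dst_le (nnm_vnorm H) emem0). Qed.
Lemma qd_adh x e : 0 < e -> exists2 s, emem s & nE (x - s) < q x + e.
Proof. exact: (dst_adh (nnm_vnorm H) emem0). Qed.
Lemma qd_mod x y : emem (x - y) -> q x = q y.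
Proof. exact: (dst_mod (nnm_vnorm H) emem0 ememD ememN). Qed.
Lemma qdD x y : q (x + y) <= q x + q y.
Proof. exact: (dstD (nnm_vnorm H) emem0 ememD). Qed.
Lemma qd_op (T : op H) (C : R) x : onm T <= C -> q (T x) <= C * q x.
Proof.
move=> TC; apply: (@le_eps _ _ _ C) => e e0.
have [s ss hs] := qd_adh x e0.
have := qd_le (T x) (emem_op T ss); rewrite -ofnB => /le_trans; apply.
apply: le_trans (onm_leP _ TC) _; rewrite -mulrDr ler_wpM2l ?(le_trans (onm_ge0 T) TC) //.
exact: ltW.
Qed.

Lemma qd_scale (r : R) x : q (r%:C *: x) <= `|r| * q x.
Proof. by rewrite -(oscE H); apply: qd_op; exact: onm_osc. Qed.

Lemma dI_nip y z z' : emem (z - z') -> dI (ip y z) = dI (ip y z').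
Proof.
move=> h; apply: (dst_mod (cnorm_vnorm cA) id0 idD idN).
by rewrite -nipBr; exact: h.
Qed.

(** A weak form of [|z + E I|^2 = |<z, z> + I|]. Split [z] at [zseq n] with [2 n l D = 1]: [zseq n]
    has norm at most [sqrt D] by [zseq_bound], and [z - zseq n] is a sum of [n] terms of quotient
    norm at most [l |z| D], together [|z| / 2]. Large [n] ensures [l |<z, z>| <= 1]. *)
Lemma qd_of_dI z (D : R) : 0 < D -> dI (ip z z) < D -> q z <= Num.sqrt D + nE z / 2.
Proof.
move=> D0 hD; set X := ip z z.
have [i Ii hi] : exists2 i, I i & nA (X - i) <= D.
  have e0 : 0 < D - dI X by rewrite subr_gt0.
  have [i Ii hi] := dst_adh (cnorm_vnorm cA) id0 X e0.
  by exists i => //; move: hi; rewrite -/(dI X); lra.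
pose n := (Num.truncn (nA X / (2 * D))).+1.
have nX : nA X <= 2 * n%:R * D.
  have := truncnS_gt (nA X / (2 * D)); rewrite -/n ltr_pdivrMr ?mulr_gt0 //.
  by move/ltW => /le_trans; apply; rewrite mulrA [n%:R * 2]mulrC.
have n0 : 0 < n%:R :> R by rewrite ltr0n.
have nD : 0 < 2 * n%:R * D by rewrite !mulr_gt0.
pose l := (2 * n%:R * D)^-1; have lp : 0 < l by rewrite invr_gt0.
have l1 : l * nA (ip z z) <= 1 by rewrite /l mulrC ler_pdivrMr // mul1r.
have zl := zseq_le hpos (ltW lp) l1.
have zb : nE (zseq H z l n) <= Num.sqrt D.
  rewrite -(ler_pXn2r (n := 2)) ?nnegrE ?nnm_ge0 ?sqrtr_ge0 // sqr_sqrtr ?(ltW D0) //.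
  have := zseq_bound hpos (ltW lp) l1 n; set t := nE _ ^+ 2 => ht.
  have t0 : 0 <= t by exact: sqr_ge0.
  have : 2 * n%:R * l * t <= 1.
    apply: le_trans ht; rewrite ler_wpM2r // ler_wpM2r ?(ltW lp) //.
    by rewrite -natrM ler_nat mul2n leqnSn.
  have -> : 2 * n%:R * l = D^-1.
    by rewrite /l invfM mulrA mulfV ?mul1r // gt_eqF // mulr_gt0.
  by rewrite mulrC ler_pdivrMr // mul1r.
have zd : q (z - zseq H z l n) <= n%:R * (l * (nE z * D)).
  elim: (n : nat) => [|m IH].
    by rewrite mul0r /= subrr; have := qd_nnm 0; rewrite (vn0 (nnm_vnorm H)).
  have -> : z - zseq H z l m.+1 = (z - zseq H z l m) + l%:C *: nact H (zseq H z l m) X.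
    by rewrite /= -/X; abel.
  apply: le_trans (qdD _ _) _; rewrite -natr1 mulrDl mul1r; apply: lerD => //.
  apply: le_trans (qd_scale _ _) _; rewrite gtr0_norm // ler_wpM2l ?(ltW lp) //.
  have := qd_le (nact H (zseq H z l m) X) (emem_act (zseq H z l m) Ii).
  rewrite -nactNr -nactDr => /le_trans; apply; apply: le_trans (nnm_act _ _ _) _.
  by apply: ler_pM => //; [exact: nnm_ge0 | exact: cnorm_ge0].
have e : n%:R * (l * (nE z * D)) = nE z / 2.
  rewrite /l; field; apply/andP; split; [exact: lt0r_neq0 | exact: lt0r_neq0].
rewrite e in zd; have := qdD (z - zseq H z l n) (zseq H z l n); rewrite subrK.
have := qd_nnm (zseq H z l n); lra.
Qed.

(** Testing on [y = z] needs [|z|] comparable with [q z], so [z] is replaced by a nearly shortest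
    representative. Then [qd_of_dI] gives [d <= sqrt (C d) + d / 2] up to [e], that is
    [d <= 4 C]. *)
Lemma qd_of_dual z (C : R) : 0 <= C ->
  (forall y, dI (ip y z) <= C * nE y) -> q z <= 4 * C.
Proof.
move=> C0 h; set d := q z; have d0 : 0 <= d := qd_ge0 z.
have key e : 0 < e -> d <= e \/ (d - e) ^+ 2 <= 4 * (C * (d + e) + e).
  move=> e0; have [s ss hs] := qd_adh z e0; pose z0 := z - s.
  have zz : emem (z0 - z) by rewrite /z0 addrAC subrr add0r; apply: ememN.
  have z0n : nE z0 <= d + e by exact: ltW.
  have D0 : 0 < C * (d + e) + e by rewrite ltr_wpDl // mulr_ge0 // addr_ge0 // ltW.
  have hD : dI (ip z0 z0) < C * (d + e) + e.
    rewrite (dI_nip _ zz); apply: le_lt_trans (h z0) _.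
    apply: le_lt_trans (_ : C * (d + e) < _); first exact: ler_wpM2l.
    by rewrite ltrDl.
  have := qd_of_dI D0 hD; rewrite (qd_mod zz) -/d; move: D0; set D := _ + e => D0.
  have r0 := sqrtr_ge0 D; have r2 := sqr_sqrtr (ltW D0); move: r0 r2.
  set r := Num.sqrt D => r0 r2 hr.
  have hr2 : d - e <= 2 * r by lra.
  have [|de] := leP d e; [by left | right].
  rewrite -r2; have -> : 4 * r ^+ 2 = (2 * r) ^+ 2 by ring.
  by rewrite ler_pXn2r ?nnegrE // ?subr_ge0 ?(ltW de) // mulr_ge0.
have h2 : d ^+ 2 <= 4 * C * d.
  apply: (@le_eps _ _ _ (4 * C + 4 + 2 * d)) => e e0.
  have Cd : 0 <= C * d by rewrite mulr_ge0.
  have Ce : 0 <= C * e by rewrite mulr_ge0 // ltW.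
  have de : 0 <= d * e by rewrite mulr_ge0 // ltW.
  have [k|k] := key e e0.
    have : d ^+ 2 <= d * e by rewrite expr2 ler_wpM2l.
    lra.
  have : (d - e) ^+ 2 = d ^+ 2 - 2 * (d * e) + e ^+ 2 by ring.
  have := sqr_ge0 e; lra.
have [->|dn] := eqVneq d 0; first by rewrite mulr_ge0.
have dp : 0 < d by rewrite lt_def dn.
by rewrite -(ler_pM2r dp) -expr2.
Qed.

Variable phi : E -> E.
Hypothesis hphi : forall x y, I (ip (phi x) y - ip x (phi y)).

(** Symmetry modulo [I] moves [phi] to the other argument, where the inner product is linear;
    homogeneity and additivity below follow in the same way. *)
Lemma phi_mod x y : emem (x - y) -> emem (phi x - phi y).
Proof.
move=> h w; rewrite nipBr.
have h1 := id_sym (hphi w x); have h2 := hphi w y.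
have := idD (idD h1 h2) (h (phi w)); rewrite nipBr.
by rewrite (_ : _ + (_ - _) = ip w (phi x) - ip w (phi y)) //; abel.
Qed.

Lemma phiZ (r : R) x : emem (phi (r%:C *: x) - r%:C *: phi x).
Proof.
move=> w; rewrite nipBr nipZr.
have h1 := id_sym (hphi w (r%:C *: x)); have h2 := idZ r%:C (hphi w x).
have := idD h1 h2; rewrite nipZr scalerBr.
by rewrite (_ : _ + (_ - _) = ip w (phi (r%:C *: x)) - r%:C *: ip w (phi x)) //; abel.
Qed.

Lemma phiD x y : emem (phi (x + y) - (phi x + phi y)).
Proof.
move=> w; rewrite nipBr nipDr.
have h1 := id_sym (hphi w (x + y)).
have := idD h1 (idD (hphi w x) (hphi w y)); rewrite nipDr.
by rewrite (_ : _ + (_ + _) = ip w (phi (x + y)) - (ip w (phi x) + ip w (phi y))) //; abel.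
Qed.

(** The seminorms are the distances of [<x, phi y>] to [I] for [y] in the unit ball. Each is bounded
    by [|phi y|]; at fixed [x] all are bounded by [|phi x|], because [<x, phi y>] and [<phi x, y>]
    agree modulo [I]. [qd_of_dual] turns the uniform bound into one on [q (phi y)]. *)
Lemma phi_bounded : exists2 C : R, 0 < C & forall x, q (phi x) <= C * q x.
Proof.
have vA := cnorm_vnorm cA; have vE := nnm_vnorm H.
pose J := {y : E | nE y <= 1}; pose p (j : J) x := dI (ip x (phi (sval j))).
have [C C0 hC] : exists2 C : R, 0 <= C & forall j x, p j x <= C * nE x.
  apply: (uniform_boundedness vE (nnm_real H) (@ncomplete _ _ _ _ H)).
  - by move=> j x y; rewrite /p nipDl; exact: (dstD vA id0 idD).
  - by move=> j x; rewrite /p nipNl; exact: (dstN vA id0 idN).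
  - by move=> j r x r0; rewrite /p nipRl dI_scale.
  - move=> j; exists (nE (phi (sval j))) => x; rewrite mulrC.
    exact: le_trans (dst_nrm vA id0 _) (nip_cs _ _ _).
  - move=> x; exists (nE (phi x)) => -[y hy]; rewrite /p /=.
    have -> : dI (ip x (phi y)) = dI (ip (phi x) y).
      by apply: (dst_mod vA id0 idD idN); apply: id_sym; exact: hphi.
    apply: le_trans (dst_nrm vA id0 _) (le_trans (nip_cs _ _ _) _).
    by rewrite -[leRHS]mulr1 ler_wpM2l // nnm_ge0.
have b1 y : nE y <= 1 -> q (phi y) <= 4 * C.
  move=> hy; apply: qd_of_dual => // x; exact: (hC (exist _ y hy) x).
have b2 y : q (phi y) <= 4 * C * nE y.
  have [y0|yn] := eqVneq (nE y) 0.
    rewrite y0 mulr0 (nnm_eq0 y0); have := phiZ 0 0; rewrite !scale0r subr0 => h.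
    by have := qd_le (phi 0) h; rewrite subrr (vn0 vE).
  have yp : 0 < nE y by rewrite lt_def yn nnm_ge0.
  have {1}-> : y = (nE y)%:C *: ((nE y)^-1%:C *: y).
    by rewrite scalerA -rmorphM mulfV // scale1r.
  rewrite (qd_mod (phiZ _ _)); apply: le_trans (qd_scale _ _) _.
  rewrite gtr0_norm // mulrC ler_wpM2r ?(ltW yp) //; apply: b1.
  by rewrite nnm_real gtr0_norm ?invr_gt0 // mulVf.
exists (4 * C + 1); first by lra.
(* A nearly shortest representative of [x] replaces [|x|] by [q x]. *)
move=> x; apply: (@le_eps _ _ _ (4 * C + 1)) => e e0.
have [s ss hs] := qd_adh x e0.
have -> : q (phi x) = q (phi (x - s)).
  by apply: qd_mod; apply: phi_mod; rewrite opprB addrC subrK.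
apply: le_trans (b2 _) _; have := nnm_ge0 H (x - s); nra.
Qed.

End Ideal.

(** * Norm-controlled lifting of operators *)

Section NormLift.
Variables (R : realType) (A : lmodType R[i]) (cA : cstar_algebra A).
Variables (I : A -> Prop) (hI : closed_ideal cA I).
Variables (E : lmodType R[i]) (H : nmod cA E).
Hypothesis hpos : forall x, Pos cA (nip H x x).
Local Notation nA := (cnorm cA).
Local Notation ip := (nip H).
Local Notation nE := (nnm H).
Local Notation q := (qd I H).
Local Notation leA := (leA cA).
Local Notation emem := (emem I H).
Implicit Types (x y : E) (T : op H).

Definition qbound T (C : R) :=
  (forall x, q (T x) <= C * q x) /\ (forall x, q (ost T x) <= C * q x).

Lemma onm_osc_ge0 (r : R) T : 0 <= r -> onm (osc H r * T) <= r * onm T.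
Proof. exact: (@unm_scale_ge0 _ _ (op_cstar H)). Qed.

Lemma onm_st T : onm (ost T) = onm T.
Proof. exact: (unm_st (op_cstar H)). Qed.

(** Put [k = l (ost T) T] and [u = T s^n]. By [sXk_bound], [(2n + 1) l <u x, u x> <= <x, x>], so
    [2 n l C^2 = 1] gives [|u| <= C]. In the quotient [k] has norm at most [l C^2], and [T - u] is
    the sum of [T k s^m] over [m < n], of norm at most [n l C^3 = C / 2]. Large [n] makes [k] a
    contraction. *)
Lemma lift_step T (C : R) : 0 < C -> qbound T C ->
  exists u, onm u <= C /\ qbound (T - u) (C / 2).
Proof.
move=> C0 [hT hTs]; have C20 : 0 < C ^+ 2 by rewrite exprn_gt0.
pose n := (Num.truncn (onm T ^+ 2 / (2 * C ^+ 2))).+1.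
have n0 : 0 < n%:R :> R by rewrite ltr0n.
have nD : 0 < 2 * n%:R * C ^+ 2 by rewrite !mulr_gt0.
pose l := (2 * n%:R * C ^+ 2)^-1; have lp : 0 < l by rewrite invr_gt0.
have l1 : l * onm T ^+ 2 <= 1.
  rewrite /l mulrC ler_pdivrMr // mul1r.
  have := truncnS_gt (onm T ^+ 2 / (2 * C ^+ 2)); rewrite -/n ltr_pdivrMr ?mulr_gt0 //.
  by move/ltW => /le_trans; apply; rewrite mulrA [n%:R * 2]mulrC.
pose X := ost T * T; pose k := osc H l * X.
have sk : ost k = k by rewrite ostM ost_osc ostM ostK [RHS]oscaleC.
have kn : onm k <= 1.
  apply: le_trans (onm_osc_ge0 _ (ltW lp)) (le_trans _ l1).
  rewrite ler_wpM2l ?(ltW lp) //; apply: le_trans (onmM _ _) _.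
  by rewrite onm_st expr2.
have k0 : opos k by apply: opos_osc; [exact: ltW | exact: opos_stM].
have k1 : opos (1 - k) by apply: opos_1B.
pose s := 1 - k; pose u := T * s ^+ n.
have qs m x : q ((s ^+ m) x) <= q x.
  rewrite -[leRHS]mul1r; apply: (qd_op hI); exact: (onm_sX hpos sk k0 k1).
have qk x : q (k x) <= l * C ^+ 2 * q x.
  rewrite /k opM oscE; apply: le_trans (qd_scale hI _ _ _) _.
  rewrite gtr0_norm // -mulrA ler_wpM2l ?(ltW lp) // opM.
  apply: le_trans (hTs _) _; rewrite expr2 -mulrA ler_wpM2l ?(ltW C0) //; exact: hT.
have lC : n%:R * (C * (l * C ^+ 2)) = C / 2.
  by rewrite /l; field; rewrite !lt0r_neq0.
have lC0 : 0 <= l * C ^+ 2 by rewrite mulr_ge0 ?ltW.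
exists u; split; last split.
- apply: (onm_leA hpos); first exact: ltW.
  move=> x; rewrite /u opM ost_adj -opM -/X.
  have := sXk_bound hpos sk k1 n x; rewrite -/s; set z := (s ^+ n) x => h.
  have px : Pos cA (ip z (X z)) by rewrite /X opM -ost_adj; exact: hpos.
  have := leAR (ltW C20) h; rewrite /k opM oscE nipZr !scalerA -!rmorphM => h2.
  apply: leA_trans h2; rewrite -[X in leA X _]scale1r -[X in leA (X *: _) _]/(1%:C).
  apply: leA_scale => //.
  have -> : C ^+ 2 * (n.*2.+1)%:R * l = (n.*2.+1)%:R / (2 * n%:R).
    by rewrite /l; field; rewrite !lt0r_neq0.
  by rewrite ler_pdivlMr ?mulr_gt0 // mul1r -natrM ler_nat mul2n.
- have key m x : q ((T * (1 - s ^+ m)) x) <= m%:R * (C * (l * C ^+ 2)) * q x.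
    elim: m => [|m IH].
      rewrite expr0 subrr mulr0 op0 !mul0r.
      by have := qd_nnm hI H 0; rewrite (vn0 (nnm_vnorm H)).
    have -> : T * (1 - s ^+ m.+1) = T * (1 - s ^+ m) + T * (k * s ^+ m).
      by rewrite exprS /s; ncring.
    rewrite opD; apply: le_trans (qdD hI _ _ _) _.
    have -> : m.+1%:R * (C * (l * C ^+ 2)) * q x =
        m%:R * (C * (l * C ^+ 2)) * q x + C * (l * C ^+ 2) * q x by rewrite -natr1; ring.
    apply: lerD => //; rewrite !opM.
    apply: le_trans (hT _) _; rewrite -mulrA ler_wpM2l ?(ltW C0) //.
    by apply: le_trans (qk _) _; rewrite ler_wpM2l.
  move=> x; have -> : T - u = T * (1 - s ^+ n) by rewrite /u; ncring.
  by rewrite -lC; apply: key.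
- have key m x : q (((1 - s ^+ m) * ost T) x) <= m%:R * (C * (l * C ^+ 2)) * q x.
    elim: m => [|m IH].
      rewrite expr0 subrr mul0r op0 !mul0r.
      by have := qd_nnm hI H 0; rewrite (vn0 (nnm_vnorm H)).
    have -> : (1 - s ^+ m.+1) * ost T = (1 - s ^+ m) * ost T + s ^+ m * k * ost T.
      by rewrite exprSr {3}/s; ncring.
    rewrite opD; apply: le_trans (qdD hI _ _ _) _.
    have -> : m.+1%:R * (C * (l * C ^+ 2)) * q x =
        m%:R * (C * (l * C ^+ 2)) * q x + C * (l * C ^+ 2) * q x by rewrite -natr1; ring.
    apply: lerD => //; rewrite !opM.
    apply: le_trans (qs _ _) _; apply: le_trans (qk _) _.
    by rewrite [C * _]mulrC -[leRHS]mulrA ler_wpM2l.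
  move=> x; have -> : ost (T - u) = (1 - s ^+ n) * ost T.
    by rewrite ostB /u ostM (ost_sX sk); ncring.
  by rewrite -lC; apply: key.
Qed.

Lemma norm_lift T (C : R) : 0 < C -> qbound T C ->
  exists u : op H, onm u <= 2 * C /\ forall x, emem (T x - u x).
Proof.
move=> C0 hT.
have step (n : nat) (S : op H) : exists u : op H, qbound S (C * 2^-1 ^+ n) ->
    onm u <= C * 2^-1 ^+ n /\ qbound (S - u) (C * 2^-1 ^+ n.+1).
  (* The default [0] makes the statement total, so that [choice] yields a function on all pairs. *)
  have [h|h] := pselect (qbound S (C * 2^-1 ^+ n)); last by exists 0.
  have [|u hu] := lift_step _ h; first by rewrite mulr_gt0 // geo_gt0.
  by exists u => _; rewrite exprSr mulrA.
have [F hF] := choice (fun nS : nat * op H => step nS.1 nS.2).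
pose Tn := fix Tn n := if n is n'.+1 then Tn n' - F (n', Tn n') else T.
have hTn n : qbound (Tn n) (C * 2^-1 ^+ n).
  by elim: n => [|n IH]; [rewrite expr0 mulr1 | have [] := hF (n, Tn n) IH].
pose u n := F (n, Tn n).
have hu n : onm (u n) <= C * 2^-1 ^+ n by have [] := hF (n, Tn n) (hTn n).
have [U hU UC] := geo_series (onm_vnorm H) (@onm_complete _ _ _ _ H) hu.
exists U; split=> // x.
have sumE n : \sum_(i < n) u i = T - Tn n.
  elim: n => [|n IH]; first by rewrite big_ord0 subrr.
  by rewrite big_ord_recr /= IH -/(u n); abel.
apply: (dst_eq0 (nnm_vnorm H) (emem0 hI H) (emem_closed hI (H := H))).
rewrite -/(q _); apply/eqP; rewrite eq_le qd_ge0 // andbT.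
apply: (@le_eps _ _ _ (C * q x + nE x)) => e e0; rewrite add0r.
have [N hN] := hU e e0; have [N' hN'] := tends0_geo (@ler01 R) e0.
have := hN _ (leq_maxl N N'); have := hN' _ (leq_maxr N N').
set n := maxn N N'; rewrite mul1r sumE => h1 h2.
have -> : T x - U x = Tn n x + (T - Tn n - U) x by rewrite !opB; abel.
apply: le_trans (qdD hI _ _ _) _; rewrite mulrDl; apply: lerD.
  apply: le_trans ((hTn n).1 x) _; rewrite mulrAC ler_wpM2l ?mulr_ge0 ?qd_ge0 ?(ltW C0) //.
  exact: ltW.
apply: le_trans (qd_nnm hI _ _) _; apply: le_trans (onmP _ _) _.
by rewrite mulrC ler_wpM2l ?nnm_ge0 // ltW.
Qed.

(** Weighted Cauchy-Schwarz in [A]: with [z_j = u_j Q_j x], [2 <V, V> <= b sum <z_j, z_j> + b^-1 sum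
    <P_j V, P_j V>], and the last term is at most [<V, V>]. The bound has no factor counting the
    summands. *)
Lemma strict_sum (P Q u : nat -> op H) (C b : R) :
  0 <= C -> 0 < b -> (forall j, onm (u j) <= C) -> (forall j, ost (P j) = P j) ->
  (forall v n m, leA (\sum_(n <= j < m) ip (P j v) (P j v)) (b%:C *: ip v v)) ->
  forall x n m,
  let V := \sum_(n <= j < m) (P j * u j * Q j) x in
  leA (ip V V) ((b * C ^+ 2)%:C *: \sum_(n <= j < m) ip (Q j x) (Q j x)).
Proof.
move=> C0 b0 hu sP hP x n m V.
pose y j := P j V; pose z j := u j (Q j x).
have VV1 : ip V V = \sum_(n <= j < m) ip (y j) (z j).
  rewrite {2}/V nip_sumr; apply: eq_bigr => j _.
  by rewrite !opM ost_adj' sP.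
have VV2 : ip V V = \sum_(n <= j < m) ip (z j) (y j).
  rewrite {1}/V nip_suml; apply: eq_bigr => j _.
  by rewrite !opM ost_adj sP.
have bi : 0 <= b^-1 by rewrite invr_ge0 ltW.
have h1 j : leA (ip (y j) (z j) + ip (z j) (y j))
    (b%:C *: ip (z j) (z j) + b^-1%:C *: ip (y j) (y j)).
  have := PosR (ltW b0) (hpos (z j - b^-1%:C *: y j)).
  have b1 : b * b^-1 = 1 by rewrite mulfV // gt_eqF.
  set w := ip (z j - _) _.
  have wE : b%:C *: w = b%:C *: ip (z j) (z j) + b^-1%:C *: ip (y j) (y j) -
      (ip (y j) (z j) + ip (z j) (y j)).
    rewrite /w nipBr !nipBl !nipRl !nipZr !scalerBr !scalerA -!rmorphM.
    by rewrite ?mulrA b1 mul1r !scale1r; abel.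
  by rewrite wE => h; exact: h.
have h2 := leA_sum (index_iota n m) h1; rewrite !big_split /= -VV1 -VV2 in h2.
rewrite -!scaler_sumr in h2.
have h3 := leAR bi (hP V n m); rewrite scalerA -rmorphM mulVf ?gt_eqF // scale1r in h3.
have h4 := leA_trans h2 (leAD (leA_refl _ _) h3).
have h5 : leA (ip V V) (b%:C *: \sum_(n <= j < m) ip (z j) (z j)).
  move: h4; rewrite /leA; set S1 := _ *: _; set S2 := ip V V.
  by rewrite (_ : S1 + S2 - (S2 + S2) = S1 - S2) //; abel.
apply: leA_trans h5 _; rewrite rmorphM -scalerA; apply: leAR; first exact: ltW.
rewrite scaler_sumr; apply: leA_sum => j; exact: (op_leA hpos).
Qed.

End NormLift.

(** * The lifting theorem for one module *)

Section Core.
Variables (R : realType) (A : lmodType R[i]) (cA : cstar_algebra A).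
Variables (I : A -> Prop) (hI : closed_ideal cA I).
Variables (E : lmodType R[i]) (H : nmod cA E).
Hypothesis hpos : forall x, Pos cA (nip H x x).
Variable phi : E -> E.
Hypothesis hphi : forall x y, I (nip H (phi x) y - nip H x (phi y)).
Local Notation nA := (cnorm cA).
Local Notation ip := (nip H).
Local Notation nE := (nnm H).
Local Notation q := (qd I H).
Local Notation leA := (leA cA).
Local Notation emem := (emem I H).
Implicit Types (x y : E) (T : op H).

Definition eqm x y := emem (x - y).

Lemma eqm_refl x : eqm x x.
Proof. by rewrite /eqm subrr; exact: emem0. Qed.
Lemma eqm_sym x y : eqm x y -> eqm y x.
Proof. exact: emem_sym. Qed.
Lemma eqm_trans y x z : eqm x y -> eqm y z -> eqm x z.
Proof. exact: emem_trans. Qed.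
Lemma eqmD x x' y y' : eqm x x' -> eqm y y' -> eqm (x + y) (x' + y').
Proof.
move=> h h'; have := ememD hI h h'; rewrite /eqm.
by rewrite (_ : x - x' + (y - y') = x + y - (x' + y')) //; abel.
Qed.
Lemma eqmN x x' : eqm x x' -> eqm (- x) (- x').
Proof.
move=> h; have := ememN hI h; rewrite /eqm.
by rewrite (_ : - (x - x') = - x - - x') //; abel.
Qed.
Lemma eqmB x x' y y' : eqm x x' -> eqm y y' -> eqm (x - y) (x' - y').
Proof. by move=> h /eqmN; exact: eqmD. Qed.
Lemma eqm_op T x y : eqm x y -> eqm (T x) (T y).
Proof. by move=> h; rewrite /eqm -ofnB; exact: emem_op. Qed.
Lemma eqm_phiD x y : eqm (phi (x + y)) (phi x + phi y).
Proof. exact: (phiD hI hphi). Qed.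
Lemma eqm_phiB x y : eqm (phi (x - y)) (phi x - phi y).
Proof.
have := eqmB (eqm_sym (eqm_phiD (x - y) y)) (eqm_refl (phi y)).
rewrite subrK; apply: eqm_trans.
by rewrite (_ : phi (x - y) + phi y - phi y = phi (x - y)); [exact: eqm_refl | abel].
Qed.

Lemma onm_mul3 (S T U : op H) (a b c : R) : onm S <= a -> onm T <= b -> onm U <= c ->
  onm (S * T * U) <= a * b * c.
Proof.
move=> ha hb hc; apply: le_trans (onmM _ _) _; apply: ler_pM; rewrite ?onm_ge0 //.
by apply: le_trans (onmM _ _) _; apply: ler_pM; rewrite ?onm_ge0.
Qed.

Variables k t : op H.
Local Notation s := (1 - k).
Hypotheses (sk : ost k = k) (k0 : opos k) (k1 : opos s).
Hypothesis sX_0 : forall x, tends0 (fun n => nE ((s ^+ n) x)).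
Hypothesis sXt_0 : tends0 (fun n => onm (s ^+ n * t)).
Hypothesis tsX_0 : tends0 (fun n => onm (t * s ^+ n)).
Hypothesis tE : forall x, eqm (t x) (phi (k x)).

(** A geometric sum in the role of [k^-1 (1 - s^m)]: since [k cs m = 1 - s^m], [t cs m] lifts
    [phi (1 - s^m)], at the price of a norm of order [m]. *)
Let cs m : op H := \sum_(i < m) s ^+ i.

Let kcs m : k * cs m = 1 - s ^+ m.
Proof.
rewrite /cs; elim: m => [|m IH]; first by rewrite big_ord0 mulr0 subrr.
by rewrite big_ord_recr /= mulrDr IH exprS; ncring.
Qed.

Let onm_cs m : onm (cs m) <= m%:R.
Proof.
rewrite /cs; elim: m => [|m IH]; first by rewrite big_ord0 (vn0 (onm_vnorm H)).
rewrite big_ord_recr -natr1; apply: le_trans (onmD _ _) _.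
by apply: lerD => //; exact: onm_sX.
Qed.

Let cs_comm m n : cs m * s ^+ n = s ^+ n * cs m.
Proof.
rewrite /cs mulr_suml mulr_sumr; apply: eq_bigr => i _.
by rewrite -!exprD addnC.
Qed.

Let tcs m x : eqm ((t * cs m) x) (phi ((1 - s ^+ m) x)).
Proof. by rewrite -kcs !opM; exact: tE. Qed.

Let a n : op H := s ^+ n.*2.

Let onm_a n : onm (a n) <= 1.
Proof. exact: onm_sX. Qed.

Let sa n : ost (a n) = a n.
Proof. exact: ost_sX. Qed.

Let ost_tcs m x : eqm (ost (t * cs m) x) ((1 - s ^+ m) (phi x)).
Proof.
move=> y; rewrite nipBr -ost_adj ost_adj' ostB ost1 (ost_sX sk).
have h1 : I (ip ((t * cs m) y) x - ip (phi ((1 - s ^+ m) y)) x).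
  by rewrite -nipBl; apply: (emem_l hI); exact: tcs.
exact: (id_trans hI h1 (hphi _ _)).
Qed.

(** Modulo [E I], [t cs n.*2] is [phi (1 - a n)], bounded by [2 C] whatever [n] is, and so is its
    adjoint; [norm_lift] doubles this constant. *)
Lemma lift_seq : exists2 C : R, 0 < C & exists u : nat -> op H,
  forall n, onm (u n) <= C /\ forall x, eqm ((t * cs n.*2) x) (u n x).
Proof.
have [C C0 hC] := phi_bounded hI hpos hphi.
have C2 : 0 < 2 * C by rewrite mulr_gt0.
exists (2 * (2 * C)); first by rewrite mulr_gt0.
have n1 n : onm (1 - a n) <= 2.
  have := vnB (onm_vnorm H) 1 (a n); have := onm_a n.
  by have := onm_sX hpos sk k0 k1 0; rewrite expr0; lra.
suff h n : exists u : op H, onm u <= 2 * (2 * C) /\ forall x, eqm ((t * cs n.*2) x) (u x).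
  by have [u hu] := choice h; exists u.
apply: (norm_lift hI hpos C2); split=> x.
  rewrite (qd_mod hI (tcs _ x)); apply: le_trans (hC _) _.
  rewrite [2 * C]mulrC -mulrA ler_wpM2l ?(ltW C0) //; exact: (qd_op hI _ (n1 n)).
rewrite (qd_mod hI (ost_tcs _ x)); apply: le_trans (qd_op hI _ (n1 n)) _.
by rewrite -mulrA ler_wpM2l.
Qed.

Let opos_d n m : (n <= m)%N -> opos (a n - a m).
Proof. exact: opos_sX_decr. Qed.

Let opos_a n : opos (a n).
Proof. exact: opos_sX. Qed.

Let sd n m : ost (a n - a m) = a n - a m.
Proof. by rewrite ostB !sa. Qed.

Let d_sqr n m x : (n <= m)%N ->
  leA (ip ((a n - a m) x) ((a n - a m) x)) (ip x ((a n - a m) x)).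
Proof.
move=> nm; rewrite ost_adj sd -opM; apply: opos_leA.
apply: (opos_sub_sqr (sd n m) (opos_d nm)).
rewrite (_ : _ - _ = (1 - a n) + a m); last by abel.
by apply: (oposD _ (opos_a m)); exact: (@opos_d 0%N n).
Qed.

Let a_leA n x : ip x (a n x) = ip ((s ^+ n) x) ((s ^+ n) x).
Proof. by rewrite /a -addnn exprD opM ost_adj' (ost_sX sk). Qed.

Let a_mono n m x : (n <= m)%N -> leA (ip x (a m x)) (ip x (a n x)).
Proof. by move=> nm; apply: opos_leA; apply: opos_d. Qed.

Let a_le1 n x : leA (ip x (a n x)) (ip x x).
Proof. by have := @a_mono 0 n x (leq0n n); rewrite {2}/a expr0 op1. Qed.

Section Sequences.
Variable nu : nat -> nat.
Hypotheses (nu0 : nu 0 = 0%N) (nuS : forall j, (nu j < nu j.+1)%N).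

Let nu_le i j : (i <= j)%N -> (nu i <= nu j)%N.
Proof.
elim: j => [|j IH]; first by rewrite leqn0 => /eqP ->.
rewrite leq_eqVlt => /orP[/eqP -> //|]; rewrite ltnS => /IH h.
exact: leq_trans h (ltnW (nuS j)).
Qed.

Let nu_ge j : (j <= nu j)%N.
Proof. by elim: j => // j IH; exact: leq_ltn_trans IH (nuS j). Qed.

Definition dw j := a (nu j) - a (nu j.+1).
(** This is [dw j] with its neighbours added. At [j = 0] the predecessor is [0], where
    [a (nu 0) = 1], so nothing is missing on the left. *)
Definition ww j := a (nu j.-1) - a (nu j.+2).

Let dw_sum x n m : (n <= m)%N ->
  leA (\sum_(n <= j < m) ip (dw j x) (dw j x)) (ip x (a (nu n) x)).
Proof.
move=> nm; apply: (@leA_trans _ _ _ (\sum_(n <= j < m) ip x (dw j x))).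
  by apply: leA_sum => j; apply: d_sqr; exact: ltnW.
have -> : \sum_(n <= j < m) ip x (dw j x) = ip x (a (nu n) x) - ip x (a (nu m) x).
  elim: m nm => [|m IH]; first by rewrite leqn0 => /eqP ->; rewrite big_geq // subrr.
  rewrite leq_eqVlt => /orP[/eqP ->|nm]; first by rewrite big_geq // subrr.
  by rewrite big_nat_recr //= IH // /dw opB nipBr; abel.
by rewrite /leA opprB addrC subrK; exact: opos_a.
Qed.

(** Three windows overlap, so the sum telescopes to three terms, each at most [b n.-1]; the constant
    is raised to [4], a perfect square, to give the bound [2 C] below. *)
Let ww_sum x n m : (n <= m)%N ->
  leA (\sum_(n <= j < m) ip (ww j x) (ww j x)) (4%:C *: ip x (a (nu n.-1) x)).
Proof.
move=> nm; apply: (@leA_trans _ _ _ (\sum_(n <= j < m) ip x (ww j x))).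
  apply: leA_sum => j; apply: d_sqr; apply: nu_le.
  by apply: leq_trans (leq_pred _) _; apply: leq_trans (leqnSn j) (leqnSn _).
pose b j := ip x (a (nu j) x); pose B j := b j.-1 + b j + b j.+1.
have b0 j : Pos cA (b j) by exact: opos_a.
have -> : \sum_(n <= j < m) ip x (ww j x) = B n - B m.
  elim: m nm => [|m IH]; first by rewrite leqn0 => /eqP ->; rewrite big_geq // subrr.
  rewrite leq_eqVlt => /orP[/eqP ->|nm]; first by rewrite big_geq // subrr.
  by rewrite big_nat_recr //= IH // /ww opB nipBr /B /=; rewrite -!/(b _); abel.
apply: (@leA_trans _ _ _ (B n)).
  by rewrite /leA opprB addrC subrK; apply: PosD => //; apply: PosD.
have -> : 4%:C *: ip x (a (nu n.-1) x) = b n.-1 + b n.-1 + b n.-1 + b n.-1.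
  have -> : 4%:C = 1 + 1 + 1 + 1 :> R[i] by rewrite (_ : 4 = 1 + 1 + 1 + 1) ?rmorphD //; ring.
  by rewrite !scalerDl !scale1r.
have mono i : (n.-1 <= i)%N -> leA (b i) (b n.-1) by move=> h; apply: a_mono; apply: nu_le.
apply: (@leA_trans _ _ _ (b n.-1 + b n.-1 + b n.-1)).
  by apply: leAD; [apply: leAD|]; apply: mono; rewrite ?leq_pred // (leq_trans (leq_pred n)).
by rewrite /leA addrC addKr.
Qed.

Variables (u : nat -> op H) (C : R).
Hypotheses (C0 : 0 <= C) (hu : forall j, onm (u j) <= C).

Let small_nu x (f : nat -> nat) : (forall n, (n <= (f n).+1)%N) ->
  tends0 (fun n => 2 * C * nE ((s ^+ nu (f n)) x)).
Proof.
move=> hf; apply: tends0M; last by move=> n; exact: nnm_ge0.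
move=> e /(sX_0 x)[N hN]; exists N.+1 => n Nn; apply: hN.
apply: leq_trans (nu_ge _); rewrite -ltnS; exact: leq_trans Nn (hf n).
Qed.

(** [strict_sum] with [ww] outside and [dw] inside bounds a block starting at [n] by
    [2 C |s^(nu n) x|]. *)
Lemma strict_cauchy x : cauchy_seq nE (fun n => \sum_(0 <= j < n) (ww j * u j * dw j) x).
Proof.
apply: (cauchy_le (nnm_vnorm H) (@small_nu x id (fun n => leqnSn n))) => n m nm.
rewrite (big_cat_nat (n := n)) //= addrAC subrr add0r.
have hP v i j : leA (\sum_(i <= l < j) ip (ww l v) (ww l v)) (4%:C *: ip v v).
  have [ij|ji] := leqP i j; last first.
    rewrite big_geq; last exact: ltnW.
    by rewrite /leA subr0; apply: PosR.
  apply: leA_trans (ww_sum v ij) _; apply: leAR => //; exact: a_le1.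
have b0 : 0 < 4 :> R by rewrite ltr0n.
have := strict_sum hpos dw C0 b0 hu (fun j => sd _ _) hP x n m.
set V := \sum_(_ <= _ < _) _ => h.
apply: (leA_nnm hpos); first by rewrite mulr_ge0.
apply: leA_trans h _; have -> : (2 * C) ^+ 2 = 4 * C ^+ 2 by ring.
apply: leAR; first by rewrite mulr_ge0 ?sqr_ge0.
by rewrite -a_leA; exact: dw_sum.
Qed.

(** The windows trade places: the constant [1] comes from [dw] outside and the [4] from [ww] inside.
    As [ww n] reaches back to [nu n.-1], the bound is [2 C |s^(nu n.-1) x|]. *)
Lemma strict_cauchy_adj x :
  cauchy_seq nE (fun n => \sum_(0 <= j < n) (dw j * ost (u j) * ww j) x).
Proof.
apply: (cauchy_le (nnm_vnorm H) (@small_nu x predn (fun n => leqSpred n))) => n m nm.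
rewrite (big_cat_nat (n := n)) //= addrAC subrr add0r.
have hP v i j : leA (\sum_(i <= l < j) ip (dw l v) (dw l v)) (1%:C *: ip v v).
  rewrite scale1r; have [ij|ji] := leqP i j; last first.
    by rewrite big_geq ?(ltnW ji) // /leA subr0.
  by apply: leA_trans (dw_sum v ij) _; exact: a_le1.
have hus j : onm (ost (u j)) <= C by rewrite onm_st.
have := strict_sum hpos ww C0 (@ltr01 R) hus (fun j => sd _ _) hP x n m.
set V := \sum_(_ <= _ < _) _ => h.
apply: (leA_nnm hpos); first by rewrite mulr_ge0.
apply: leA_trans h _; rewrite mul1r.
have cE v : ((2 * C) ^+ 2)%:C *: v = (C ^+ 2)%:C *: (4%:C *: v) :> A.
  by rewrite scalerA -rmorphM; congr (_%:C *: _); ring.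
rewrite cE; apply: leAR; first exact: sqr_ge0.
by rewrite -a_leA; exact: ww_sum.
Qed.

End Sequences.

Lemma onm_ww nu j : onm (ww nu j) <= 2.
Proof.
have := vnB (onm_vnorm H) (a (nu j.-1)) (a (nu j.+2)).
by have := onm_a (nu j.-1); have := onm_a (nu j.+2); rewrite -/(ww nu j); lra.
Qed.

(** The sums [cs (nu j).*2] have norm of order [nu j]; [nu j.+1] is placed where [a m * t] is small
    enough to absorb that growth. *)
Lemma nu_exists : exists nu : nat -> nat, [/\ nu 0%N = 0%N,
  forall j, (nu j < nu j.+1)%N &
  forall j m, (nu j.+1 <= m)%N -> onm (a m * t) * (4 * (nu j)%:R) <= 2^-1 ^+ j].
Proof.
have step (jn : nat * nat) : exists n', (jn.2 < n')%N /\
    forall m, (n' <= m)%N -> onm (a m * t) * (4 * jn.2%:R) <= 2^-1 ^+ jn.1.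
  case: jn => j n /=.
  have h := tends0M (4 * n%:R) sXt_0 (fun m => onm_ge0 _).
  have [N hN] := h _ (geo_gt0 R j).
  exists (maxn N n.+1); split; first exact: leq_maxr.
  move=> m; rewrite geq_max => /andP[Nm _]; rewrite mulrC; apply: ltW.
  by apply: hN; apply: leq_trans Nm _; rewrite -addnn leq_addr.
have [f hf] := choice step.
pose nu := fix nu j := if j is j'.+1 then f (j', nu j') else 0%N.
by exists nu; split=> // j; have [] := hf (j, nu j).
Qed.

Lemma core : exists Phi Psi : E -> E,
  (forall x y, ip (Phi x) y = ip x (Psi y)) /\ forall x, eqm (Phi x) (phi x).
Proof.
have [C C0 [u0 hu0]] := lift_seq.
have [nu [nu0 nuS hnu]] := nu_exists.
(* [u0 (N j)] lifts [phi (1 - a (N j))] rather than [phi], and [N j] is so far out that the defect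
   [r3] is small. The [8] is the bound [2] of [ww] times the [4] in the bound of [D j]. *)
have [N hN] : exists N : nat -> nat, forall j,
    onm (t * a (N j)) * (8 * (nu j.+1)%:R) <= 2^-1 ^+ j.
  suff h j : exists n, onm (t * a n) * (8 * (nu j.+1)%:R) <= 2^-1 ^+ j.
    by have [N hN] := choice h; exists N.
  have h := tends0M (8 * (nu j.+1)%:R) tsX_0 (fun m => onm_ge0 _).
  have [M hM] := h _ (geo_gt0 R j); exists M; rewrite mulrC; apply: ltW; apply: hM.
  by rewrite -addnn leq_addr.
pose u j := u0 (N j).
have hu j : onm (u j) <= C by have [] := hu0 (N j).
pose d := dw nu; pose w := ww nu.
pose D j := cs (nu j.+1).*2 - cs (nu j).*2.
have onm_cs2 n : onm (cs n.*2) <= 2 * n%:R by rewrite -natrM mul2n.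
have nuR j : (nu j)%:R <= (nu j.+1)%:R :> R by rewrite ler_nat ltnW.
have nu0R j : 0 <= (nu j)%:R :> R by exact: ler0n.
have onm_D j : onm (D j) <= 4 * (nu j.+1)%:R.
  have := vnB (onm_vnorm H) (cs (nu j.+1).*2) (cs (nu j).*2).
  by have := onm_cs2 (nu j.+1); have := onm_cs2 (nu j); have := nuR j; rewrite -/(D j); lra.
(* Since [1 - w_j = a (nu j.+2) + (1 - a (nu j.-1))], [r1] and [ost r2] lift the two parts of
   [(1 - w_j) phi d_j], and [r3] restores [w_j phi d_j a (N j)]. The adjoint enters because
   [ost (t cs m)] is the lift with [1 - s^m] on the left of [phi]. *)
pose r1 j := a (nu j.+2) * t * D j.
pose r2 j := d j * t * cs (nu j.-1).*2.
pose r3 j := w j * (t * a (N j)) * D j.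
pose r j := r1 j + ost (r2 j) + r3 j.
have g0 j := geo_gt0 R j.
have hr j : onm (r j) <= 4 * 2^-1 ^+ j.
  have b1 : onm (r1 j) <= 2^-1 ^+ j.
    apply: le_trans (onmM _ _) _.
    have := hnu j.+1 (nu j.+2) (leqnn _); rewrite exprS.
    have : onm (a (nu j.+2) * t) * onm (D j) <= onm (a (nu j.+2) * t) * (4 * (nu j.+1)%:R).
      by apply: ler_wpM2l; [exact: onm_ge0 | exact: onm_D].
    by have := g0 j; lra.
  have b2 : onm (r2 j) <= 2 * 2^-1 ^+ j.
    case: j {b1} => [|j].
      rewrite /r2 /= nu0 /cs big_ord0 mulr0 (vn0 (onm_vnorm H)).
      by have := g0 0%N; lra.
    rewrite /r2 /=; apply: le_trans (onmM _ _) _.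
    have h1 := hnu j (nu j.+1) (leqnn _).
    have h2 := hnu j (nu j.+2) (ltnW (nuS _)).
    have h3 : onm (d j.+1 * t) <= onm (a (nu j.+1) * t) + onm (a (nu j.+2) * t).
      by rewrite /d /dw mulrBl; exact: (vnB (onm_vnorm H)).
    have h4 : onm (d j.+1 * t) * onm (cs (nu j).*2) <=
        (onm (a (nu j.+1) * t) + onm (a (nu j.+2) * t)) * (2 * (nu j)%:R).
      by apply: ler_pM; rewrite ?onm_ge0.
    by apply: le_trans h4 _; rewrite exprS; lra.
  have b3 : onm (r3 j) <= 2^-1 ^+ j.
    apply: le_trans (onm_mul3 (onm_ww nu j) (lexx _) (onm_D j)) _.
    by have := hN j; lra.
  have := vnD (onm_vnorm H) (r1 j + ost (r2 j)) (r3 j).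
  have := vnD (onm_vnorm H) (r1 j) (ost (r2 j)); rewrite onm_st -/(r j); lra.
have phid j x : eqm ((t * D j) x) (phi (d j x)).
  rewrite /D mulrBr opB; apply: eqm_trans (eqmB (tcs _ _) (tcs _ _)) _.
  apply: eqm_trans (eqm_sym (eqm_phiB _ _)) _; rewrite -opB.
  rewrite (_ : _ - _ = d j); first exact: eqm_refl.
  by rewrite /d /dw /a; abel.
have er2 j x : eqm (ost (r2 j) x) (phi (d j x) - a (nu j.-1) (phi (d j x))).
  rewrite /r2 -mulrA ostM opM /d /dw (sd (nu j)) -/(dw nu j) -/d.
  by apply: eqm_trans (ost_tcs _ _) _; rewrite opB op1; exact: eqm_refl.
have er1 j x : eqm (r1 j x) (a (nu j.+2) (phi (d j x))).
  by rewrite /r1 -mulrA opM; apply: eqm_op; exact: phid.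
have er3 j x : eqm (r3 j x) (w j (phi (d j (a (N j) x)))).
  have -> : r3 j = w j * (t * D j * a (N j)).
    by rewrite /r3 -!mulrA; congr (_ * (_ * _)); rewrite /D mulrBr mulrBl !cs_comm.
  by rewrite opM; apply: eqm_op; rewrite opM; exact: phid.
have eu j x : eqm ((w j * u j * d j) x)
    (w j (phi (d j x)) - w j (phi (d j (a (N j) x)))).
  rewrite !opM -ofnB; apply: eqm_op.
  apply: eqm_trans (eqm_sym ((hu0 (N j)).2 _)) _; apply: eqm_trans (tcs _ _) _.
  rewrite -/(a (N j)) opB op1; apply: eqm_trans (eqm_phiB _ _) _.
  rewrite (_ : a (N j) (d j x) = d j (a (N j) x)); first exact: eqm_refl.
  rewrite -!opM; congr (ofn _ _); rewrite /d /dw mulrBr mulrBl /a.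
  by rewrite -!exprD addnC [(_ + (nu j.+1).*2)%N]addnC.
have eS j x : eqm ((w j * u j * d j + r j) x) (phi (d j x)).
  rewrite opD /r !opD.
  apply: eqm_trans (eqmD (eu j x) (eqmD (eqmD (er1 j x) (er2 j x)) (er3 j x))) _.
  set z := phi (d j x); set z' := phi (d j _); rewrite /w /ww !opB /eqm.
  rewrite (_ : _ - z = 0); first exact: emem0.
  abel.
pose S n : op H := \sum_(0 <= j < n) (w j * u j * d j + r j).
have SE n x : eqm (S n x) (phi ((1 - a (nu n)) x)).
  rewrite /S; elim: n => [|n IH].
    rewrite big_geq // nu0 /a expr0 subrr !op0.
    by have := eqm_phiB 0 0; rewrite !subrr => /eqm_sym.
  rewrite big_nat_recr //= opD; apply: eqm_trans (eqmD IH (eS n x)) _.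
  apply: eqm_trans (eqm_sym (eqm_phiD _ _)) _; rewrite -opD.
  rewrite (_ : 1 - a (nu n) + d n = 1 - a (nu n.+1)); first exact: eqm_refl.
  by rewrite /d /dw; abel.
have cr (T : nat -> op H) x : (forall j, onm (T j) <= 4 * 2^-1 ^+ j) ->
    cauchy_seq nE (fun n => \sum_(0 <= j < n) T j x).
  move=> hT; have h : cauchy_seq nE (fun n => \sum_(j < n) T j x).
    apply: (@geo_cauchy _ _ _ (nnm_vnorm H) (fun j => T j x) (4 * nE x)) => j.
    by apply: le_trans (onm_leP _ (hT j)) _; rewrite mulrAC.
  move=> e /h[M hM]; exists M => m n Mm Mn; have := hM m n Mm Mn.
  by rewrite !big_mkord.
have Sx n x : S n x = \sum_(0 <= j < n) (w j * u j * d j) x + \sum_(0 <= j < n) r j x.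
  by rewrite /S op_sum -big_split /=; apply: eq_bigr => j _; rewrite opD.
have Ssx n x : ost (S n) x = \sum_(0 <= j < n) (d j * ost (u j) * w j) x +
    \sum_(0 <= j < n) ost (r j) x.
  have -> : ost (S n) = \sum_(0 <= j < n) (ost (w j * u j * d j) + ost (r j)).
    rewrite /S (big_morph (@ost _ _ _ _ H) (@ostD _ _ _ _ H) (ust0 (op_cstar H))).
    by apply: eq_bigr => j _; rewrite ostD.
  rewrite op_sum -big_split /=; apply: eq_bigr => j _; rewrite opD !ostM.
  by rewrite /d /w /dw /ww !sd !mulrA.
have cS x : exists l, converges_to nE (fun n => S n x) l.
  apply: ncomplete; have := cauchyD (nnm_vnorm H)
    (strict_cauchy nuS (ltW C0) hu x) (cr r x hr).
  by move=> h e /h[M hM]; exists M => m n Mm Mn; rewrite !Sx; exact: hM.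
have cSs x : exists l, converges_to nE (fun n => ost (S n) x) l.
  have hrs j : onm (ost (r j)) <= 4 * 2^-1 ^+ j by rewrite onm_st.
  apply: ncomplete; have := cauchyD (nnm_vnorm H)
    (strict_cauchy_adj nuS (ltW C0) hu x) (cr _ x hrs).
  by move=> h e /h[M hM]; exists M => m n Mm Mn; rewrite !Ssx; exact: hM.
have [Phi hPhi] := choice cS; have [Psi hPsi] := choice cSs.
exists Phi, Psi; split=> [x y|x y].
  apply: (cvgt_unique (cnorm_vnorm cA) (nip_cvgl y (hPhi x))).
  move=> e /(nip_cvgr x (hPsi y))[M hM]; exists M => n /hM.
  by rewrite -ost_adj.
rewrite nipBr.
have nu_ge j : (j <= nu j)%N by elim: j => // j IH; exact: leq_ltn_trans IH (nuS j).
have ax : converges_to nE (fun n => (1 - a (nu n)) x) x.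
  apply: (cvgt_tends0 (v := fun n => nE ((s ^+ n) x))) => // n.
  rewrite opB op1 (_ : x - _ - x = - a (nu n) x); last by abel.
  rewrite (vnN (nnm_vnorm H)) /a.
  have -> : (nu n).*2 = ((nu n).*2 - n + n)%N.
    by rewrite subnK // (leq_trans (nu_ge n)) // -addnn leq_addr.
  rewrite exprD opM -[leRHS]mul1r; apply: onm_leP; exact: onm_sX.
(* To avoid passing to the limit inside [phi], it is moved to [y]: [<y, S n x>] and
   [<phi y, (1 - a (nu n)) x>] agree modulo [I], both converge, and [I] is closed. *)
have h1 : I (ip y (Phi x) - ip (phi y) x).
  apply: (@id_limit _ _ _ _ hI (fun n => ip y (S n x) - ip (phi y) ((1 - a (nu n)) x))).
    move=> n; apply: (@id_trans _ _ _ _ hI _ (ip y (phi ((1 - a (nu n)) x)))).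
      by rewrite -nipBr; exact: SE.
    apply: (id_sym hI); exact: hphi.
  by apply: (cvgtB (cnorm_vnorm cA)); apply: nip_cvgr.
exact: (id_trans hI h1 (hphi y x)).
Qed.

End Core.

(** * Countably generated modules and direct sums *)

Section Generated.
Variables (R : realType) (A : lmodType R[i]) (cA : cstar_algebra A).
Variables (I : A -> Prop) (hI : closed_ideal cA I).
Variables (E : lmodType R[i]) (H : nmod cA E).
Hypothesis hpos : forall x, Pos cA (nip H x x).
Local Notation "a ** b" := (cmul cA a b) (at level 40, left associativity).
Local Notation nA := (cnorm cA).
Local Notation st := (cstar cA).
Local Notation ip := (nip H).
Local Notation nE := (nnm H).
Local Notation leA := (leA cA).
Implicit Types (x y : E) (T : op H).

Lemma onm_othe x y : onm (othe H x y) <= nE x * nE y.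
Proof.
apply: onm_le => [|w]; first by rewrite mulr_ge0 ?nnm_ge0.
rewrite otheE; apply: le_trans (nnm_act _ _ _) _.
by rewrite -mulrA ler_wpM2l ?nnm_ge0 // nip_cs.
Qed.

Lemma op_othe T x y : T * othe H x y = othe H (T x) y.
Proof. by apply: op_ext => w; rewrite opM !otheE ofn_act. Qed.

Definition rank1_sum (c : nat -> R) (x y : nat -> E) n : op H :=
  \sum_(i < n) osc H (c i) * othe H (x i) (y i).

Lemma rank1_series (c : nat -> R) (x y : nat -> E) : (forall n, 0 <= c n) ->
  (forall n, c n * (nE (x n) * nE (y n)) <= 2^-1 * 2^-1 ^+ n) ->
  exists2 T, converges_to (@onm _ _ _ _ H) (rank1_sum c x y) T & onm T <= 1.
Proof.
move=> c0 hc.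
have h n : onm (osc H (c n) * othe H (x n) (y n)) <= 2^-1 * 2^-1 ^+ n.
  apply: le_trans (onm_osc_ge0 _ (c0 n)) (le_trans _ (hc n)).
  by rewrite ler_wpM2l // onm_othe.
have [T hT T1] := geo_series (onm_vnorm H) (@onm_complete _ _ _ _ H) h.
by exists T => //; move: T1; rewrite mulfV // pnatr_eq0.
Qed.

Lemma rank1_sumE c (x y : nat -> E) n w v : ip v (rank1_sum c x y n w) =
  \sum_(i < n) (c i)%:C *: (ip v (x i) ** ip (y i) w).
Proof.
rewrite op_sum nip_sumr; apply: eq_bigr => i _.
by rewrite opM oscE nipZr otheE nip_act.
Qed.

Lemma rank1_sum_lim c (x y : nat -> E) T w v : converges_to (@onm _ _ _ _ H) (rank1_sum c x y) T ->
  converges_to nA (fun n => \sum_(i < n) (c i)%:C *: (ip v (x i) ** ip (y i) w)) (ip v (T w)).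
Proof.
move=> /(op_cvg w) /(nip_cvgr v) h e /h[N hN]; exists N => n /hN.
by rewrite rank1_sumE.
Qed.

Lemma rank1_st c (x y : nat -> E) T S : converges_to (@onm _ _ _ _ H) (rank1_sum c x y) T ->
  converges_to (@onm _ _ _ _ H) (rank1_sum c y x) S -> ost T = S.
Proof.
move=> hT hS; apply: op_st_ext => v w; rewrite [RHS]nip_sym.
apply: (cvgt_unique (cnorm_vnorm cA) (rank1_sum_lim w v hT)).
have h0 := rank1_sum_lim v w hS.
have lip (a b : A) : nA (st a - st b) <= 1 * nA (a - b).
  by rewrite mul1r -cstarN -cstarD cnorm_star.
move=> e /(cvgt_map (cnorm_vnorm cA) lip h0)[N hN]; exists N => n /hN.
rewrite (big_morph st (@cstarD _ _ cA) (@cstar0 _ _ cA)).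
by rewrite (eq_bigr (fun i : 'I_n => (c i)%:C *: (ip v (x i) ** ip (y i) w))) // => i _;
  rewrite cstar_real cstarM -!nip_sym.
Qed.

(** Contractions tending strongly to [0] tend to [0] in norm against a norm limit of finite rank
    operators: check rank one terms, and bound the tail by [|P n| <= 1]. *)
Lemma vanish_series c (x y : nat -> E) T (P : nat -> op H) :
  converges_to (@onm _ _ _ _ H) (rank1_sum c x y) T -> (forall n, 0 <= c n) ->
  (forall n, onm (P n) <= 1) -> (forall w, tends0 (fun n => nE (P n w))) ->
  tends0 (fun n => onm (P n * T)).
Proof.
move=> hT c0 hP hv.
have part N : tends0 (fun n => onm (P n * rank1_sum c x y N)).
  elim: N => [|N IH].
    move=> e e0; exists 0%N => n _.
    by rewrite /rank1_sum big_ord0 mulr0 (vn0 (onm_vnorm H)).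
  have h1 := tends0M (c N * nE (y N)) (hv (x N)) (fun n => nnm_ge0 _ _).
  move=> e e0; have e2 : 0 < e / 2 by lra.
  have [M1 hM1] := h1 _ e2; have [M2 hM2] := IH _ e2.
  exists (maxn M1 M2) => n; rewrite geq_max => /andP[/hM1 n1 /hM2 n2].
  rewrite /rank1_sum big_ord_recr /= -/(rank1_sum c x y N) mulrDr.
  apply: le_lt_trans (onmD _ _) _.
  have -> : P n * (osc H (c N) * othe H (x N) (y N)) = osc H (c N) * othe H (P n (x N)) (y N).
    by rewrite mulrA -[P n * _]oscaleC -mulrA op_othe.
  have := onm_osc_ge0 (othe H (P n (x N)) (y N)) (c0 N).
  have := ler_wpM2l (c0 N) (onm_othe (P n (x N)) (y N)).
  rewrite [nE (P n _) * _]mulrC mulrA; lra.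
move=> e e0; have e2 : 0 < e / 2 by lra.
have [N /(_ N (leqnn N)) hN] := hT _ e2; have [M hM] := part N _ e2.
exists M => n /hM hn.
have -> : P n * T = P n * rank1_sum c x y N - P n * (rank1_sum c x y N - T) by ncring.
have := vnB (onm_vnorm H) (P n * rank1_sum c x y N) (P n * (rank1_sum c x y N - T)).
have := onmM (P n) (rank1_sum c x y N - T).
have := onm_ge0 (rank1_sum c x y N - T); have := hP n; have := onm_ge0 (P n); nra.
Qed.

Lemma Pos_sum_sub (F : nat -> A) i n : (forall j, Pos cA (F j)) ->
  Pos cA (\sum_(j < n + i.+1) F j - F i).
Proof.
move=> hF; elim: n => [|n IH].
  rewrite big_ord_recr /= addrK; apply: (big_ind (Pos cA)) => //; first exact: Pos0.
  exact: PosD.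
by rewrite addSn big_ord_recr /= addrAC; exact: PosD.
Qed.

Variable phi : E -> E.
Hypothesis hphi : forall x y, I (ip (phi x) y - ip x (phi y)).
Variable G : nat -> E.
(** Generation as an induction principle over closed submodules, the form in which [s^n x -> 0]
    extends from the generators to all [x]. *)
Hypothesis hG : forall Z : E -> Prop, (forall i, Z (G i)) ->
  (forall x y, Z x -> Z y -> Z (x + y)) -> (forall (z : R[i]) x, Z x -> Z (z *: x)) ->
  (forall x a, Z x -> Z (nact H x a)) -> (forall x, in_closure nE Z x -> Z x) ->
  forall x, Z x.

Lemma generated_lift : exists Phi Psi : E -> E,
  (forall x y, ip (Phi x) y = ip x (Psi y)) /\ forall x, emem I H (Phi x - phi x).
Proof.
(* One sequence of coefficients must serve [k], [t] and the adjoint of [t], so [den] dominates all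
   three products of norms. The extra [2^-1] in [c] makes the series sum to at most [1], so that [k]
   is a contraction. *)
pose den n := 1 + nE (G n) * nE (G n) + nE (phi (G n)) * nE (G n).
have p1 n : 0 <= nE (G n) * nE (G n) by rewrite mulr_ge0 ?nnm_ge0.
have p2 n : 0 <= nE (phi (G n)) * nE (G n) by rewrite mulr_ge0 ?nnm_ge0.
have den0 n : 0 < den n by have := p1 n; have := p2 n; rewrite /den; lra.
pose c n : R := 2^-1 * 2^-1 ^+ n / den n.
have cp n : 0 < c n by rewrite divr_gt0 // mulr_gt0 ?geo_gt0 // invr_gt0 ltr0n.
have c0 n : 0 <= c n by exact: ltW.
have hc n (b : R) : b <= den n -> c n * b <= 2^-1 * 2^-1 ^+ n.
  move=> bd; rewrite /c mulrAC ler_pdivrMr // ler_wpM2l //.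
  by rewrite mulr_ge0 ?(ltW (geo_gt0 R n)) // invr_ge0 ler0n.
clearbody c.
have d1 n : nE (G n) * nE (G n) <= den n by have := p2 n; rewrite /den; lra.
have d2 n : nE (phi (G n)) * nE (G n) <= den n by have := p1 n; rewrite /den; lra.
have d3 n : nE (G n) * nE (phi (G n)) <= den n by rewrite mulrC.
have [k hk k1n] := rank1_series c0 (fun n => hc n _ (d1 n)).
have [t ht _] := @rank1_series c (phi \o G) G c0 (fun n => hc n _ (d2 n)).
have [t' ht' _] := @rank1_series c G (phi \o G) c0 (fun n => hc n _ (d3 n)).
have sk : ost k = k := rank1_st hk hk.
have stt : ost t = t' := rank1_st ht ht'.
have posF x i : Pos cA ((c i)%:C *: (ip x (G i) ** ip (G i) x)).
  by apply: PosR => //; rewrite nip_sym; exact: Pos_stM.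
have kge i x : leA ((c i)%:C *: (ip x (G i) ** ip (G i) x)) (ip x (k x)).
  apply: (@Pos_limit _ _ _ (fun n => \sum_(j < n + i.+1)
    (c j)%:C *: (ip x (G j) ** ip (G j) x) - (c i)%:C *: (ip x (G i) ** ip (G i) x))).
    move=> n; exact: (Pos_sum_sub (F := fun j => (c j)%:C *: (ip x (G j) ** ip (G j) x))).
  apply: (cvgtB (cnorm_vnorm cA)); last exact: (cvgt_cst (cnorm_vnorm cA)).
  apply: (cvgt_sub (u := fun n => \sum_(j < n) (c j)%:C *: (ip x (G j) ** ip (G j) x))
    (f := fun n => (n + i.+1)%N)); first by move=> n; exact: leq_addr.
  exact: rank1_sum_lim hk.
have k0 : opos k by move=> x; exact: (leA_Pos (posF x 0%N) (kge 0%N x)).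
have k1 : opos (1 - k) by apply: opos_1B.
pose s := 1 - k.
have s1 n : onm (s ^+ n) <= 1 by exact: onm_sX.
have sG i : tends0 (fun n => nE ((s ^+ n) (G i))).
  set g := G i.
  (* With [h = s^(2m) g], the [i]-th term of [k] gives [c_i <h, g> <g, h> <= <h, k h>], and
     [sXk_bound] with exponent [2m] gives [(4m + 1) <h, k h> <= <g, g>]. As [<g, h>] is the inner
     square of [s^m g], a fourth power appears. *)
  have key m : c i * nE ((s ^+ m) g) ^+ 4 <= nE g ^+ 2 / m.+1%:R.
    set h := (s ^+ m.*2) g.
    have e1 : ip g h = ip ((s ^+ m) g) ((s ^+ m) g).
      by rewrite /h -addnn exprD opM ost_adj' (ost_sX sk).
    have N0 : 0 <= (m.*2.*2.+1)%:R :> R by exact: ler0n.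
    have := leA_trans (leAR N0 (kge i h)) (sXk_bound hpos sk k1 m.*2 g).
    rewrite scalerA -rmorphM => h1.
    have p : Pos cA (((m.*2.*2.+1)%:R * c i)%:C *: (ip h g ** ip g h)).
      by apply: PosR; [rewrite mulr_ge0 | rewrite nip_sym; exact: Pos_stM].
    have := Pos_mono p h1; rewrite cnorm_real ger0_norm ?mulr_ge0 //.
    rewrite [ip h g]nip_sym cnorm_cstar_id e1 -nnm_sqr -exprM -nnm_sqr => h2.
    rewrite ler_pdivlMr ?ltr0n //; apply: le_trans h2.
    rewrite mulrC mulrA ler_wpM2r ?exprn_ge0 ?nnm_ge0 // ler_wpM2r //.
    by rewrite ler_nat ltnS -!addnn -addnA leq_addr.
  move=> e e0; have K0 := mulr_gt0 (cp i) (exprn_gt0 4 e0).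
  have [N hN] := tends0_inv (nE g ^+ 2) K0; exists N => n /hN h.
  rewrite ltNge; apply/negP => en; have := le_lt_trans (key n) h; apply/negP.
  by rewrite -leNgt ler_wpM2l // lerXn2r ?nnegrE ?nnm_ge0 // ltW.
have sv : forall x, tends0 (fun n => nE ((s ^+ n) x)).
  apply: (hG (Z := fun x => tends0 (fun n => nE ((s ^+ n) x)))).
  - exact: sG.
  - move=> x y hx hy e e0; have e2 : 0 < e / 2 by lra.
    have [M1 hM1] := hx _ e2; have [M2 hM2] := hy _ e2.
    exists (maxn M1 M2) => n; rewrite geq_max => /andP[/hM1 n1 /hM2 n2].
    by rewrite ofnD; apply: le_lt_trans (vnD (nnm_vnorm H) _ _) _; lra.
  - move=> z x hx; apply: tends0_le (tends0M (onm (oscale H z)) hx _).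
      by move=> n; rewrite ofnZ -(oscaleE H); exact: onmP.
    by move=> n; exact: nnm_ge0.
  - move=> x a hx; apply: tends0_le (tends0M (nA a) hx _).
      by move=> n; rewrite ofn_act mulrC; exact: nnm_act.
    by move=> n; exact: nnm_ge0.
  - move=> x hx e e0; have e2 : 0 < e / 2 by lra.
    have [y [hy xy]] := hx _ e2; have [M hM] := hy _ e2; exists M => n /hM hn.
    rewrite -[x](subrK y) ofnD; apply: le_lt_trans (vnD (nnm_vnorm H) _ _) _.
    by have := onm_leP (x - y) (s1 n); rewrite mul1r; lra.
apply: (@core _ _ _ _ hI _ H hpos phi hphi k t sk k0 k1 sv).
- exact: (vanish_series ht c0 s1 sv).
- have := vanish_series ht' c0 s1 sv; apply: tends0_le => n.
  by rewrite -onm_st ostM (ost_sX sk) stt.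
(* [<y, t x>] and [<phi y, k x>] are compared term by term: each difference contains
   [<y, phi G_i> - <phi y, G_i>], which lies in [I], and [I] is closed. *)
move=> x y; rewrite nipBr.
apply: (@id_trans _ _ _ _ hI _ (ip (phi y) (k x))); last exact: hphi.
apply: (@id_limit _ _ _ _ hI (fun n =>
  \sum_(i < n) (c i)%:C *: (ip y (phi (G i)) ** ip (G i) x) -
  \sum_(i < n) (c i)%:C *: (ip (phi y) (G i) ** ip (G i) x))); last first.
  by apply: (cvgtB (cnorm_vnorm cA)); [exact: rank1_sum_lim ht | exact: rank1_sum_lim hk].
move=> n; rewrite -sumrB; apply: (big_ind I); [exact: (id0 hI) | exact: (idD hI) |].
move=> i _; rewrite -scalerBr -cmulBl; apply: (idZ hI); apply: (idMr hI).
apply: (id_sym hI); exact: hphi.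
Qed.

End Generated.

(** * The direct sum of two Hilbert modules *)

Section DirectSum.
Variables (R : realType) (A : lmodType R[i]) (cA : cstar_algebra A).
Local Notation "a ** b" := (cmul cA a b) (at level 40, left associativity).
Local Notation nA := (cnorm cA).
Local Notation st := (cstar cA).

Lemma cpositive_Pos (a : A) : cpositive cA a -> Pos cA a.
Proof. by case=> b ->; exact: Pos_stM. Qed.

Variables (M N : lmodType R[i]) (hM : hilbert_module cA M) (hN : hilbert_module cA N).

Definition sum_ip (x y : M * N) : A := ip hM x.1 y.1 + ip hN x.2 y.2.
Definition sum_act (x : M * N) (a : A) : M * N := (ract hM x.1 a, ract hN x.2 a).
Definition sum_nm (x : M * N) : R := Num.sqrt (nA (sum_ip x x)).

Lemma sum_ipD x y y' : sum_ip x (y + y') = sum_ip x y + sum_ip x y'.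
Proof. by rewrite /sum_ip /= !ipD; abel. Qed.
Lemma sum_ipZ (z : R[i]) x y : sum_ip x (z *: y) = z *: sum_ip x y.
Proof. by rewrite /sum_ip /= !ipZ scalerDr. Qed.
Lemma sum_ip_act x y a : sum_ip x (sum_act y a) = sum_ip x y ** a.
Proof. by rewrite /sum_ip /= !ip_ract cmulDl. Qed.
Lemma sum_ip_sym x y : sum_ip y x = st (sum_ip x y).
Proof. by rewrite /sum_ip cstarD -!ip_sym. Qed.

Lemma ipM_pos x : Pos cA (ip hM x x).
Proof. by apply: cpositive_Pos; exact: ip_pos. Qed.
Lemma ipN_pos x : Pos cA (ip hN x x).
Proof. by apply: cpositive_Pos; exact: ip_pos. Qed.
Lemma sum_pos x : Pos cA (sum_ip x x).
Proof. by apply: PosD; [exact: ipM_pos | exact: ipN_pos]. Qed.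

Lemma hnormM_le (x : M * N) : hnorm hM x.1 <= sum_nm x.
Proof.
rewrite /hnorm /sum_nm; apply: ler_wsqrtr; apply: Pos_mono; first exact: ipM_pos.
by rewrite /sum_ip addrAC subrr add0r; exact: ipN_pos.
Qed.

Lemma hnormN_le (x : M * N) : hnorm hN x.2 <= sum_nm x.
Proof.
rewrite /hnorm /sum_nm; apply: ler_wsqrtr; apply: Pos_mono; first exact: ipN_pos.
by rewrite /sum_ip addrK; exact: ipM_pos.
Qed.

Lemma sum_nm_le (x : M * N) : sum_nm x <= hnorm hM x.1 + hnorm hN x.2.
Proof.
rewrite /sum_nm /hnorm; set p := nA (ip hM _ _); set r := nA (ip hN _ _).
have p0 : 0 <= p := cnorm_ge0 cA _; have r0 : 0 <= r := cnorm_ge0 cA _.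
rewrite -[leRHS]ger0_norm ?addr_ge0 ?sqrtr_ge0 // -sqrtr_sqr; apply: ler_wsqrtr.
apply: le_trans (cnormD _ _ _) _; rewrite -/p -/r sqrrD !sqr_sqrtr //.
by rewrite addrAC lerDl mulrn_wge0 // mulr_ge0 ?sqrtr_ge0.
Qed.

Lemma sum_nm_sqr x : sum_nm x ^+ 2 = nA (sum_ip x x).
Proof. by rewrite /sum_nm sqr_sqrtr // cnorm_ge0. Qed.

Lemma sum_complete : complete_for sum_nm.
Proof.
move=> u hu.
have [l1 h1] : exists l, converges_to (hnorm hM) (fun n => (u n).1) l.
  apply: (@hcomplete _ _ _ _ hM) => e /hu[K hK]; exists K => m n Km Kn.
  exact: le_lt_trans (hnormM_le (u m - u n)) (hK _ _ Km Kn).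
have [l2 h2] : exists l, converges_to (hnorm hN) (fun n => (u n).2) l.
  apply: (@hcomplete _ _ _ _ hN) => e /hu[K hK]; exists K => m n Km Kn.
  exact: le_lt_trans (hnormN_le (u m - u n)) (hK _ _ Km Kn).
exists (l1, l2) => e e0; have e2 : 0 < e / 2 by lra.
have [K1 hK1] := h1 _ e2; have [K2 hK2] := h2 _ e2.
exists (maxn K1 K2) => n; rewrite geq_max => /andP[/hK1 n1 /hK2 n2].
by apply: le_lt_trans (sum_nm_le _) _; rewrite /=; lra.
Qed.

Definition summod : nmod cA (M * N)%type.
Proof.
refine (@NMod R A cA _ sum_ip sum_act sum_nm sum_ipD sum_ipZ sum_ip_act sum_ip_sym
  _ sum_nm_sqr _ _ sum_complete).
- by move=> x; exact: sqrtr_ge0.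
- move=> [x y] h; have := hnormM_le (x, y); have := hnormN_le (x, y); rewrite h /=.
  have z (p : R) : Num.sqrt p <= 0 -> 0 <= p -> p = 0.
    move=> p1 p0; have e : Num.sqrt p = 0 by apply/eqP; rewrite eq_le p1 sqrtr_ge0.
    by rewrite -(sqr_sqrtr p0) e expr0n.
  move=> /z /(_ (cnorm_ge0 cA _)) /cnorm_eq0 /ip_def -> /z.
  by move=> /(_ (cnorm_ge0 cA _)) /cnorm_eq0 /ip_def ->.
- move=> x y; rewrite -(ler_pXn2r (n := 2)) ?nnegrE ?mulr_ge0 ?sqrtr_ge0 ?cnorm_ge0 //.
  rewrite exprMn !sum_nm_sqr.
  exact: (cs_norm sum_ipD sum_ipZ sum_ip_act sum_ip_sym sum_pos).
Defined.

End DirectSum.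

Theorem theorem2p1 (R : realType) (A : lmodType R[i]) (cA : cstar_algebra A)
    (I : A -> Prop) (hI : closed_ideal cA I)
    (M N : lmodType R[i]) (hM : hilbert_module cA M) (hN : hilbert_module cA N)
    (cgM : countably_generated hM) (cgN : countably_generated hN)
    (phi : M -> N) (hphi : quotient_adjointable_lift I hM hN phi) :
  exists Phi : M -> N, adjointable hM hN Phi /\
    forall m : M, modMI hN I (Phi m - phi m).
Proof.
case: hphi => _ [psi [_ hpsi]]; case: cgM => gM hgM; case: cgN => gN hgN.
pose H := summod hM hN.
pose f (x : M * N) : M * N := (psi x.2, phi x.1).
pose G n : M * N := if odd n then (0, gN n./2) else (gM n./2, 0).
have hf x y : I (nip H (f x) y - nip H x (f y)).
  (* The second relation is used after applying the involution, under which a closed ideal is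
     stable. *)
  have h1 := hpsi x.1 y.2; have h2 := id_star hI (hpsi y.1 x.2).
  rewrite cstarD cstarN -!ip_sym in h2; have := idB hI h1 h2.
  rewrite /= /sum_ip /=.
  rewrite (_ : ip hN (phi x.1) y.2 - ip hM x.1 (psi y.2) -
    (ip hN x.2 (phi y.1) - ip hM (psi x.2) y.1) =
    ip hM (psi x.2) y.1 + ip hN (phi x.1) y.2 -
    (ip hM x.1 (psi y.2) + ip hN x.2 (phi y.1))) //; abel.
have hG (Z : M * N -> Prop) : (forall i, Z (G i)) ->
  (forall x y, Z x -> Z y -> Z (x + y)) -> (forall (z : R[i]) x, Z x -> Z (z *: x)) ->
  (forall x a, Z x -> Z (nact H x a)) -> (forall x, in_closure (nnm H) Z x -> Z x) ->
  forall x, Z x.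
  move=> ZG ZD ZZ ZA ZC.
  have Z0 : Z 0 by rewrite -(scale0r (G 0%N)); exact: ZZ.
  have ip0 (P : lmodType R[i]) (h : hilbert_module cA P) (y : P) : ip h y 0 = 0.
    by rewrite -(scale0r (0 : P)) ipZ !scale0r.
  have ract0 (P : lmodType R[i]) (h : hilbert_module cA P) a : ract h 0 a = 0.
    by rewrite -(scale0r (0 : P)) ractZl !scale0r.
  have ZM x : Z (x, 0).
    apply: ZC => e /(hgM x)[y [[n [c [d [j [a ->]]]]] hy]].
    set y' := \sum_(_ < n) _ in hy *.
    exists (y', 0); split; last first.
      apply: le_lt_trans (sum_nm_le _ _ _) _; rewrite /= subrr {2}/hnorm ip0 cnorm0 sqrtr0.
      by rewrite addr0.
    have -> : (y', 0) = \sum_(i < n) (c i *: G (j i).*2 + d i *: nact H (G (j i).*2) (a i)).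
      apply: (big_ind2 (fun (u : M) (v : M * N) => (u, 0) = v)) => //.
        by move=> x1 ? x2 ? <- <-; congr (_, _); rewrite /= addr0.
      move=> i _; rewrite /G odd_double doubleK /= /sum_act /= ract0.
      congr (_, _) => /=; by rewrite !scaler0 !addr0.
    by apply: (big_ind Z) => // i _; apply: ZD; apply: ZZ => //; apply: ZA.
  have ZN x : Z (0, x).
    apply: ZC => e /(hgN x)[y [[n [c [d [j [a ->]]]]] hy]].
    set y' := \sum_(_ < n) _ in hy *.
    exists (0, y'); split; last first.
      apply: le_lt_trans (sum_nm_le _ _ _) _; rewrite /= subrr {1}/hnorm ip0 cnorm0 sqrtr0.
      by rewrite add0r.
    have -> : (0, y') = \sum_(i < n) (c i *: G (j i).*2.+1 + d i *: nact H (G (j i).*2.+1) (a i)).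
      apply: (big_ind2 (fun (u : N) (v : M * N) => (0, u) = v)) => //.
        by move=> x1 ? x2 ? <- <-; congr (_, _); rewrite /= addr0.
      move=> i _; rewrite /G /= odd_double /= uphalf_double /= /sum_act /= ract0.
      congr (_, _) => /=; by rewrite !scaler0 !addr0.
    by apply: (big_ind Z) => // i _; apply: ZD; apply: ZZ => //; apply: ZA.
  move=> [x y]; have -> : (x, y) = (x, 0) + (0, y).
    by congr (_, _) => /=; rewrite ?addr0 ?add0r.
  exact: ZD.
have hpos x : Pos cA (nip H x x) by exact: sum_pos.
have [Phi [Psi [hadj hmem]]] := generated_lift hI hpos hf hG.
have ip0r (P : lmodType R[i]) (h : hilbert_module cA P) (y : P) : ip h y 0 = 0.
  by rewrite -(scale0r (0 : P)) ipZ !scale0r.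
have ip0l (P : lmodType R[i]) (h : hilbert_module cA P) (y : P) : ip h 0 y = 0.
  by rewrite ip_sym ip0r cstar0.
(* The corner of [Phi] from [M] to [N]; its adjoint is the opposite corner of [Psi]. *)
exists (fun m => (Phi (m, 0)).2); split.
  exists (fun n => (Psi (0, n)).1) => x y.
  by have := hadj (x, 0) (0, y); rewrite /= /sum_ip /= ip0r add0r ip0l addr0.
move=> m; set z := _ - phi m.
(* Testing the error against [(0, z)] leaves only its component in [N], which is [z] itself. *)
have Iz : I (ip hN z z).
  have := hmem (m, 0) (0, z).
  by rewrite /= /sum_ip /= ip0l add0r.
(* From [<z, z>] in [I] to the closed span: by [zseq], computed in the direct sum, [z] is a limit of
   products [z b] with [b] in [I]. *)
pose v : M * N := (0, z).
have vE : nip H v v = ip hN z z by rewrite /= /sum_ip /= ip0l add0r.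
pose l := (cnorm cA (nip H v v) + 1)^-1.
have X0 := cnorm_ge0 cA (nip H v v).
have lp : 0 < l by rewrite invr_gt0; lra.
have l1 : l * cnorm cA (nip H v v) <= 1.
  by rewrite /l mulrC ler_pdivrMr; lra.
move=> e e0; have [n hn] := zseq_small hpos (ltW lp) l1 e0 lp.
have Iv : I (nip H v v) by rewrite vE.
have [b Ib hb] := zseq_ideal l hI n Iv.
exists (ract hN z b); split.
  exists 1%N, (fun=> 1), (fun=> z), (fun=> b); split=> //.
  by rewrite big_ord_recr big_ord0 /= add0r scale1r.
apply: le_lt_trans hn; rewrite hb.
exact: (hnormN_le hM hN (v - nact H v b)).
Qed.
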